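(* Let $g\in\mathbb{N}$, $n\in\mathbb{N}_{>0}$ and let $\mathbf{c}=(c_\gamma)_\gamma$ be circle parameters in $\mathbb{K}$. The poset $\Lambda$, the sets $M_\lambda=N_\lambda$, the algebras $S_\lambda$ with bases $B_\lambda$, the elements $c^\lambda_{D,b,U}$ and the antiinvolution ${}^\star$ described in the context define an involutive sandwich cell datum for the handlebody Temperley–Lieb algebra $\mathrm{TL}_{g,n}(\mathbf{c})$.
   Context: $\mathbb{K}$ is a unital, commutative, Noetherian domain and $\mathrm{F}_g$ is the free group in $g$ generators. Diagrams. A crossingless matching of $2n$ points of genus $g$ is a pairing of the integers $\{1,\dots,2n\}$ (the boundary points, $n$ at the bottom and $n$ at the top) such that $i<j<k<l$ never occurs for pairs $(i,k)$ and $(j,l)$, together with a choice of a reduced word in $\mathrm{F}_g$ for each appearing pair. These are drawn (in slightly misleading pictures) as crossingless matchings whose strands can wind around $g$ core strands at the left, but not among themselves; winding once around the $u$th core (a coil $\tau_u$) corresponds to the $u$th generator of $\mathrm{F}_g$. The word of a strand is read from its rightmost boundary point to the other one. Algebra. $\mathrm{TL}_{g,n}(\mathbf{c})$ is the $\mathbb{K}$-linear span of all these diagrams. The product $xy$ is concatenation ($x$ at the bottom, $y$ on top), with words concatenated reading bottom to top along strands, respectively starting anywhere and moving clockwise along closed components, modulo circle evaluation: a circle, read clockwise, gives an element $\gamma$ of $\mathrm{F}_g$ up to conjugation; it is removed and contributes a factor $c_\gamma\in\mathbb{K}$. The parameters $\mathbf{c}=(c_\gamma)_\gamma$ are constant on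 conjugacy classes and otherwise arbitrary. Datum. $\Lambda=\{n,n-2,n-4,\dots\}\subset\mathbb{N}$ with the usual order; $\lambda\in\Lambda$ is the number of through strands. $S_\lambda=\mathbb{K}\mathrm{F}_g$ for $\lambda>0$ and $S_0=\mathbb{K}$ (for $\lambda=0$ the group is taken to be trivial), and $B_\lambda$ is the group element basis. $M_\lambda=N_\lambda$ is the set of crossingless half-diagrams from $n$ bottom points to $\lambda$ top points, having $\lambda$ through strands and otherwise caps, where the caps are allowed to wind around the cores but the through strands are not. For $D,U\in M_\lambda$, $b\in B_\lambda$, the diagram $c^\lambda_{D,b,U}$ is the concatenation, from bottom to top, of the cap diagram $D$, the coils $b$ of the through strands ($\mathrm{F}_g$ corresponding to the leftmost through strand), and $U$ drawn upside down as a cup diagram. ${}^\star$ flips diagrams upside down but keeps positive coils positive and negative coils negative, i.e. it reverses words in $\mathrm{F}_g$ without inverting them. A sandwich cell datum for an associative, unital $\mathbb{K}$-algebra $A$ consists of: a poset $(\Lambda,\le)$; finite sets $M_\lambda$, $N_\lambda$; algebras $S_\lambda$ with fixed bases $B_\lambda$; and a $\mathbb{K}$-basis $\{c^\lambda_{D,b,U}\mid\lambda\in\Lambda, D\in M_\lambda, U\in N_\lambda, b\in B_\lambda\}$ of $A$ such that, with $A^{<\lambda}$ (resp. $A^{\le\lambda}$) the span of all $c^\mu_{D,b,U}$ with $\mu<\lambda$ (resp. $\mu\le\lambda$): (i) for all $x\in A$ there exist scalars $r(S,D)\in\mathbb{K}$ that do not depend on $U$ or on $b$ such that $xc^\lambda_{D,b,U}\equiv\sum_{S\in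 M_\lambda,a\in B_\lambda}r(S,D)c^\lambda_{S,a,U}\pmod{A^{<\lambda}}$, and similarly for right multiplication; (ii) $A^{\le\lambda}/A^{<\lambda}$ is isomorphic to $\Delta(\lambda)\otimes_{S_\lambda}(\lambda)\Delta$ for free graded right and left $S_\lambda$-modules $\Delta(\lambda)$ and $(\lambda)\Delta$, respectively. It is involutive if $M_\lambda=N_\lambda$ for all $\lambda$ and $A$ has an antiinvolution ${}^\star$ that restricts to an antiinvolution of each $S_\lambda$ which is a bijection on $B_\lambda$, with $(c^\lambda_{D,b,U})^\star=c^\lambda_{U,b^\star,D}$.
   Formalization: Repairs: a strand cut off from the cores by another strand has trivial word; M_λ is finite only if g=0 or λ=n; (i) reads x c_{D,b,U} ≡ Σ r(S,a,D) c_{S,ab,U} (mirrored on the right); for n≥2, ⋆ is an antiinvolution assuming c_γ = c_{reversed γ}. *)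

(* Defs.v *)
From HB Require Import structures.
From mathcomp Require Import all_boot all_order all_algebra zify.
From mathcomp Require Import finmap.
From mathcomp.multinomials Require Import monalg.
Set Implicit Arguments.
Unset Strict Implicit.
Unset Printing Implicit Defensive.

Import Order.TTheory GRing.Theory.

(* The free group on g generators as the group of reduced words: the letter
   (u, true) is the u-th generator and (u, false) its inverse. *)

Section FreeGroup.
Variable g : nat.

Definition letter : Type := ('I_g * bool)%type.

Definition linv (x : letter) : letter := (x.1, ~~ x.2).

Definition reduced (w : seq letter) : bool := sorted (fun x y => y != linv x) w.

Record free_group := FreeGroup { fgword :> seq letter; _ : reduced fgword }.

HB.instance Definition _ := [isSub for fgword].
HB.instance Definition _ := [Choice of free_group by <:].

(* Left multiplication of a reduced word by a letter. *)
Definition lcons (x : letter) (w : seq letter) : seq letter :=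
  if w is y :: w' then if y == linv x then w' else x :: w else [:: x].

Lemma linvK : involutive linv.
Proof. by case=> u b; rewrite /linv negbK. Qed.

Lemma lcons_reduced x w : reduced w -> reduced (lcons x w).
Proof.
by case: w => [|y w] //= rw; case: eqP => [_|/eqP yx]; [apply: path_sorted rw | rewrite /= yx].
Qed.

Lemma lconsK x w : reduced w -> lcons (linv x) (lcons x w) = w.
Proof.
case: w => [|y w] /= rw; first by rewrite linvK eqxx.
move: rw; case: (y =P linv x) => [->|_] /=; last by rewrite linvK eqxx.
by case: w => [|z w] //= /andP [/negPf ->].
Qed.

Lemma foldr_reduced u w : reduced w -> reduced (foldr lcons w u).
Proof. by move=> rw; elim: u => //= x u; apply: lcons_reduced. Qed.

Lemma foldr_lcons x v w :
  reduced v -> reduced w -> foldr lcons w (lcons x v) = lcons x (foldr lcons w v).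
Proof.
case: v => [|y v] //= rv rw; case: eqP => [->|] //=.
by rewrite -[X in lcons X]linvK lconsK // foldr_reduced.
Qed.

Lemma foldr_reduce u : reduced u -> foldr lcons [::] u = u.
Proof.
elim: u => //= x [|y u] IH //= /andP [/negPf yx ru].
by move: (IH ru) => /= ->; rewrite /= yx.
Qed.

Definition fmul (u v : free_group) : free_group :=
  FreeGroup (foldr_reduced u (valP v)).

Definition fone : free_group := @FreeGroup [::] isT.

Lemma finv_reduced (u : free_group) : reduced (rev (map linv u)).
Proof.
case: u => u /= ru; rewrite /reduced rev_sorted sorted_map.
apply: sub_sorted ru => x y /=.
by apply: contra => /eqP /(congr1 (@linv)); rewrite !linvK => ->; rewrite linvK.
Qed.

Definition finv (u : free_group) : free_group := FreeGroup (finv_reduced u).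

Fact fmulA : associative fmul.
Proof.
move=> u v w; apply: val_inj => /=.
elim: (u : seq _) => //= x s ->; rewrite foldr_lcons //; last exact: valP.
exact: foldr_reduced (valP v).
Qed.

Fact fmul1 : left_id fone fmul.
Proof. by move=> u; apply: val_inj. Qed.

Fact fmul1r : right_id fone fmul.
Proof. by move=> u; apply: val_inj; rewrite /= foldr_reduce // (valP u). Qed.

Fact fmulV : left_inverse fone finv fmul.
Proof.
move=> [u ru]; apply: val_inj => /=.
elim: u ru => //= x u IH rxu; have ru := path_sorted rxu.
rewrite rev_cons -cats1 foldr_cat /= linvK eqxx.
exact: IH.
Qed.

Fact finvK : involutive finv.
Proof.
by move=> u; apply: val_inj; rewrite /= map_rev revK mapK //; exact: linvK.
Qed.

Fact fmulrV : right_inverse fone finv fmul.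
Proof. by move=> u; rewrite -{1}(finvK u) fmulV. Qed.

HB.instance Definition _ :=
  isGroup.Build free_group fmulA fmul1 fmul1r fmulV fmulrV.

Lemma frev_reduced (u : free_group) : reduced (rev u).
Proof.
case: u => u /= ru; rewrite /reduced rev_sorted; apply: sub_sorted ru => x y /=.
by apply: contra => /eqP ->; rewrite linvK.
Qed.

(* The word read backwards, letters not inverted. *)
Definition frev (u : free_group) : free_group := FreeGroup (frev_reduced u).

Lemma frevK : involutive frev.
Proof. by move=> u; apply: val_inj; rewrite /= revK. Qed.

Lemma frev1 : frev 1%g = 1%g.
Proof. exact: val_inj. Qed.

Lemma frevV u : frev u^-1%g = (frev u)^-1%g.
Proof. by apply: val_inj; rewrite /= revK map_rev revK. Qed.

End FreeGroup.

Notation "''Fr_' g" := (free_group g) (at level 8, g at level 2, format "''Fr_' g").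

Section Diagrams.
Variable g : nat.

Definition pt (m n : nat) : finType := ('I_m + 'I_n)%type.

(* The cores are on the left.  Boundary points are numbered from the cores
   along the bottom line (left to right) and then back along the top line
   (right to left); crossings are detected in this numbering. *)
Definition pos m n (p : pt m n) : nat :=
  match p with inl i => i | inr j => m + (n - j.+1) end.

(* f p = (q, w): p is joined to q, and w is the word of the strand read from
   p to q; hence the word read from q to p is w^-1.
   The last condition expresses that strands wind around the cores but not
   among themselves: a strand having another strand between itself and the
   cores does not wind. *)
Definition is_diagram m n (f : {ffun pt m n -> pt m n * 'Fr_g}) : bool :=
  [&& [forall p, ((f p).1 != p) && ((f (f p).1).1 == p)],
      [forall p, (f (f p).1).2 == (f p).2^-1%g],
      [forall p, forall q, ~~ [&& pos p < pos q, pos q < pos (f p).1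
                                & pos (f p).1 < pos (f q).1]] &
      [forall p, forall q, (pos q < pos p < pos (f q).1) ==> ((f p).2 == 1%g)]].

Record diagram m n := Diagram {
  dgm :> {ffun pt m n -> pt m n * 'Fr_g}; _ : is_diagram dgm }.

HB.instance Definition _ m n := [isSub for @dgm m n].
HB.instance Definition _ m n := [Choice of diagram m n by <:].

Definition mate m n (x : diagram m n) (p : pt m n) : pt m n := (x p).1.
Definition word m n (x : diagram m n) (p : pt m n) : 'Fr_g := (x p).2.

(* A matching of the points in A without crossings, as above. *)
Definition good (P : eqType) (ps : P -> nat) (A : pred P)
    (f : P -> P) (w : P -> 'Fr_g) : Prop :=
  forall p, A p ->
  [/\ A (f p), f p != p, f (f p) = p, w (f p) = (w p)^-1%g &
    forall q, A q -> [/\ ~~ [&& ps p < ps q, ps q < ps (f p) & ps (f p) < ps (f q)]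
      & ps q < ps p < ps (f q) -> w p = 1%g]].

Lemma diagramP m n (f : {ffun pt m n -> pt m n * 'Fr_g}) :
  reflect (good (@pos m n) predT (fun p => (f p).1) (fun p => (f p).2))
          (is_diagram f).
Proof.
apply: (iffP and4P).
  case=> /forallP h1 /forallP h2 /forallP h3 /forallP h4 p _.
  have /andP [h11 /eqP h12] := h1 p.
  split=> //; first exact/eqP/h2.
  move=> q _; split; first exact: (forallP (h3 p) q).
  by have /forallP /(_ q) /implyP h := h4 p => /h /eqP.
move=> h; split; apply/forallP => p; case: (h p isT) => _ h1 h2 h3 h4.
- by rewrite h1 h2 eqxx.
- exact/eqP.
- by apply/forallP => q; case: (h4 q isT).
by apply/forallP => q; apply/implyP; case: (h4 q isT) => _ h5 /h5 /eqP.
Qed.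

Lemma pos_inj m n : injective (@pos m n).
Proof.
move=> [i|j] [i'|j'] /= E.
- by congr inl; apply: val_inj.
- by exfalso; have := ltn_ord i; lia.
- by exfalso; have := ltn_ord i'; lia.
- by congr inr; apply: val_inj => /=; have := ltn_ord j; have := ltn_ord j'; lia.
Qed.

End Diagrams.

(* z lies between x and y, for distinct x, y, z *)
Definition btw (x y z : nat) := (x < z) (+) (y < z).

Lemma btw_nc x y z t : x <> z -> x <> t -> y <> z -> y <> t ->
  btw x y z = btw x y t -> ~~ [&& x < z, z < y & y < t] /\ ~~ [&& z < x, x < t & t < y].
Proof. rewrite /btw; lia. Qed.

Lemma nc_btw x y z t : x <> z -> x <> t -> y <> z -> y <> t ->
  (~~ [&& x < z, z < y & y < t] /\ ~~ [&& y < z, z < x & x < t]) ->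
  (~~ [&& x < t, t < y & y < z] /\ ~~ [&& y < t, t < x & x < z]) ->
  (~~ [&& z < x, x < t & t < y] /\ ~~ [&& z < y, y < t & t < x]) ->
  (~~ [&& t < x, x < z & z < y] /\ ~~ [&& t < y, y < z & z < x]) ->
  btw x y z = btw x y t.
Proof. 
rewrite /btw.
case: (ltngtP x z) => //; case: (ltngtP x t) => //; case: (ltngtP y z) => //; case: (ltngtP y t) => //=; lia.
Qed.

Lemma btw_trans a b a' b' p p' :
  p <> a -> p' <> a -> p <> b -> p' <> b ->
  ~~ (a < p < b) -> ~~ (a < p' < b) -> a < b ->
  btw p p' a = btw p p' a' -> btw p p' b = btw p p' b' -> btw p p' a' = btw p p' b'.
Proof.
move=> ? ? ? ? ? ? ? <- <-; rewrite /btw.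
have -> : (p < a) = (p < b) by lia.
by have -> : (p' < a) = (p' < b) by lia.
Qed.

Lemma btw_in x y z : x < y -> x <> z -> y <> z -> btw x y z = (x < z < y).
Proof. rewrite /btw; lia. Qed.

Lemma btw_split a b a' b' p : p <> a -> p <> b -> ~~ (a < p < b) -> a < b ->
  (b' < p < a') || (a' < p < b') ->
  [|| a < p < a', b < p < b', a' < p < a | b' < p < b].
Proof. lia. Qed.

Section Gluing.
Variable g : nat.

(* Strands with ends in P: the other end, the word read from the given end, and
   the words of the circles closed so far. *)
Record tangle (P : Type) := Tangle {
  tmate : P -> P; tword : P -> 'Fr_g; circles : seq 'Fr_g }.

(* Glue the strand ends a and b.  If they are the ends of one strand this closes
   a circle, which is read starting at a along that strand; otherwise the strand
   from f a to a is continued by the strand from b to f b. *)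
Definition glue (P : eqType) (a b : P) (t : tangle P) : tangle P :=
  let f := tmate t in let w := tword t in
  if f a == b then Tangle f w (w a :: circles t)
  else Tangle
    (fun p => if p == f a then f b else if p == f b then f a else f p)
    (fun p => if p == f a then (w (f a) * w b)%g
              else if p == f b then (w (f b) * w a)%g else w p)
    (circles t).

Lemma glue_good (P : eqType) (ps : P -> nat) (A A' : pred P) a b t :
  injective ps -> A a -> A b -> ps a < ps b ->
  (forall p, A p -> ~~ (ps a < ps p < ps b)) ->
  (forall p, A' p = [&& A p, p != a & p != b]) ->
  good ps A (tmate t) (tword t) ->
  good ps A' (tmate (glue a b t)) (tword (glue a b t)).
Proof.
case: t => f w z psI Aa Ab ltab adj A'E /= G.
have fA p : A p -> A (f p) by case/G.
have fN p : A p -> f p != p by case/G.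
have fK p : A p -> f (f p) = p by case/G.
have wV p : A p -> w (f p) = (w p)^-1%g by case/G.
have fI p q : A p -> A q -> f p = f q -> p = q.
  by move=> Ap Aq E; rewrite -(fK p) // E fK.
have nc p q : A p -> A q -> ~~ [&& ps p < ps q, ps q < ps (f p) & ps (f p) < ps (f q)].
  by move=> Ap Aq; case: (G p Ap) => _ _ _ _ /(_ q Aq) [].
have un p q : A p -> A q -> ps q < ps p < ps (f q) -> w p = 1%g.
  by move=> Ap Aq; case: (G p Ap) => _ _ _ _ /(_ q Aq) [].
have psN p q : p != q -> ps p <> ps q by move=> /eqP pq /psI.
rewrite /glue /=; case: eqP => [fab|/eqP fab] /=.
  have fba : f b = a by rewrite -fab fK.
  move=> p; rewrite A'E => /and3P [Ap pa pb]; split.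
  - rewrite A'E fA //=; apply/andP; split.
      by apply: contraNneq pb => E; rewrite -fab -E fK.
    by apply: contraNneq pa => E; rewrite -fba -E fK.
  - exact: fN.
  - exact: fK.
  - exact: wV.
  by move=> q; rewrite A'E => /and3P [Aq _ _]; split; [apply: nc | apply: un].
have fba : f b != a by apply: contraNneq fab => <-; rewrite fK.
have faa := fN a Aa; have fbb := fN b Ab.
have Afa := fA a Aa; have Afb := fA b Ab.
have fafb : f a != f b.
  by apply/eqP => /fI E; move: ltab; rewrite (E Aa Ab) ltnn.
have ab : a != b by apply/eqP => E; move: ltab; rewrite E ltnn.
set f' := fun p => _; set w' := fun p => _.
have f'a : f' (f a) = f b by rewrite /f' eqxx.
have f'b : f' (f b) = f a by rewrite /f' eqxx eq_sym (negPf fafb).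
have f'o p : p != f a -> p != f b -> f' p = f p.
  by rewrite /f' => /negPf -> /negPf ->.
have w'a : w' (f a) = (w (f a) * w b)%g by rewrite /w' eqxx.
have w'b : w' (f b) = (w (f b) * w a)%g by rewrite /w' eqxx eq_sym (negPf fafb).
have w'o p : p != f a -> p != f b -> w' p = w p.
  by rewrite /w' => /negPf -> /negPf ->.
have fneq p q : A p -> A q -> p != f q -> f p != q.
  by move=> Ap Aq; apply: contraNneq => <-; rewrite fK.
have fnn p q : A p -> A q -> p != q -> f p != f q.
  by move=> Ap Aq; apply: contraNneq => /fI ->.
(* the position of an other strand relative to the glued ones *)
have sep p : A p -> p != a -> p != b -> p != f a -> p != f b ->
  [/\ ps p <> ps a, ps p <> ps b, ps p <> ps (f a), ps p <> ps (f b) &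
      ~~ (ps a < ps p < ps b)].
  by move=> Ap *; split; try (by apply: psN); apply: adj.
have B p q : A p -> A q -> q != p -> q != f p ->
    btw (ps p) (ps (f p)) (ps q) = btw (ps p) (ps (f p)) (ps (f q)).
  move=> Ap Aq qp qfp; have Afp := fA p Ap; have Afq := fA q Aq.
  have qfp' : f q != f p by apply: fnn.
  have qp' : f q != p by apply: fneq.
  have := (nc p q Ap Aq, nc q p Aq Ap, nc (f p) q Afp Aq, nc q (f p) Aq Afp,
    (nc p (f q) Ap Afq, nc (f q) p Afq Ap, nc (f p) (f q) Afp Afq, nc (f q) (f p) Afq Afp)).
  rewrite !fK // => [[[[[n1 n2] n3] n4] [[[n5 n6] n7] n8]]].
  by apply: nc_btw => //; apply/nesym/psN.
have BB q : A q -> q != a -> q != b -> q != f a -> q != f b ->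
  [/\ btw (ps q) (ps (f q)) (ps (f a)) = btw (ps q) (ps (f q)) (ps (f b)),
      btw (ps q) (ps (f q)) (ps a) = btw (ps q) (ps (f q)) (ps (f a)),
      btw (ps q) (ps (f q)) (ps b) = btw (ps q) (ps (f q)) (ps (f b)),
      [/\ ps q <> ps a, ps q <> ps b, ps q <> ps (f a), ps q <> ps (f b) &
          ~~ (ps a < ps q < ps b)] &
      [/\ ps (f q) <> ps a, ps (f q) <> ps b, ps (f q) <> ps (f a),
          ps (f q) <> ps (f b) & ~~ (ps a < ps (f q) < ps b)]].
  move=> Aq qa qb qfa qfb.
  have [r1 r2 r3 r4 r5] := sep q Aq qa qb qfa qfb.
  have [] := sep (f q) (fA _ Aq); [exact: fneq | exact: fneq | exact: fnn | exact: fnn |].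
  move=> s1 s2 s3 s4 s5.
  have Ba : btw (ps q) (ps (f q)) (ps a) = btw (ps q) (ps (f q)) (ps (f a)).
    by apply: B => //; rewrite eq_sym //; apply: fneq.
  have Bb : btw (ps q) (ps (f q)) (ps b) = btw (ps q) (ps (f q)) (ps (f b)).
    by apply: B => //; rewrite eq_sym //; apply: fneq.
  by split=> //; apply: (@btw_trans (ps a) (ps b)).
have wfa : w a = (w (f a))^-1%g by rewrite -wV ?fK.
have wfb : w b = (w (f b))^-1%g by rewrite -wV ?fK.
move=> p; rewrite A'E => /and3P [Ap pa pb].
have [pfa|pfa] := eqVneq p (f a); [|have [pfb|pfb] := eqVneq p (f b)].
- subst p; rewrite f'a f'b w'a w'b; split.
  + by rewrite A'E Afb fba.
  + by rewrite eq_sym.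
  + by [].
  + by rewrite invgM (wV a) // invgK wV.
  move=> q; rewrite A'E => /and3P [Aq qa qb].
  have [qfa|qfa] := eqVneq q (f a).
    by subst q; rewrite f'a !ltnn !(andbF, andFb); split=> //; lia.
  have [qfb|qfb] := eqVneq q (f b).
    by subst q; rewrite f'b !ltnn !(andbF, andFb); split=> //; lia.
  rewrite f'o //.
  have [E Ea Eb [s1 s2 s3 s4 _] [r1 r2 r3 r4 _]] := BB q Aq qa qb qfa qfb.
  split; first by case: (btw_nc s3 s4 r3 r4 E).
  move=> H; have lt : ps q < ps (f q) by case/andP: H; apply: ltn_trans.
  rewrite (un (f a) q) // (un b q) ?mulg1 //.
  by rewrite -btw_in // Eb -E btw_in.
- subst p; rewrite f'b f'a w'a w'b; split.
  + by rewrite A'E Afa faa.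
  + by [].
  + by [].
  + by rewrite invgM (wV b) // invgK wV.
  move=> q; rewrite A'E => /and3P [Aq qa qb].
  have [qfa|qfa] := eqVneq q (f a).
    by subst q; rewrite f'a !ltnn !(andbF, andFb); split=> //; lia.
  have [qfb|qfb] := eqVneq q (f b).
    by subst q; rewrite f'b !ltnn !(andbF, andFb); split=> //; lia.
  rewrite f'o //.
  have [E Ea Eb [s1 s2 s3 s4 _] [r1 r2 r3 r4 _]] := BB q Aq qa qb qfa qfb.
  split; first by case: (btw_nc s4 s3 r4 r3 (esym E)).
  move=> H; have lt : ps q < ps (f q) by case/andP: H; apply: ltn_trans.
  rewrite (un (f b) q) // (un a q) ?mulg1 //.
  by rewrite -btw_in // Ea E btw_in.
have Afp := fA p Ap.
have fpa : f p != a by apply: fneq.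
have fpb : f p != b by apply: fneq.
have fpfa : f p != f a by apply: fnn.
have fpfb : f p != f b by apply: fnn.
rewrite (f'o p) // (w'o p) // (f'o (f p)) // (w'o (f p)) //; split.
+ by rewrite A'E Afp fpa.
+ exact: fN.
+ exact: fK.
+ exact: wV.
have [E Ea Eb [p1 p2 p3 p4 p5] [t1 t2 t3 t4 t5]] := BB p Ap pa pb pfa pfb.
have ua := un p a Ap Aa; have ub := un p b Ap Ab.
have ufa := un p (f a) Ap Afa; have ufb := un p (f b) Ap Afb.
rewrite fK // in ufa; rewrite fK // in ufb.
move=> q; rewrite A'E => /and3P [Aq qa qb].
have key : (ps (f b) < ps p < ps (f a)) || (ps (f a) < ps p < ps (f b)) -> w p = 1%g.
  by move=> H; case/or4P: (btw_split p1 p2 p5 ltab H).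
have [qfa|qfa] := eqVneq q (f a).
  subst q; rewrite f'a; split; first by case: (btw_nc p3 p4 t3 t4 E).
  by move=> H; apply: key; rewrite H orbT.
have [qfb|qfb] := eqVneq q (f b).
  subst q; rewrite f'b; split; first by case: (btw_nc p4 p3 t4 t3 (esym E)).
  by move=> H; apply: key; rewrite H.
by rewrite f'o //; split; [apply: nc | apply: un].
Qed.

Section Concat.
Variables m k n : nat.

Definition jpt : finType := (pt m k + pt k n)%type.

(* x next to y, the boundary of y being traversed after the one of x. *)
Definition jpos (p : jpt) : nat :=
  match p with inl q => pos q | inr q => m + k + pos q end.

Definition juxtapose (x : diagram g m k) (y : diagram g k n) : tangle jpt :=
  Tangle
    (fun p => match p with inl q => inl (mate x q) | inr q => inr (mate y q) end)
    (fun p => match p with inl q => word x q | inr q => word y q end)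
    [::].

(* x at the bottom and y on top: the i-th top point of x is glued to the i-th
   bottom point of y, for i = 0, ..., k - 1.  A circle is thus closed at its
   rightmost point on the gluing line, and it is read from there downwards into
   x, that is, clockwise. *)
Definition stack (x : diagram g m k) (y : diagram g k n) : tangle jpt :=
  foldl (fun t i => glue (inl (inr i)) (inr (inl i)) t) (juxtapose x y) (enum 'I_k).

Definition outer (p : pt m n) : jpt :=
  match p with inl i => inl (inl i) | inr j => inr (inr j) end.

Definition of_outer (p : jpt) : option (pt m n) :=
  match p with
  | inl (inl i) => Some (inl i) | inr (inr j) => Some (inr j) | _ => None
  end.

(* mates of outer points are outer (concat_subproof), so that the default
   value p does not occur *)
Definition concat_fun x y : {ffun pt m n -> pt m n * 'Fr_g} :=
  [ffun p => (odflt p (of_outer (tmate (stack x y) (outer p))),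
              tword (stack x y) (outer p))].

Let alive (r : seq 'I_k) (p : jpt) : bool :=
  match p with inl (inr i) | inr (inl i) => i \in r | _ => true end.

Let jpos_inj : injective jpos.
Proof.
have lt m' n' (q : pt m' n') : pos q < m' + n'.
  by case: q => i /=; have := ltn_ord i; lia.
move=> [p|p] [q|q] /= E.
- by congr inl; apply: pos_inj.
- by have := lt _ _ p; lia.
- by have := lt _ _ q; lia.
- by congr inr; apply: (@pos_inj k n); lia.
Qed.

Let juxtapose_good x y (A : pred jpt) : A =1 predT ->
  good jpos A (tmate (juxtapose x y)) (tword (juxtapose x y)).
Proof.
have lt m' n' (q : pt m' n') : pos q < m' + n'.
  by case: q => i /=; have := ltn_ord i; lia.
have gx := elimT (diagramP _) (valP x); have gy := elimT (diagramP _) (valP y).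
move=> AT [] p _; rewrite AT.
  have [_ h1 h2 h3 h4] := gx p isT; split=> //=.
  - by congr inl.
  move=> [] q _ /=; first exact: h4.
  by have := lt _ _ p; have := lt _ _ (mate x p); split; lia.
have [_ h1 h2 h3 h4] := gy p isT; split=> //=.
- by congr inr.
move=> [] q _ /=; last by rewrite !ltn_add2l; apply: h4.
by have := lt _ _ q; have := lt _ _ (mate x q); split; lia.
Qed.

Let stack_good x y :
  good jpos (alive [::]) (tmate (stack x y)) (tword (stack x y)).
Proof.
have : sorted ltn [seq val i | i <- enum 'I_k].
  by rewrite val_enum_ord iota_ltn_sorted.
have : good jpos (alive (enum 'I_k)) (tmate (juxtapose x y)) (tword (juxtapose x y)).
  by apply: juxtapose_good => [] [[i|i]|[i|i]] //=; rewrite mem_enum.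
rewrite /stack; elim: (enum 'I_k) (juxtapose x y) => //= i r IH t gt.
rewrite (path_sortedE ltn_trans) => /andP [/allP ir sr].
have i_notin j : j \in r -> i < j by move=> jr; apply: ir; apply: map_f.
apply: IH => //; apply: (glue_good (ps := jpos) _ _ _ _ _ _ gt) => //=.
- by rewrite inE eqxx.
- by rewrite inE eqxx.
- by have := ltn_ord i; lia.
- case=> [] [j|j] //=; rewrite ?inE; have := ltn_ord i; have := ltn_ord j; try lia.
  + by move=> ? ?; case/predU1P => [->|/i_notin]; lia.
  + by move=> ? ?; case/predU1P => [->|/i_notin]; lia.
- case=> [] [j|j] //=; rewrite ?inE ?andbT //.
  + have [->|ji] := eqVneq j i.
      by rewrite eqxx andbF; apply/negP => /i_notin; rewrite ltnn.
    by rewrite (_ : _ != _) ?andbT //; apply: contraNneq ji => - [->].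
  + have [->|ji] := eqVneq j i.
      by rewrite eqxx andbF; apply/negP => /i_notin; rewrite ltnn.
    by rewrite (_ : _ != _) ?andbT //; apply: contraNneq ji => - [->].
Qed.

Let of_outerK p : alive [::] p -> omap outer (of_outer p) = Some p.
Proof. by case: p => [] []. Qed.

Lemma outer_lt (p q : pt m n) : (jpos (outer p) < jpos (outer q)) = (pos p < pos q).
Proof.
by case: p => i; case: q => j /=; have := ltn_ord i; have := ltn_ord j; lia.
Qed.

Lemma concat_subproof x y : is_diagram (concat_fun x y).
Proof.
have G := @stack_good x y; apply/diagramP => p _ /=.
have Ao q : alive [::] (outer q) by case: q.
have oI : injective outer by move=> [i|i] [j|j] //= [->].
have fE q : outer (concat_fun x y q).1 = tmate (stack x y) (outer q).
  rewrite ffunE /=; have [/of_outerK + _ _ _ _] := G _ (Ao q).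
  by case: (of_outer _) => //= a [].
have wE q : (concat_fun x y q).2 = tword (stack x y) (outer q) by rewrite ffunE.
have [_ h1 h2 h3 h4] := G _ (Ao p); split=> //.
- by apply: contra h1 => /eqP E; rewrite -fE E.
- by apply: oI; rewrite !fE.
- by rewrite !wE fE.
by move=> q _; rewrite wE -!outer_lt !fE; apply: h4.
Qed.

Definition concat x y : diagram g m n := Diagram (concat_subproof x y).

End Concat.
End Gluing.

Section FlipCoil.
Variable g : nat.

Definition swap m n (p : pt m n) : pt n m :=
  match p with inl i => inr i | inr j => inl j end.

(* Turning x upside down while keeping positive coils positive and negative
   coils negative: the word of the flipped strand from swap p to swap (mate x p)
   is the word of the original strand from mate x p to p, read backwards. *)
Definition flip_fun m n (x : diagram g m n) : {ffun pt n m -> pt n m * 'Fr_g} :=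
  [ffun p => (swap (mate x (swap p)), frev (word x (mate x (swap p))))].

Lemma swapK m n : cancel (@swap m n) (@swap n m).
Proof. by case. Qed.

Lemma pos_swap m n (p : pt m n) : pos (swap p) = (m + n).-1 - pos p.
Proof. by case: p => i /=; have := ltn_ord i; lia. Qed.

Lemma swap_lt m n (p q : pt m n) : (pos (swap p) < pos (swap q)) = (pos q < pos p).
Proof.
rewrite !pos_swap; have lt (q' : pt m n) : pos q' < m + n.
  by case: q' => i /=; have := ltn_ord i; lia.
by have := lt p; have := lt q; lia.
Qed.

Lemma flip_subproof m n (x : diagram g m n) : is_diagram (flip_fun x).
Proof.
have G := elimT (diagramP _) (valP x).
have fK p : mate x (mate x p) = p by case: (G p isT).
have wV p : word x (mate x p) = (word x p)^-1%g by case: (G p isT).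
apply/diagramP => p _; rewrite -(swapK p); move: (swap p) => {}p.
rewrite !ffunE /= !swapK fK; split=> //.
- by case: (G p isT) => _ + _ _ _; apply: contra => /eqP /(can_inj (@swapK _ _)) /eqP.
- by rewrite wV frevV invgK.
move=> q _; rewrite -(swapK q); move: (swap q) => {}q.
rewrite !ffunE /= !swapK !swap_lt; split.
  have [_ _ _ _ /(_ (mate x p) isT) [+ _]] := G (mate x q) isT.
  rewrite -/(mate x (mate x q)) -/(mate x (mate x p)) !fK.
  by apply: contra => /and3P [-> -> ->].
have [_ _ _ _ /(_ (mate x q) isT) [_ h]] := G p isT.
move=> H; rewrite wV frevV [word x p]h ?frev1 ?invg1 //.
by rewrite -/(mate x (mate x q)) fK andbC.
Qed.

Definition flip m n (x : diagram g m n) : diagram g n m :=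
  Diagram (flip_subproof x).

(* l through strands, the leftmost one having the word b from bottom to top. *)
Definition coil_fun l (b : 'Fr_g) : {ffun pt l l -> pt l l * 'Fr_g} :=
  [ffun p => (swap p, match p with
                      | inl i => if i == 0 :> nat then b else 1%g
                      | inr j => if j == 0 :> nat then b^-1%g else 1%g
                      end)].

Lemma coil_subproof l b : is_diagram (coil_fun l b).
Proof.
apply/diagramP => p _; rewrite !ffunE /= swapK; split=> //.
- by case: p.
- by case: p => i /=; case: eqP => _; rewrite ?invgK ?invg1.
move=> q _; rewrite !ffunE /=; split.
  by case: p => i; case: q => j /=; have := ltn_ord i; have := ltn_ord j; lia.
case: p => i; case: q => j /=; have := ltn_ord i; have := ltn_ord j;
  case: eqP => //; lia.
Qed.

Definition coil l (b : 'Fr_g) : diagram g l l := Diagram (coil_subproof l b).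

End FlipCoil.

Local Open Scope ring_scope.

Definition noetherian (R : comNzRingType) : Prop :=
  forall I : R -> Prop,
    I 0 -> (forall a b, I a -> I b -> I (a + b)) -> (forall a b, I b -> I (a * b)) ->
  exists (k : nat) (s : 'I_k -> R),
    forall a, I a <-> exists r : 'I_k -> R, a = \sum_(i < k) r i * s i.

Section LinearExtension.
Variable K : comNzRingType.

Definition lext (I : choiceType) (V : lmodType K) (f : I -> V) (v : {malg K[I]}) : V :=
  \sum_(i <- msupp v) v@_i *: f i.

Definition lext2 (I J : choiceType) (V : lmodType K) (f : I -> J -> V)
    (u : {malg K[I]}) (v : {malg K[J]}) : V :=
  lext (fun i => lext (f i) v) u.

(* The product of the group algebra K[G]. *)
Definition group_mul (G : groupType) : {malg K[G]} -> {malg K[G]} -> {malg K[G]} :=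
  lext2 (fun a b => << (a * b)%g >>).

Definition group_one (G : groupType) : {malg K[G]} := << (1%g : G) >>.

End LinearExtension.

Section Algebras.
Variable K : comNzRingType.

Definition is_bilinear (U V W : lmodType K) (f : U -> V -> W) : Prop :=
  (forall v, linear (f^~ v)) /\ (forall u, linear (f u)).

Definition is_algebra (A : lmodType K) (mul : A -> A -> A) (one : A) : Prop :=
  [/\ is_bilinear mul, associative mul, left_id one mul & right_id one mul].

Definition is_antiinvolution (A : lmodType K) (mul : A -> A -> A) (star : A -> A) : Prop :=
  [/\ linear star, involutive star & forall x y, star (mul x y) = mul (star y) (star x)].

Section Modules.
Variables (A : lmodType K) (mul : A -> A -> A) (one : A) (V : lmodType K).

Definition is_left_module (act : A -> V -> V) : Prop :=
  [/\ is_bilinear act, forall v, act one v = v &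
      forall a b v, act (mul a b) v = act a (act b v)].

Definition is_right_module (act : V -> A -> V) : Prop :=
  [/\ is_bilinear act, forall v, act v one = v &
      forall a b v, act v (mul a b) = act (act v a) b].

Definition is_free_left (act : A -> V -> V) : Prop :=
  exists (I : choiceType) (e : I -> V),
    bijective (fun x : {malg A[I]} => \sum_(i <- msupp x) act x@_i (e i)).

Definition is_free_right (act : V -> A -> V) : Prop :=
  exists (I : choiceType) (e : I -> V),
    bijective (fun x : {malg A[I]} => \sum_(i <- msupp x) act (e i) x@_i).

End Modules.

(* t : P x Q -> T is a tensor product over S of the right S-module P and the
   left S-module Q (universal property). *)
Section Tensor.
Variables (S P Q : lmodType K) (rP : P -> S -> P) (lQ : S -> Q -> Q).

Definition is_balanced (W : lmodType K) (f : P -> Q -> W) : Prop :=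
  is_bilinear f /\ forall p s q, f (rP p s) q = f p (lQ s q).

Definition is_tensor_product (T : lmodType K) (t : P -> Q -> T) : Prop :=
  is_balanced t /\
  forall (W : lmodType K) (f : P -> Q -> W), is_balanced f ->
    exists h : T -> W,
      [/\ linear h, forall p q, h (t p q) = f p q &
          forall h' : T -> W, linear h' -> (forall p q, h' (t p q) = f p q) -> h' =1 h].

End Tensor.
End Algebras.

(* An algebra S l with a fixed basis B l is given as a multiplication on the free
   K-module {malg K[B l]}.  M l and N l may be infinite (half-diagrams can wind
   arbitrarily often); all sums are over finite supports. *)

Section SandwichCellDatum.
Variables (K : comNzRingType) (A : lmodType K) (mul : A -> A -> A) (one : A).
Variables (disp : Order.disp_t) (L : porderType disp) (M N B : L -> choiceType).
Variable smul : forall l, {malg K[B l]} -> {malg K[B l]} -> {malg K[B l]}.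
Variable sone : forall l, {malg K[B l]}.
Variable c : forall l, M l -> B l -> N l -> A.

Definition cell_index : choiceType := {l : L & (M l * B l * N l)%type}.

Definition cell (i : cell_index) : A :=
  c (tagged i).1.1 (tagged i).1.2 (tagged i).2.

Definition in_cell_span (P : pred L) (a : A) : Prop :=
  exists2 v : {malg K[cell_index]},
    (forall i, i \in msupp v -> P (tag i)) & a = lext cell v.

Definition lower l : A -> Prop := in_cell_span (fun m => (m < l)%O).
Definition lower_eq l : A -> Prop := in_cell_span (fun m => (m <= l)%O).

(* c^l_{D,s,U}, extended linearly to s in S l *)
Definition cext l (D : M l) (s : {malg K[B l]}) (U : N l) : A :=
  lext (fun b => c D b U) s.

(* A^{<= l} / A^{< l} is isomorphic, as an A-bimodule, to P (x)_S Q.  The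
   isomorphism is given as a bimodule map pi from A^{<= l} onto a tensor product
   T of P and Q, with kernel A^{< l}.  All gradings are concentrated in degree 0. *)
Definition cell_quotient_tensor l : Prop :=
  exists (P Q T : lmodType K)
    (lP : A -> P -> P) (rP : P -> {malg K[B l]} -> P)
    (lQ : {malg K[B l]} -> Q -> Q) (rQ : Q -> A -> Q)
    (lT : A -> T -> T) (rT : T -> A -> T) (t : P -> Q -> T) (pi : A -> T),
  [/\ [/\ is_left_module mul one lP, is_right_module (@smul l) (sone l) rP,
          forall a p s, rP (lP a p) s = lP a (rP p s) & is_free_right rP],
      [/\ is_left_module (@smul l) (sone l) lQ, is_right_module mul one rQ,
          forall s q a, rQ (lQ s q) a = lQ s (rQ q a) & is_free_left lQ],
      [/\ is_tensor_product rP lQ t, is_left_module mul one lT,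
          is_right_module mul one rT, forall a p q, lT a (t p q) = t (lP a p) q &
          forall p q a, rT (t p q) a = t p (rQ q a)] &
      [/\ forall k a b, lower_eq l a -> lower_eq l b -> pi (k *: a + b) = k *: pi a + pi b,
          forall x a, lower_eq l a ->
            [/\ lower_eq l (mul x a), lower_eq l (mul a x),
                pi (mul x a) = lT x (pi a) & pi (mul a x) = rT (pi a) x],
          forall y, exists2 a, lower_eq l a & pi a = y &
          forall a, lower_eq l a -> (pi a = 0 <-> lower l a)]].

(* In sandwich_left and sandwich_right, the scalars r(S,a,D) and r(S,a,U) depend
   neither on b nor on the opposite half-diagram: x acts on the left through
   sum_{S,a} r(S,a,D) S a, with values in a free right S_l-module, and b is then
   multiplied on. *)
Record sandwich_cell_datum : Prop := SandwichCellDatum {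
  sandwich_algebra : is_algebra mul one;
  sandwiched_algebra : forall l, is_algebra (@smul l) (sone l);
  sandwich_basis : bijective (lext cell);
  sandwich_left : forall (x : A) l,
    exists r : M l -> {malg K[(M l * B l)%type]}, forall D b U,
      lower l (mul x (c D b U) -
        \sum_(i <- msupp (r D)) (r D)@_i *: cext i.1 (smul << i.2 >> << b >>) U);
  sandwich_right : forall (x : A) l,
    exists r : N l -> {malg K[(N l * B l)%type]}, forall D b U,
      lower l (mul (c D b U) x -
        \sum_(i <- msupp (r U)) (r U)@_i *: cext D (smul << b >> << i.2 >>) i.1);
  sandwich_tensor : forall l, cell_quotient_tensor l }.

End SandwichCellDatum.

Section Involutive.
Variables (K : comNzRingType) (A : lmodType K) (mul : A -> A -> A).
Variables (disp : Order.disp_t) (L : porderType disp) (M B : L -> choiceType).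
Variable smul : forall l, {malg K[B l]} -> {malg K[B l]} -> {malg K[B l]}.
Variable c : forall l, M l -> B l -> M l -> A.
Variables (star : A -> A) (bstar : forall l, B l -> B l).

Record sandwich_involution : Prop := SandwichInvolution {
  star_antiinvolution : is_antiinvolution mul star;
  bstar_bijective : forall l, bijective (@bstar l);
  bstar_antiinvolution : forall l,
    is_antiinvolution (@smul l) (lext (fun b => << bstar b >>));
  star_cell : forall l (D U : M l) (b : B l), star (c D b U) = c U (bstar b) D }.

End Involutive.

Section TemperleyLieb.
Variables (K : comNzRingType) (g : nat) (c : 'Fr_g -> K).

Definition TL (m n : nat) : lmodType K := {malg K[diagram g m n]}.

Definition circle_factor m k n (x : diagram g m k) (y : diagram g k n) : K :=
  \prod_(w <- circles (stack x y)) c w.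

Definition TL_comp m k n : TL m k -> TL k n -> TL m n :=
  lext2 (fun x y => << circle_factor x y *g concat x y >>).

Definition TL_mul n : TL n n -> TL n n -> TL n n := @TL_comp n n n.

Definition TL_one n : TL n n := << coil n 1%g >>.

(* Flipping turns a circle with clockwise word w into one with clockwise word
   frev w, up to conjugation; so TL_star reverses products as soon as c is
   invariant under frev (automatic for g <= 1). *)
Definition TL_star n : TL n n -> TL n n := lext (fun x => << flip x >>).

End TemperleyLieb.

Section Datum.
Variable g : nat.

Record through (n : nat) := Through {
  nthrough :> nat; _ : (nthrough <= n)%N && (odd nthrough == odd n) }.

HB.instance Definition _ n := [isSub for @nthrough n].
HB.instance Definition _ n := [Choice of through n by <:].
HB.instance Definition _ n :=
  [SubChoice_isSubOrder of through n by <: with Order.NatOrder.nat_display].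

(* Every top point belongs to a through strand, without winding. *)
Definition is_half m l (x : diagram g m l) : bool :=
  [forall j : 'I_l, is_inl (mate x (inr j)) && (word x (inr j) == 1%g)].

Record half_diagram (m l : nat) := HalfDiagram {
  half_dgm :> diagram g m l; _ : is_half half_dgm }.

HB.instance Definition _ m l := [isSub for @half_dgm m l].
HB.instance Definition _ m l := [Choice of half_diagram m l by <:].

(* The group F_g for l > 0, and the trivial group for l = 0. *)
Record coil_group (l : nat) := CoilGroup {
  coil_word :> 'Fr_g; _ : (l == 0)%N ==> (coil_word == 1%g) }.

HB.instance Definition _ l := [isSub for @coil_word l].
HB.instance Definition _ l := [Choice of coil_group l by <:].

Section CoilGroup.
Variable l : nat.
Implicit Types a b : coil_group l.

Let coil_word0 a : (l == 0)%N -> coil_word a = 1%g.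
Proof. by move=> l0; case: a => w /= /implyP /(_ l0) /eqP. Qed.

Fact coil_mul_subproof a b : (l == 0)%N ==> (coil_word a * coil_word b == 1)%g.
Proof. by apply/implyP => l0; rewrite !coil_word0 // mulg1. Qed.
Fact coil_one_subproof : (l == 0)%N ==> ((1 : 'Fr_g) == 1)%g.
Proof. by rewrite eqxx implybT. Qed.
Fact coil_inv_subproof a : (l == 0)%N ==> ((coil_word a)^-1 == 1)%g.
Proof. by apply/implyP => l0; rewrite coil_word0 // invg1. Qed.
Fact coil_rev_subproof a : (l == 0)%N ==> (frev (coil_word a) == 1)%g.
Proof. by apply/implyP => l0; rewrite coil_word0 // frev1. Qed.

Definition coil_mul a b : coil_group l := CoilGroup (coil_mul_subproof a b).
Definition coil_one : coil_group l := CoilGroup coil_one_subproof.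
Definition coil_inv a : coil_group l := CoilGroup (coil_inv_subproof a).
Definition coil_rev a : coil_group l := CoilGroup (coil_rev_subproof a).

Fact coil_mulA : associative coil_mul.
Proof. by move=> x y z; apply: val_inj; apply: mulgA. Qed.
Fact coil_mul1 : left_id coil_one coil_mul.
Proof. by move=> x; apply: val_inj; apply: mul1g. Qed.
Fact coil_mulr1 : right_id coil_one coil_mul.
Proof. by move=> x; apply: val_inj; apply: mulg1. Qed.
Fact coil_mulV : left_inverse coil_one coil_inv coil_mul.
Proof. by move=> x; apply: val_inj; apply: mulVg. Qed.
Fact coil_mulrV : right_inverse coil_one coil_inv coil_mul.
Proof. by move=> x; apply: val_inj; apply: mulgV. Qed.

HB.instance Definition _ := isGroup.Build (coil_group l)
  coil_mulA coil_mul1 coil_mulr1 coil_mulV coil_mulrV.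

End CoilGroup.

Variables (K : comNzRingType) (c : 'Fr_g -> K) (n : nat).

Definition TL_M (l : through n) : choiceType := half_diagram n l.
Definition TL_B (l : through n) : choiceType := coil_group l.

Definition TL_smul (l : through n) : {malg K[TL_B l]} -> {malg K[TL_B l]} -> {malg K[TL_B l]} :=
  @group_mul K (coil_group l).
Definition TL_sone (l : through n) : {malg K[TL_B l]} := group_one K (coil_group l).

Definition TL_cell (l : through n) (D : TL_M l) (b : TL_B l) (U : TL_M l) : TL K g n n :=
  TL_comp c (TL_comp c << half_dgm D >> << coil l (coil_word b) >>) << flip (half_dgm U) >>.

Definition TL_bstar (l : through n) (b : TL_B l) : TL_B l := coil_rev b.

End Datum.

(* Main.v *)
Require Import Defs.
From mathcomp Require Import all_boot all_order all_algebra zify.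
From mathcomp Require Import finmap.
From mathcomp.multinomials Require Import monalg.
Set Implicit Arguments.
Unset Strict Implicit.
Unset Printing Implicit Defensive.
Import Order.TTheory GRing.Theory.
Local Open Scope ring_scope.

(** Everything about diagrams is reduced to one operation, gluing two strand ends
of a tangle, and everything about the algebra to one fact about diagrams, the
unique factorization through half-diagrams.

Associativity.  Both bracketings of a threefold composite are obtained from the
three diagrams side by side by the same gluings, performed in two different
orders ([concat_assoc]).  Two gluings commute ([swap_glue]): the strands come out
the same, and the only circle whose word depends on the order is one made of
both pairs; planarity forces it to be read as u w in one order and as w u in the
other.  These words are conjugate, so the circle parameters agree.  Orientations
matter here, since the parameters of a word and of its inverse are unrelated.

Factorization.  Call a diagram full if all its top points are ends of through
strands.  Composites with a full diagram at the bottom are explicit: no circle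
arises, and the strands of the upper diagram are merely prolonged ([concat_push],
[concat_cap]).  A
diagram with l through strands is cut into its lower half, the coil of its
leftmost through strand (the others lie to its right and cannot wind) and its
upper half, and this is its only expression as a composite S, b, flip U
([factorization], [cell_diagram_inj]).  Hence the elements c_{D,b,U} are, up to
a bijection of indices, the diagrams themselves, and A^{<= l} is spanned by the
diagrams with at most l through strands, a number which cannot increase under
composition.

Cell structure.  Multiplying a half-diagram D by a diagram x either loses through
strands, or yields a full diagram, which is some S followed by a coil; that is
the scalar r(S,a,D).  For the bimodules, let X(m,n,l) be the free module on the
diagrams from m to n with exactly l through strands, multiplied by composing and
discarding what has fewer through strands.  This is associative because the
discarded part is an ideal, and A^{<= l} / A^{< l} is X(n,n,l), the tensor product
of X(n,l,l) and X(l,n,l) over the group algebra of the coils: the factorization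
provides the bases ([lower_free], [upper_free], [layer_tensor_product]).

The involution is flipping, which reverses composites and reads each circle
backwards ([flip_concat], [circle_factor_flip]).  There are finitely many half-
diagrams when all words are trivial, and a single one when there are no caps
([half_square]). *)

(** * Gluing strand ends of a tangle *)

Section Glue.
Variable g : nat.
Local Notation Fr := ('Fr_g).
Local Notation tangle := (tangle g).

Definition delete (P : eqType) (A : pred P) (ab : P * P) : pred P :=
  fun p => [&& A p, p != ab.1 & p != ab.2].

(** Gluing leaves stale values of the mate and word functions at the ends it
consumes; A records the ends that are still free, and only these matter. *)
Definition closed_under (P : eqType) (A : pred P) (t : tangle P) : Prop :=
  forall p, A p ->
  [/\ A (tmate t p), tmate t p != p, tmate t (tmate t p) = p &
      tword t (tmate t p) = (tword t p)^-1%g].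

Definition glue_pair (P : eqType) (t : tangle P) (ab : P * P) : tangle P :=
  glue ab.1 ab.2 t.

Definition glues (P : eqType) (L : seq (P * P)) (t : tangle P) : tangle P :=
  foldl (@glue_pair P) t L.

Fixpoint gluable (P : eqType) (A : pred P) (L : seq (P * P)) : Prop :=
  if L is ab :: L' then
    [/\ A ab.1, A ab.2, ab.1 != ab.2 & gluable (delete A ab) L']
  else True.

Definition deletes (P : eqType) (A : pred P) (L : seq (P * P)) : pred P :=
  foldl (@delete P) A L.

Lemma deletesE (P : eqType) (A : pred P) L p :
  deletes A L p = [&& A p, p \notin unzip1 L & p \notin unzip2 L].
Proof.
elim: L A => [|[a b] L IH] A /=; first by rewrite andbT.
rewrite IH /delete /= !inE !negb_or.
by case: (A p); case: (p == a); case: (p == b); rewrite ?andbF.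
Qed.

Lemma glue_mateE (P : eqType) (a b p : P) (t : tangle P) :
  tmate t a != b ->
  tmate (glue a b t) p = if p == tmate t a then tmate t b
                         else if p == tmate t b then tmate t a else tmate t p.
Proof. by rewrite /glue => /negPf ->. Qed.

Lemma glue_wordE (P : eqType) (a b p : P) (t : tangle P) :
  tmate t a != b ->
  tword (glue a b t) p = if p == tmate t a then (tword t (tmate t a) * tword t b)%g
       else if p == tmate t b then (tword t (tmate t b) * tword t a)%g else tword t p.
Proof. by rewrite /glue => /negPf ->. Qed.

Lemma glue_circlesE (P : eqType) (a b : P) (t : tangle P) :
  circles (glue a b t) = if tmate t a == b then tword t a :: circles t else circles t.
Proof. by rewrite /glue; case: ifP. Qed.

Lemma glue_circle (P : eqType) (a b : P) (t : tangle P) : tmate t a == b ->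
  glue a b t = Tangle (tmate t) (tword t) (tword t a :: circles t).
Proof. by rewrite /glue => ->. Qed.

Section ClosedUnder.
Variables (P : eqType) (A : pred P) (t : tangle P).
Hypothesis tA : closed_under A t.
Local Notation f := (tmate t).
Local Notation w := (tword t).

Lemma mateA p : A p -> A (f p). Proof. by case/tA. Qed.
Lemma mate_neq p : A p -> f p != p. Proof. by case/tA. Qed.
Lemma mateK p : A p -> f (f p) = p. Proof. by case/tA. Qed.
Lemma wordV p : A p -> w (f p) = (w p)^-1%g. Proof. by case/tA. Qed.

Lemma mate_sym p q : A p -> A q -> (f p == q) = (p == f q).
Proof. by move=> Ap Aq; apply/eqP/eqP => [<-|->]; rewrite mateK. Qed.

Lemma mate_eq p q : A p -> A q -> (f p == f q) = (p == q).
Proof. by move=> Ap Aq; rewrite mate_sym ?mateK ?mateA. Qed.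

Lemma glue_closed ab : A ab.1 -> A ab.2 -> ab.1 != ab.2 ->
  closed_under (delete A ab) (glue_pair t ab).
Proof.
case: ab => a b /= Aa Ab ab p; rewrite /delete /= => /and3P [Ap pa pb].
rewrite /glue_pair /=; have [fab|fab] := eqVneq (f a) b.
  rewrite glue_circle ?fab //=.
  have fba : f b = a by rewrite -fab mateK.
  split; [|exact: mate_neq|exact: mateK|exact: wordV].
  by rewrite mateA //= [_ == a]mate_sym // [_ == b]mate_sym // fab fba pb pa.
have fafb : (f a == f b) = false by rewrite mate_eq // (negPf ab).
have fba : (f b == a) = false by rewrite mate_sym // eq_sym (negPf fab).
rewrite !glue_wordE // !glue_mateE //.
have [->|pfa] := eqVneq p (f a).
  rewrite eqxx [f b == f a]eq_sym fafb fba mate_neq // mateA //.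
  by rewrite invgM !wordV // invgK.
have [->|pfb] := eqVneq p (f b).
  rewrite eqxx fafb mate_neq // fab mateA //.
  by rewrite invgM !wordV // invgK.
rewrite !(mate_eq Ap) // (negPf pa) (negPf pb) mateA // mate_neq // mateK // wordV //.
by rewrite [f p == a]mate_sym // [f p == b]mate_sym // pfa pfb.
Qed.

End ClosedUnder.

Lemma glues_closed (P : eqType) (A : pred P) L t :
  closed_under A t -> gluable A L -> closed_under (deletes A L) (glues L t).
Proof.
elim: L A t => //= ab L IH A t tA [Aa Ab neq gL].
by apply: IH => //; apply: glue_closed.
Qed.

Section Transport.
Variables (P P' : eqType) (h : P -> P') (theta : Fr -> Fr) (sw : bool).
Hypothesis h_inj : injective h.
Hypothesis thetaM : {morph theta : u v / (u * v)%g}.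

(** The strands of t, with words changed by theta, are those of t' that end in
the image of h.  An inclusion of diagrams into a taller stack is the case where
theta is the identity; turning a stack upside down is the case where theta
inverts each letter. *)
Definition transports (A : pred P) (t : tangle P) (t' : tangle P') : Prop :=
  forall p, A p -> tmate t' (h p) = h (tmate t p) /\
                   tword t' (h p) = theta (tword t p).

(** The flag tells whether h exchanges the two sides of the gluing line. *)
Definition image_pair (ab : P * P) : P' * P' :=
  if sw then (h ab.2, h ab.1) else (h ab.1, h ab.2).

(** A circle is read from the first end of the pair that closes it; when the ends
are exchanged it is read in the opposite direction. *)
Definition image_circle (w : Fr) : Fr := if sw then theta w^-1%g else theta w.

(** Gluing only consults mates and words at the two ends and at their mates, and
all of these are free ends of t. *)
Lemma transports_glue (A : pred P) t t' ab :
  closed_under A t -> A ab.1 -> A ab.2 -> ab.1 != ab.2 -> transports A t t' ->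
  transports (delete A ab) (glue_pair t ab) (glue_pair t' (image_pair ab)) /\
  exists z, circles (glue_pair t ab) = z ++ circles t /\
     circles (glue_pair t' (image_pair ab)) = map image_circle z ++ circles t'.
Proof.
case: ab => a b /= tA Aa Ab neq H.
have [fa wa] := H a Aa; have [fb wb] := H b Ab.
have Afa := mateA tA Aa; have Afb := mateA tA Ab.
have [_ wfa] := H _ Afa; have [_ wfb] := H _ Afb.
rewrite /glue_pair /image_pair /image_circle /=.
have [fab|fab] := eqVneq (tmate t a) b.
  have fba' : tmate t b = a by rewrite -fab (mateK tA).
  split.
    move=> p /and3P [Ap _ _]; have [Hp Hp'] := H p Ap.
    rewrite (@glue_circle _ a b t) ?fab //=.
    by case: (sw) => /=; rewrite glue_circle //= ?fa ?fb ?fba' ?fab.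
  exists [:: tword t a]; rewrite (@glue_circle _ a b t) ?fab //.
  case: (sw); rewrite /= glue_circle //= ?fa ?fb ?fba' ?fab // ?wa ?wb //.
  by rewrite -{1}fab (wordV tA).
have fba : (tmate t b == a) = false.
  by rewrite (mate_sym tA) // eq_sym (negPf fab).
have fafb : (tmate t a == tmate t b) = false by rewrite (mate_eq tA) // (negPf neq).
split; last first.
  exists [::]; rewrite (@glue_circlesE _ a b t) (negPf fab); case: (sw) => /=; rewrite glue_circlesE.
    by rewrite fb (inj_eq h_inj) fba.
  by rewrite fa (inj_eq h_inj) (negPf fab).
move=> p /and3P [Ap _ _]; have [Hp Hp'] := H p Ap.
rewrite (@glue_mateE _ a b p t) // (@glue_wordE _ a b p t) //.
case: (sw) => /=; rewrite glue_mateE ?fa ?fb ?(inj_eq h_inj) ?fba // glue_wordE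
  ?fa ?fb ?(inj_eq h_inj) ?fba // ?wa ?wb ?wfa ?wfb ?Hp ?Hp'.
all: have [pE|_] := eqVneq p (tmate t a); first by rewrite ?pE ?fafb thetaM.
all: by case: (p == _); rewrite ?thetaM.
Qed.

Lemma transports_glues (A : pred P) t t' L :
  closed_under A t -> gluable A L -> transports A t t' ->
  transports (deletes A L) (glues L t) (glues (map image_pair L) t') /\
  exists z, circles (glues L t) = z ++ circles t /\
     circles (glues (map image_pair L) t') = map image_circle z ++ circles t'.
Proof.
elim: L A t t' => [|ab L IH] A t t' /= tA; first by move=> _ H; split=> //; exists [::].
move=> [Aa Ab neq gL] H.
have [H1 [z [z1 z2]]] := transports_glue tA Aa Ab neq H.
have [H2 [z' [z1' z2']]] := IH _ _ _ (glue_closed tA Aa Ab neq) gL H1.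
split=> //; exists (z' ++ z).
by rewrite -catA -z1 -z1' map_cat -catA -z2 -z2'.
Qed.

End Transport.

End Glue.

(** * Two gluings commute *)

Section Swap.
Variables (g : nat) (K : comNzRingType) (c : 'Fr_g -> K).
Hypothesis c_conj : forall u w : 'Fr_g, c (w ^ u)%g = c w.
Local Notation tangle := (tangle g).

Lemma circle_mulC (u w : 'Fr_g) : c (u * w)%g = c (w * u)%g.
Proof. by rewrite -(c_conj u (u * w)%g) /conjg !mulgA mulVg mul1g. Qed.

Definition circle_prod (P : Type) (t : tangle P) : K := \prod_(w <- circles t) c w.

Section Points.
Variable P : eqType.
Implicit Types (A : pred P) (t : tangle P).

(** Circles are compared through their parameters: their words are determined
only up to conjugation, and their order not at all. *)
Definition equivalent A t t' : Prop :=
  transports id id A t t' /\ circle_prod t = circle_prod t'.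

Lemma equivalent_trans A t1 t2 t3 :
  equivalent A t1 t2 -> equivalent A t2 t3 -> equivalent A t1 t3.
Proof.
move=> [H e] [H' e']; split; last by rewrite e.
by move=> p Ap; have [<- <-] := H p Ap; have [<- <-] := H' p Ap.
Qed.

Lemma equivalent_glues A t t' L : closed_under A t -> gluable A L ->
  equivalent A t t' -> equivalent (deletes A L) (glues L t) (glues L t').
Proof.
move=> tA gL [H e].
have [] := @transports_glues g _ _ id id false (fun _ _ => id) _ A t t' L tA gL H; first by [].
have -> : map (image_pair id false) L = L by elim: {gL} L => //= [[a b] L] ->.
move=> H' [z [z1 z2]]; split=> //.
by rewrite /circle_prod z1 z2 !big_cat /= map_id; congr (_ * _).
Qed.

Lemma circle_prod_cons f w (u : 'Fr_g) s :
  circle_prod (@Tangle g P f w (u :: s)) = c u * circle_prod (Tangle f w s).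
Proof. by rewrite /circle_prod /= big_cons. Qed.

Lemma swap_glue_circle A t a b x y : closed_under A t ->
  A a -> A b -> A x -> A y -> x != a -> x != b -> y != a -> y != b ->
  tmate t a = b ->
  equivalent A (glue x y (glue a b t)) (glue a b (glue x y t)).
Proof.
move=> tA Aa Ab Ax Ay xa xb ya yb fab.
have fba : tmate t b = a by rewrite -fab (mateK tA).
rewrite [glue a b t]glue_circle ?fab //.
have [fxy|fxy] := eqVneq (tmate t x) y.
  rewrite [glue x y t]glue_circle ?fxy // !glue_circle /= ?fab ?fxy //.
  by split=> //; rewrite !circle_prod_cons mulrCA.
have anx : (a == tmate t x) = false by rewrite -(mate_sym tA) // fab eq_sym (negPf xb).
have any : (a == tmate t y) = false by rewrite -(mate_sym tA) // fab eq_sym (negPf yb).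
rewrite [glue a b _]glue_circle; last by rewrite glue_mateE // anx any fab.
by rewrite /glue /= (negPf fxy) /= anx any.
Qed.

(** Excludes that the two gluings close one circle out of two strands in the
twisted way, a to x and b to y. *)
Definition crossless t a b x y : Prop :=
  ~~ ((tmate t a == x) && (tmate t b == y)).

(** If neither pair closes a circle by itself, at most one coincidence between
{f a, f b} and {x, y} is possible, f being the mate function, except for
f a = y and f b = x.  With no coincidence two unrelated strands are formed, and
with one, a single strand whose word is a product of three factors in either
order.  In the exceptional case a circle closes, read as w x * w a when (x, y)
is glued last and as w a * w x when (a, b) is. *)
Lemma swap_glue A t a b x y : closed_under A t ->
  A a -> A b -> A x -> A y -> a != b -> x != y ->
  x != a -> x != b -> y != a -> y != b ->
  crossless t a b x y ->
  equivalent (delete (delete A (a, b)) (x, y))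
    (glue x y (glue a b t)) (glue a b (glue x y t)).
Proof.
move=> tA Aa Ab Ax Ay ab xy xa xb ya yb nc.
have sub (B : pred P) t1 t2 : (forall p, B p -> A p) -> equivalent A t1 t2 -> equivalent B t1 t2.
  by move=> BA [H e]; split=> // p /BA /H.
have dA p : delete (delete A (a, b)) (x, y) p -> A p by move=> /and3P [/and3P []].
have [fab|fab] := eqVneq (tmate t a) b.
  by apply: sub (swap_glue_circle _ _ _ _ _ _ _ _ _ fab).
have [fxy|fxy] := eqVneq (tmate t x) y.
  have [H e] : equivalent A (glue a b (glue x y t)) (glue x y (glue a b t)).
    by apply: swap_glue_circle; rewrite // eq_sym.
  by split=> // p /dA /H [-> ->].
have fE p q : A p -> A q -> (tmate t p == q) = (p == tmate t q) by exact: mate_sym.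
have ff p q : A p -> A q -> (tmate t p == tmate t q) = (p == q) by exact: mate_eq.
have nax : (a == x) = false by rewrite eq_sym; apply/negbTE.
have nbx : (b == x) = false by rewrite eq_sym; apply/negbTE.
have nay : (a == y) = false by rewrite eq_sym; apply/negbTE.
have nby : (b == y) = false by rewrite eq_sym; apply/negbTE.
have nba : (b == a) = false by rewrite eq_sym; apply/negbTE.
have nyx : (y == x) = false by rewrite eq_sym; apply/negbTE.
have fba : (b == tmate t a) = false by rewrite eq_sym; apply/negbTE.
have fyx : (y == tmate t x) = false by rewrite eq_sym; apply/negbTE.
have Ea : (a == tmate t x) = (x == tmate t a) by rewrite -fE // eq_sym.
have Eb : (b == tmate t x) = (x == tmate t b) by rewrite -fE // eq_sym.
have Fa : (a == tmate t y) = (y == tmate t a) by rewrite -fE // eq_sym.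
have Fb : (b == tmate t y) = (y == tmate t b) by rewrite -fE // eq_sym.
move: (nc); rewrite /crossless [_ == x]eq_sym [_ == y]eq_sym.
rewrite /equivalent /circle_prod /glue /= (negPf fab) /= (negPf fxy) /= Ea Eb Fa Fb.
have neg u v : A u -> A v -> u != tmate t v ->
    ((tmate t v == u) = false) * (((v == tmate t u) = false) * ((tmate t u == v) = false)).
  by move=> Au Av /negPf uv; rewrite eq_sym uv eq_sym fE // uv.
(* all coincidences; those identifying distinct ends are absurd *)
have [xfa|xfa] := eqVneq x (tmate t a); have [xfb|xfb] := eqVneq x (tmate t b);
  have [yfa|yfa] := eqVneq y (tmate t a); have [yfb|yfb] := eqVneq y (tmate t b) => //=.
all: move=> cross.
all: try by move: xy; rewrite xfa -?yfa ?eqxx.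
all: try by move: xy; rewrite xfb -?yfb ?eqxx.
all: try by move: (ff a b Aa Ab); rewrite -?xfa -?xfb -?yfa -?yfb ?eqxx (negPf ab).
(* in each case, the mates of a, b, x, y among these four *)
all: try have fxE : tmate t x = a by rewrite xfa (mateK tA).
all: try have fxE : tmate t x = b by rewrite xfb (mateK tA).
all: try have fyE : tmate t y = a by rewrite yfa (mateK tA).
all: try have fyE : tmate t y = b by rewrite yfb (mateK tA).
all: try have faE : tmate t a = x by rewrite xfa.
all: try have faE : tmate t a = y by rewrite yfa.
all: try have fbE : tmate t b = x by rewrite xfb.
all: try have fbE : tmate t b = y by rewrite yfb.
all: try have Nxa := neg _ _ Ax Aa xfa.
all: try have Nxb := neg _ _ Ax Ab xfb.
all: try have Nya := neg _ _ Ay Aa yfa.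
all: try have Nyb := neg _ _ Ay Ab yfb.
all: have Nab := neg b a Ab Aa (negbT fba).
all: have Nxy := neg y x Ay Ax (negbT fyx).
all: have N := (nax, nbx, nay, nby, nba, nyx, negPf ab, negPf xy, negPf xa, negPf xb, negPf ya, negPf yb).
all: rewrite ?(Nxa, Nxb, Nya, Nyb) ?Nxa ?Nxb ?Nya ?Nyb ?Nab ?Nxy ?(faE,fbE,fxE,fyE) ?ff // ?eqxx ?N /=.
all: split; last by rewrite // !big_cons circle_mulC.
all: move=> p /and3P [/and3P [_ /negPf pa /negPf pb] /negPf px /negPf py] /=.
all: rewrite ?(faE, fbE, fxE, fyE) ?(pa, pb, px, py) //.
(* the strand at p is affected only if p is the mate of a glued end *)
all: have [qa|qa] := eqVneq p (tmate t a); have [qb|qb] := eqVneq p (tmate t b);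
  have [qx|qx] := eqVneq p (tmate t x); have [qy|qy] := eqVneq p (tmate t y).
all: try by rewrite ?mulgA.
all: try by [move: px; rewrite qa faE eqxx | move: py; rewrite qa faE eqxx].
all: try by [move: px; rewrite qb fbE eqxx | move: py; rewrite qb fbE eqxx].
all: try by [move: pa; rewrite qx fxE eqxx | move: pb; rewrite qx fxE eqxx].
all: try by [move: pa; rewrite qy fyE eqxx | move: pb; rewrite qy fyE eqxx].
all: try by move: (ff a b Aa Ab); rewrite -qa -qb eqxx N.
all: try by move: (ff a x Aa Ax); rewrite -qa -qx eqxx N.
all: try by move: (ff a y Aa Ay); rewrite -qa -qy eqxx N.
all: try by move: (ff b x Ab Ax); rewrite -qb -qx eqxx N.
all: try by move: (ff b y Ab Ay); rewrite -qb -qy eqxx N.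
all: try by move: (ff x y Ax Ay); rewrite -qx -qy eqxx N.
all: by [rewrite fxE !mulgA | rewrite fyE !mulgA | rewrite faE !mulgA | rewrite fbE !mulgA].
Qed.

Section Adjacent.
Variable ps : P -> nat.
Hypothesis ps_inj : injective ps.

(** No free end separates the two ends on the boundary, so that the gluing arc
can be drawn without crossings. *)
Definition adjacent A (ab : P * P) : Prop :=
  [/\ A ab.1, A ab.2, (ps ab.1 < ps ab.2)%N &
      forall p, A p -> ~~ (ps ab.1 < ps p < ps ab.2)%N].

Fixpoint adjacents A (L : seq (P * P)) : Prop :=
  if L is ab :: L' then adjacent A ab /\ adjacents (delete A ab) L' else True.

Definition planar A t : Prop := good ps A (tmate t) (tword t).

Lemma planar_closed A t : planar A t -> closed_under A t.
Proof. by move=> G p /G []. Qed.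

Lemma adjacent_neq A ab : adjacent A ab -> ab.1 != ab.2.
Proof. by case=> _ _ lt _; apply: contraTneq lt => ->; rewrite ltnn. Qed.

Lemma adjacents_gluable A L : adjacents A L -> gluable A L.
Proof.
elim: L A => //= ab L IH A [adj /IH gL]; split=> //; [by case: adj | by case: adj |].
exact: adjacent_neq adj.
Qed.

Lemma planar_glue A t ab : planar A t -> adjacent A ab ->
  planar (delete A ab) (glue_pair t ab).
Proof. by move=> G [Aa Ab lt adj]; apply: (glue_good (ps := ps) _ _ _ _ _ _ G). Qed.

Lemma planar_glues A t L : planar A t -> adjacents A L ->
  planar (deletes A L) (glues L t).
Proof.
elim: L A t => //= ab L IH A t G [adj aL].
by apply: IH => //; apply: planar_glue.
Qed.

(** Were a joined to x and b to y, with a, b adjacent and x, y adjacent, then the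
two strands would cross. *)
Lemma planar_crossless A t ab xy : planar A t -> adjacent A ab -> adjacent A xy ->
  ab.1 != xy.1 -> ab.2 != xy.2 -> ab.1 != xy.2 -> ab.2 != xy.1 ->
  crossless t ab.1 ab.2 xy.1 xy.2.
Proof.
case: ab xy => a b [x y] G [/= Aa Ab ltab adj] [/= Ax Ay ltxy adj'] ax b_y ay bx.
apply/andP => -[/eqP fa /eqP fb].
have [_ _ fx _ _] := G a Aa; rewrite fa in fx.
have := adj x Ax; have := adj y Ay; have := adj' a Aa; have := adj' b Ab.
have [_ _ _ _ /(_ b Ab) [+ _]] := G a Aa; rewrite fa fb.
have [_ _ fyb _ _] := G b Ab; rewrite fb in fyb.
have [_ _ _ _ /(_ y Ay) [+ _]] := G x Ax; rewrite fx fyb.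
have neq u v : u != v -> ps u <> ps v by move=> /eqP uv /ps_inj.
by move: (neq _ _ ax) (neq _ _ b_y) (neq _ _ ay) (neq _ _ bx); lia.
Qed.

End Adjacent.
End Points.
End Swap.

Section SwapLists.
Variables (g : nat) (K : comNzRingType) (c : 'Fr_g -> K).
Hypothesis c_conj : forall u w : 'Fr_g, c (w ^ u)%g = c w.
Variables (P : eqType) (ps : P -> nat).
Hypothesis ps_inj : injective ps.
Implicit Types (A : pred P) (t : tangle g P) (L : seq (P * P)).
Local Notation equivalent := (equivalent c).

Lemma equivalent_sub A A' t t' :
  (forall p, A' p -> A p) -> equivalent A t t' -> equivalent A' t t'.
Proof. by move=> sAA [H e]; split=> // p /sAA /H. Qed.

Lemma adjacents_mem A L ab : adjacents ps A L -> ab \in L -> A ab.1 /\ A ab.2.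
Proof.
elim: L A => //= xy L IH A [[Ax Ay _ _] aL]; rewrite inE => /predU1P [->|] //.
by move=> /(IH _ aL) [/and3P [? _ _] /and3P [? _ _]].
Qed.

Lemma adjacent_sub A A' ab : (forall p, A' p -> A p) -> A' ab.1 -> A' ab.2 ->
  adjacent ps A ab -> adjacent ps A' ab.
Proof. by move=> sAA Aa Ab [_ _ lt adj]; split=> // p /sAA /adj. Qed.

Lemma adjacents_sub A A' L : (forall p, A' p -> A p) ->
  (forall ab, ab \in L -> A' ab.1 /\ A' ab.2) ->
  adjacents ps A L -> adjacents ps A' L.
Proof.
elim: L A A' => //= ab L IH A A' sAA mA [adj aL].
have [Aa Ab] := mA ab (mem_head _ _); split; first exact: adjacent_sub adj.
apply: (IH _ _ _ _ aL) => [p /and3P [/sAA Ap pa pb]|xy xyL]; first exact/and3P.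
have [/and3P [_ xa xb] /and3P [_ ya yb]] := adjacents_mem aL xyL.
have [Ax Ay] : A' xy.1 /\ A' xy.2 by apply: mA; rewrite inE xyL orbT.
by rewrite /delete Ax Ay xa xb ya yb.
Qed.

Definition disjoint_pairs (ab xy : P * P) : bool :=
  [&& xy.1 != ab.1, xy.2 != ab.1, xy.1 != ab.2 & xy.2 != ab.2].

(** By adjacent transpositions.  Planarity is available at each step because the
pairs of L stay adjacent when other ends are removed. *)
Lemma swap_glue_glues A t ab L : planar ps A t ->
  adjacent ps A ab -> adjacents ps A L -> all (disjoint_pairs ab) L ->
  equivalent (deletes (delete A ab) L)
    (glues L (glue_pair t ab)) (glue_pair (glues L t) ab).
Proof.
elim: L A t => [|xy L IH] A t G adj aL; first by [].
move: aL => /= [adj' aL] /andP [/and4P [d1 d2 d3 d4] dL].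
have sw : equivalent (delete (delete A ab) xy)
   (glue_pair (glue_pair t ab) xy) (glue_pair (glue_pair t xy) ab).
  have [Aa Ab _ _] := adj; have [Ax Ay _ _] := adj'.
  have nc : crossless t ab.1 ab.2 xy.1 xy.2.
    by apply: (planar_crossless ps_inj G adj adj'); rewrite eq_sym.
  have := swap_glue c_conj (planar_closed G) Aa Ab Ax Ay (adjacent_neq adj) (adjacent_neq adj').
  by rewrite /glue_pair -!surjective_pairing; apply.
have adjd : adjacent ps (delete A xy) ab.
  have [Aa Ab _ _] := adj.
  by apply: (adjacent_sub _ _ _ adj) => [p /and3P [] //||]; apply/and3P; split; rewrite // eq_sym.
have adjd' : adjacent ps (delete A ab) xy.
  have [Ax Ay _ _] := adj'.
  by apply: (adjacent_sub _ _ _ adj') => [p /and3P [] //||]; apply/and3P; split.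
have Gxy := planar_glue ps_inj G adj'.
have {IH} step := IH _ _ Gxy adjd aL dL.
have aL' : adjacents ps (delete (delete A ab) xy) L.
  apply: (adjacents_sub _ _ aL) => [p|uv uvL].
    by move=> /and3P [/and3P [? _ _] ? ?]; apply/and3P.
  have [/and3P [Au ux uy] /and3P [Av vx vy]] := adjacents_mem aL uvL.
  have /and4P [e1 e2 e3 e4] := allP dL _ uvL.
  by rewrite /delete Au Av ux uy vx vy /= e1 e2 e3 e4.
have Gab := planar_glue ps_inj G adj.
have cl : closed_under (delete (delete A ab) xy) (glue_pair (glue_pair t ab) xy).
  by apply: planar_closed (planar_glue ps_inj Gab adjd').
apply: equivalent_trans (equivalent_glues cl (adjacents_gluable aL') sw) _.
apply: equivalent_sub step => p; rewrite !deletesE /delete.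
by case: (A p); rewrite ?andbF //=; do 4!case: (p != _); rewrite ?andbF.
Qed.

Lemma deletes_disjoint A ab L : all (disjoint_pairs ab) L -> A ab.1 -> A ab.2 ->
  deletes A L ab.1 /\ deletes A L ab.2.
Proof.
move=> /allP dL Aa Ab; rewrite !deletesE Aa Ab /=.
by split; apply/andP; split; apply/mapP => -[xy /dL /and4P [d1 d2 d3 d4] /eqP];
  rewrite eq_sym ?(negPf d1) ?(negPf d2) ?(negPf d3) ?(negPf d4).
Qed.

Lemma swap_glues A t L L' : planar ps A t ->
  adjacents ps A L -> adjacents ps A L' -> allrel disjoint_pairs L L' ->
  equivalent (deletes (deletes A L) L') (glues L' (glues L t)) (glues L (glues L' t)).
Proof.
elim: L A t => [|ab L IH] A t G /=; first by [].
move=> [adj aL] aL' /andP [dL' dLL'].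
have Gab := planar_glue ps_inj G adj.
have aL'' : adjacents ps (delete A ab) L'.
  apply: (adjacents_sub _ _ aL') => [p /and3P [] //|uv uvL'].
  have [Au Av] := adjacents_mem aL' uvL'.
  have /and4P [e1 e2 e3 e4] := allP dL' _ uvL'.
  by rewrite /delete Au Av e1 e2 e3 e4.
have aLL : adjacents ps (deletes (delete A ab) L') L.
  apply: (adjacents_sub _ _ aL) => [p|uv uvL]; first by rewrite deletesE => /and3P [].
  have [Au Av] := adjacents_mem aL uvL.
  exact: deletes_disjoint (allP dLL' _ uvL) Au Av.
have step := IH _ _ Gab aL aL'' dLL'.
have step' := equivalent_glues (planar_closed (planar_glues ps_inj Gab aL''))
  (adjacents_gluable aLL) (swap_glue_glues G adj aL' dL').
apply: (equivalent_trans step); apply: equivalent_sub step' => p.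
by rewrite !deletesE; case: (delete A ab p); rewrite ?andbF //= andbC.
Qed.
End SwapLists.

(** * Gluing along a line *)

(** The glued points occupy the positions C-k, ..., C+k-1 symmetrically around C,
so the i-th pair becomes adjacent as soon as the pairs before it are gone. *)
Lemma adjacents_line (P : eqType) (ps : P -> nat) k (a b : 'I_k -> P) C :
  injective ps -> (forall i, (ps (a i) + i.+1 = C)%N) -> (forall i, (ps (b i) = C + i)%N) ->
  adjacents ps predT [seq (a i, b i) | i <- enum 'I_k].
Proof.
move=> ps_inj pa pb.
have aN i j : (a i == a j) = (i == j).
  apply/eqP/eqP => [E|-> //]; apply: val_inj; have := pa i; have := pa j.
  by rewrite E /=; lia.
have bN i j : (b i == b j) = (i == j).
  apply/eqP/eqP => [E|-> //]; apply: val_inj; have := pb i; have := pb j.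
  by rewrite E /=; lia.
have abN i j : a i != b j.
  by apply/eqP => E; have := pa i; have := pb j; rewrite E; lia.
suff gen (r : seq 'I_k) (A : pred P) :
    (forall i, A (a i) = (i \in r) /\ A (b i) = (i \in r)) ->
    sorted ltn [seq val i | i <- r] -> adjacents ps A [seq (a i, b i) | i <- r].
  by apply: gen => [i|]; rewrite ?mem_enum // val_enum_ord iota_ltn_sorted.
elim: r A => //= i r IH A HA.
rewrite (path_sortedE ltn_trans) => /andP [/allP ir sr].
have ltr j : j \in r -> (i < j)%N by move=> jr; apply: ir; apply: map_f.
have [Aa Ab] : A (a i) /\ A (b i) by have [-> ->] := HA i; rewrite inE eqxx.
have inr : i \in r = false by apply/negP => /ltr; rewrite ltnn.
split; first split=> //=.
- by rewrite -(ltn_add2r i.+1) pa pb; lia.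
- move=> p Ap; apply/negP => /andP [lo hi].
  have [j lt jp] : exists2 j : 'I_k, (j < i)%N & p = a j \/ p = b j.
    have [pC|Cp] := ltnP (ps p) C.
      have lt : (C - (ps p).+1 < k)%N by have := ltn_ord i; have := pa i; lia.
      exists (Ordinal lt) => /=; first by have := pa i; lia.
      by left; apply: ps_inj; have := pa (Ordinal lt) => /=; lia.
    have lt : (ps p - C < k)%N by have := ltn_ord i; have := pb i; lia.
    exists (Ordinal lt) => /=; first by have := pb i; lia.
    by right; apply: ps_inj; rewrite pb /=; lia.
  have jr : j \in i :: r by have [Ea Eb] := HA j; case: jp Ap => ->; rewrite ?Ea ?Eb.
  by move: jr; rewrite inE => /predU1P [ji|/ltr]; [rewrite ji ltnn in lt|lia].
apply: IH => // j; rewrite /delete /= ?aN ?bN abN [b j == _]eq_sym abN !andbT.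
have [-> ->] := HA j; rewrite inE; have [->|] := eqVneq j i; first by rewrite inr.
by rewrite andbT.
Qed.

Section Concat.
Variable g : nat.
Local Notation tangle := (tangle g).

Definition tangle_of m n (x : diagram g m n) : tangle (pt m n) :=
  Tangle (mate x) (word x) [::].

Lemma diagram_planar m n (x : diagram g m n) :
  planar (@pos m n) predT (tangle_of x).
Proof. exact: elimT (diagramP _) (valP x). Qed.

Lemma pos_lt m n (p : pt m n) : (pos p < m + n)%N.
Proof. by case: p => i /=; have := ltn_ord i; lia. Qed.

Definition beside (P Q : Type) (t : tangle P) (t' : tangle Q) : tangle (P + Q) :=
  Tangle
    (fun p => match p with inl q => inl (tmate t q) | inr q => inr (tmate t' q) end)
    (fun p => match p with inl q => tword t q | inr q => tword t' q end)
    (circles t ++ circles t').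

Definition beside_pos (P Q : Type) N (ps : P -> nat) (qs : Q -> nat) (p : P + Q) : nat :=
  match p with inl q => ps q | inr q => N + qs q end.

Section BesidePlanar.
Variables (P Q : eqType) (N : nat) (ps : P -> nat) (qs : Q -> nat).
Hypothesis ps_lt : forall p, (ps p < N)%N.

Lemma beside_pos_inj : injective ps -> injective qs -> injective (beside_pos N ps qs).
Proof.
move=> pI qI [p|p] [q|q] /= E.
- by congr inl; apply: pI.
- by have := ps_lt p; lia.
- by have := ps_lt q; lia.
- by congr inr; apply: qI; lia.
Qed.

Lemma beside_planar (t : tangle P) (t' : tangle Q) :
  planar ps predT t -> planar qs predT t' ->
  planar (beside_pos N ps qs) predT (beside t t').
Proof.
move=> G G' [] p _.
  have [_ h1 h2 h3 h4] := G p isT; split=> //=.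
  - by congr inl.
  move=> [] q _ /=; first exact: h4.
  by have := ps_lt p; have := ps_lt (tmate t p); split; lia.
have [_ h1 h2 h3 h4] := G' p isT; split=> //=.
- by congr inr.
move=> [] q _ /=; last by rewrite !ltn_add2l; apply: h4.
by have := ps_lt q; have := ps_lt (tmate t q); split; lia.
Qed.
End BesidePlanar.

Definition line m k n : seq (jpt m k n * jpt m k n) :=
  [seq (inl (inr i), inr (inl i)) | i <- enum 'I_k].

Lemma stackE m k n (x : diagram g m k) (y : diagram g k n) :
  stack x y = glues (line m k n) (beside (tangle_of x) (tangle_of y)).
Proof.
rewrite /stack -[juxtapose x y]/(beside (tangle_of x) (tangle_of y)) /glues /line.
by elim: (enum _) (beside _ _) => /=.
Qed.

Definition jpt_pos m k n : jpt m k n -> nat :=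
  beside_pos (m + k) (@pos m k) (@pos k n).

Lemma jpt_pos_inj m k n : injective (@jpt_pos m k n).
Proof. exact: beside_pos_inj (@pos_lt m k) (@pos_inj _ _) (@pos_inj _ _). Qed.

Lemma jpt_planar m k n (x : diagram g m k) (y : diagram g k n) :
  planar (@jpt_pos m k n) predT (beside (tangle_of x) (tangle_of y)).
Proof.
exact: (@beside_planar (pt m k) (pt k n) _ _ _ (@pos_lt m k) _ _
  (diagram_planar x) (diagram_planar y)).
Qed.

Lemma line_adjacents m k n : adjacents (@jpt_pos m k n) predT (line m k n).
Proof.
apply: (@adjacents_line _ _ _ _ _ (m + k)); first exact: jpt_pos_inj.
  by move=> i /=; have := ltn_ord i; lia.
by [].
Qed.

Lemma line_gluable m k n : gluable predT (line m k n).
Proof. exact: adjacents_gluable (line_adjacents m k n). Qed.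

Lemma deletes_line m k n p :
  deletes predT (line m k n) p = if of_outer p is Some _ then true else false.
Proof.
rewrite deletesE /line /unzip1 /unzip2 -(map_comp fst) -(map_comp snd).
case: p => [] [] i.
- by apply/and3P; split=> //; apply/mapP => -[].
- apply/negbTE/and3P => -[_ /mapP []].
  by exists i; rewrite ?mem_enum.
- apply/negbTE/and3P => -[_ _ /mapP []].
  by exists i; rewrite ?mem_enum.
- by apply/and3P; split=> //; apply/mapP => -[].
Qed.

Lemma stack_closed m k n (x : diagram g m k) (y : diagram g k n) :
  closed_under (deletes predT (line m k n)) (stack x y).
Proof.
rewrite stackE; apply: glues_closed (line_gluable m k n).
exact: planar_closed (jpt_planar x y).
Qed.

(** Relates composites to stacks without the default value in the definition of
composites. *)
Lemma mate_concat m k n (x : diagram g m k) (y : diagram g k n) p :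
  outer k (mate (concat x y) p) = tmate (stack x y) (outer k p).
Proof.
rewrite /mate /= ffunE /=.
have := mateA (@stack_closed _ _ _ x y) (p := outer k p).
rewrite !deletes_line; case: (tmate _ _) => [] [] i //= H.
  by case: p H => q /(_ isT).
by case: p H => q /(_ isT).
Qed.

Lemma word_concat m k n (x : diagram g m k) (y : diagram g k n) p :
  word (concat x y) p = tword (stack x y) (outer k p).
Proof. by rewrite /word /= ffunE. Qed.

End Concat.

(** * Composition is associative *)

Section Avoid.
Variables (g : nat) (P Q : eqType) (h : P -> Q).

(** A part of the stack that is disjoint from the gluing line is unaffected. *)
Lemma transports_avoid (A : pred P) (B : pred Q) (t : tangle g P) (t' : tangle g Q) L :
  closed_under A t -> closed_under B t' -> gluable B L ->
  (forall ab p, ab \in L -> A p -> h p != ab.1 /\ h p != ab.2) ->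
  transports h id A t t' -> transports h id A t (glues L t').
Proof.
move=> tA; elim: L B t' => //= -[a b] L IH B t' tB [/= Ba Bb ab gL] hL H.
apply: (IH (delete B (a, b)) (glue_pair t' (a, b)) _ gL); first exact: glue_closed.
  by move=> xy p xyL; apply: hL; rewrite inE xyL orbT.
move=> p Ap; have [Hp Hp'] := H p Ap.
have fpN : tmate t' (h p) != a /\ tmate t' (h p) != b.
  by rewrite Hp; apply: (hL (a, b)); rewrite ?mem_head // (mateA tA).
have N y : B y -> tmate t' (h p) != y -> (h p == tmate t' y) = false.
  by move=> By; apply: contraNF => /eqP ->; rewrite (mateK tB).
case: fpN => /(N a Ba) Na /(N b Bb) Nb.
have [fab|fab] := eqVneq (tmate t' a) b.
  by rewrite /glue_pair glue_circle ?fab.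
by rewrite /glue_pair glue_mateE // glue_wordE // Na Nb.
Qed.

End Avoid.

Section Nested.
Variables (g : nat) (K : comNzRingType) (c : 'Fr_g -> K).

Definition glue_sum (P Q R : Type) (h : P -> R) (h' : Q -> R) (p : P + Q) : R :=
  match p with inl q => h q | inr q => h' q end.

Lemma transports_beside (P Q R : eqType) (h : P -> R) (h' : Q -> R)
    (t : tangle g P) (t' : tangle g Q) (T : tangle g R) :
  transports h id predT t T -> transports h' id predT t' T ->
  transports (glue_sum h h') id predT (beside t t') T.
Proof. by move=> H H' [] p _ /=; [apply: H | apply: H']. Qed.

(** Compositionality: gluing inside a larger tangle the line between x and y
replaces x next to y by the composite. *)
Lemma transports_concat m k n (x : diagram g m k) (y : diagram g k n) (R : eqType)
    (h : jpt m k n -> R) (T : tangle g R) :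
  injective h -> transports h id predT (beside (tangle_of x) (tangle_of y)) T ->
  let L := map (image_pair h false) (line m k n) in
  transports (h \o @outer m k n) id predT (tangle_of (concat x y)) (glues L T) /\
  circle_prod c (glues L T) = circle_factor c x y * circle_prod c T.
Proof.
move=> h_inj H L.
have tA := planar_closed (jpt_planar x y).
have [] := transports_glues false h_inj (theta := id) (fun _ _ => erefl) tA (line_gluable m k n) H.
rewrite -stackE -/L => H' [z []]; rewrite cats0 => z1 z2; split.
  move=> p _ /=; have [|-> ->] := H' (outer k p); first by rewrite deletes_line; case: p.
  by rewrite mate_concat word_concat.
by rewrite /circle_factor /circle_prod z2 z1 big_cat /= map_id.
Qed.

Lemma diagram_eq m n (x y : diagram g m n) :
  (forall p, mate x p = mate y p /\ word x p = word y p) -> x = y.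
Proof.
move=> H; apply/val_inj/ffunP => p; have [] := H p.
by rewrite /mate /word /=; case: (_ p) => ? ?; case: (_ p) => ? ? /= -> ->.
Qed.

Lemma outer_inj m k n : injective (@outer m k n).
Proof. by move=> [i|i] [j|j] //= [->]. Qed.
End Nested.

Section Associativity.
Variables (g : nat) (K : comNzRingType) (c : 'Fr_g -> K).
Hypothesis c_conj : forall u w : 'Fr_g, c (w ^ u)%g = c w.
Variables (m k l n : nat).
Variables (x : diagram g m k) (y : diagram g k l) (z : diagram g l n).

Let P3 : eqType := (jpt m k l + pt l n)%type.
Let T3 : tangle g P3 := beside (beside (tangle_of x) (tangle_of y)) (tangle_of z).
Let ps3 : P3 -> nat := beside_pos ((m + k) + (k + l)) (@jpt_pos m k l) (@pos l n).

Let jpt_lt (p : jpt m k l) : (jpt_pos p < (m + k) + (k + l))%N.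
Proof. by case: p => p /=; have := pos_lt p; lia. Qed.

Let ps3_inj : injective ps3.
Proof. exact: beside_pos_inj jpt_lt (@jpt_pos_inj m k l) (@pos_inj l n). Qed.

Let planar3 : planar ps3 predT T3.
Proof.
exact: (@beside_planar g (jpt m k l) (pt l n) _ _ (@pos l n) jpt_lt _ _
  (jpt_planar x y) (diagram_planar z)).
Qed.

Let lower_in (p : jpt m k l) : P3 := inl p.
Let upper_in (p : jpt k l n) : P3 := glue_sum (fun q => inl (inr q)) inr p.
Let lower_out (p : jpt m l n) : P3 := glue_sum (lower_in \o @outer m k l) inr p.
Let upper_out (p : jpt m k n) : P3 := glue_sum (fun q => inl (inl q)) (upper_in \o @outer k l n) p.

Let L : seq (P3 * P3) :=
  [seq (inl (inl (inr i)), inl (inr (inl i))) | i <- enum 'I_k].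
Let L' : seq (P3 * P3) :=
  [seq (inl (inr (inr i)), inr (inl i)) | i <- enum 'I_l].

Let lower_inE : map (image_pair lower_in false) (line m k l) = L.
Proof. by rewrite /line -map_comp. Qed.
Let upper_inE : map (image_pair upper_in false) (line k l n) = L'.
Proof. by rewrite /line -map_comp. Qed.
Let lower_outE : map (image_pair lower_out false) (line m l n) = L'.
Proof. by rewrite /line -map_comp. Qed.
Let upper_outE : map (image_pair upper_out false) (line m k n) = L.
Proof. by rewrite /line -map_comp. Qed.

Let adjL : adjacents ps3 predT L.
Proof.
apply: (@adjacents_line _ _ _ _ _ (m + k)); first exact: ps3_inj.
  by move=> i /=; have := ltn_ord i; lia.
by [].
Qed.

Let adjL' : adjacents ps3 predT L'.
Proof.
apply: (@adjacents_line _ _ _ _ _ (m + k + (k + l))); first exact: ps3_inj.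
  by move=> i /=; have := ltn_ord i; lia.
by [].
Qed.

Let disjLL' : allrel (@disjoint_pairs P3) L L'.
Proof. by apply/allrelP => _ _ /mapP [i _ ->] /mapP [j _ ->]. Qed.

Let left_assoc :
  transports (lower_out \o @outer m l n) id predT (tangle_of (concat (concat x y) z))
    (glues L' (glues L T3)) /\
  circle_prod c (glues L' (glues L T3)) = circle_factor c (concat x y) z * circle_factor c x y.
Proof.
have clz := planar_closed (diagram_planar z).
have Hxy : transports lower_in id predT (beside (tangle_of x) (tangle_of y)) T3.
  by move=> [] p.
have Hz : transports (inr : _ -> P3) id predT (tangle_of z) T3 by [].
have [|H1 e1] := transports_concat c _ Hxy; first by move=> p q [].
rewrite lower_inE in H1 e1.
have Hz1 : transports (inr : _ -> P3) id predT (tangle_of z) (glues L T3).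
  apply: (transports_avoid clz (planar_closed planar3) (adjacents_gluable adjL)) => //.
  by move=> _ p /mapP [i _ ->].
have [|H2 e2] := transports_concat c _ (transports_beside H1 Hz1).
  by move=> [] p [] q //= [] => [/outer_inj|] ->.
rewrite -/lower_out lower_outE e1 in H2 e2; split=> //.
by rewrite e2 [circle_prod c T3]big_nil mulr1.
Qed.

Let right_assoc :
  transports (upper_out \o @outer m k n) id predT (tangle_of (concat x (concat y z)))
    (glues L (glues L' T3)) /\
  circle_prod c (glues L (glues L' T3)) = circle_factor c x (concat y z) * circle_factor c y z.
Proof.
have clx := planar_closed (diagram_planar x).
have Hyz : transports upper_in id predT (beside (tangle_of y) (tangle_of z)) T3.
  by move=> [] p.
have Hx : transports (inl \o inl : _ -> P3) id predT (tangle_of x) T3 by [].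
have [|H1 e1] := transports_concat c _ Hyz; first by move=> [] p [] q //= [->].
rewrite upper_inE in H1 e1.
have Hx1 : transports (inl \o inl : _ -> P3) id predT (tangle_of x) (glues L' T3).
  apply: (transports_avoid clx (planar_closed planar3) (adjacents_gluable adjL')) => //.
  by move=> _ p /mapP [i _ ->].
have [|H2 e2] := transports_concat c _ (transports_beside Hx1 H1).
  by move=> [] [i|i] [] [j|j] //= [->].
rewrite -/upper_out upper_outE e1 in H2 e2; split=> //.
by rewrite e2 [circle_prod c T3]big_nil mulr1.
Qed.

(** Gluing the lower line L first embeds the left bracketing, gluing the upper
line L' first embeds the right one, and these gluings commute. *)
Lemma concat_assoc : concat (concat x y) z = concat x (concat y z) /\
  circle_factor c (concat x y) z * circle_factor c x y =
  circle_factor c x (concat y z) * circle_factor c y z.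
Proof.
have [H1 e1] := left_assoc; have [H2 e2] := right_assoc.
have [H e] := swap_glues c_conj ps3_inj planar3 adjL adjL' disjLL'.
split; last by rewrite -e1 -e2.
have outE p : upper_out (outer k p) = lower_out (outer l p) by case: p.
have out_inj : injective (lower_out \o @outer m l n) by move=> [i|i] [j|j] //= [->].
apply: diagram_eq => p; have [f1 w1] := H1 p isT; have [f2 w2] := H2 p isT.
have [|f3 w3] := H (lower_out (outer l p)).
  rewrite !deletesE /= /L /L' /unzip1 /unzip2 -!map_comp; case: {f1 w1 f2 w2} p => i.
    by apply/and3P; split; [apply/andP; split| |]; apply/mapP => -[].
  by apply/and3P; split; [apply/andP; split| |]; apply/mapP => -[].
rewrite /= outE in f2 w2; rewrite /= in f1 w1 f3 w3.
split; last by rewrite [LHS](esym w1) [RHS](esym w2) w3.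
by apply: out_inj; rewrite [LHS](esym f1) -f3 f2 outE.
Qed.

End Associativity.

Lemma concatA g m k l n (x : diagram g m k) (y : diagram g k l) (z : diagram g l n) :
  concat (concat x y) z = concat x (concat y z).
Proof. by have [] := @concat_assoc g int (fun=> 1) (fun _ _ => erefl) _ _ _ _ x y z. Qed.

Lemma circle_factorA g (K : comNzRingType) (c : 'Fr_g -> K) m k l n
    (x : diagram g m k) (y : diagram g k l) (z : diagram g l n) :
  (forall u w : 'Fr_g, c (w ^ u)%g = c w) ->
  circle_factor c (concat x y) z * circle_factor c x y =
  circle_factor c x (concat y z) * circle_factor c y z.
Proof. by move=> c_conj; case: (concat_assoc c_conj x y z). Qed.

(** * Turning diagrams upside down *)

Section Reversal.
Variable g : nat.
Implicit Types u v : 'Fr_g.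

Lemma lcons_map_linv (x : letter g) w : 
  lcons (linv x) (map (@linv g) w) = map (@linv g) (lcons x w).
Proof. by case: w => //= y w; rewrite (can_eq (@linvK g)); case: ifP. Qed.

(** Reversing the inverse of a word inverts each letter in place, which is the
automorphism of the free group sending generators to their inverses. *)
Lemma frev_invM u v : frev (u * v)^-1%g = (frev u^-1 * frev v^-1)%g.
Proof.
apply: val_inj => /=; rewrite !revK.
by elim: (u : seq _) => //= x s <-; rewrite lcons_map_linv.
Qed.

Lemma frevM u v : frev (u * v)%g = (frev v * frev u)%g.
Proof. by rewrite -[(u * v)%g]invgK invgM frev_invM !invgK. Qed.

End Reversal.

Section DiagramBasics.
Variable g : nat.
Variables m n : nat.
Implicit Type x : diagram g m n.

Let clx x := planar_closed (diagram_planar x).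

Lemma mate_invol x : involutive (mate x).
Proof. by move=> p; apply: (mateK (clx x)). Qed.
Lemma mate_neq_self x p : mate x p != p.
Proof. by apply: (mate_neq (clx x)). Qed.
Lemma word_mate x p : word x (mate x p) = (word x p)^-1%g.
Proof. by apply: (wordV (clx x)). Qed.
Lemma mate_inj x : injective (mate x).
Proof. exact: can_inj (mate_invol x). Qed.

Lemma mate_flip x p : mate (flip x) (swap p) = swap (mate x p).
Proof. by rewrite /mate /= ffunE /= swapK. Qed.

Lemma word_flip x p : word (flip x) (swap p) = frev (word x p)^-1%g.
Proof. by rewrite -word_mate {1}/word /= ffunE /= swapK. Qed.
End DiagramBasics.

Lemma flipK g m n : cancel (@flip g m n) (@flip g n m).
Proof.
move=> x; apply: diagram_eq => p; rewrite -{1 3}(swapK p) mate_flip word_flip.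
by rewrite -{1 2}(swapK p) mate_flip word_flip !swapK frevV frevK invgK.
Qed.

Lemma flip_coil g l (b : 'Fr_g) : flip (coil l b) = coil l (frev b).
Proof.
apply: diagram_eq => p; rewrite -(swapK p) mate_flip word_flip.
move: (swap p) => {}p; rewrite /mate /word /= !ffunE /=; split=> //.
by case: p => i /=; case: eqP => _; rewrite ?invg1 ?frev1 ?invgK // frevV.
Qed.

Section FlipConcat.
Variables (g m k n : nat) (x : diagram g m k) (y : diagram g k n).

Let jswap (p : jpt m k n) : jpt n k m :=
  match p with inl q => inr (swap q) | inr q => inl (swap q) end.

Let jswap_inj : injective jswap.
Proof. by move=> [p|p] [q|q] //= [] /(can_inj (@swapK _ _)) ->. Qed.

(* Flipping exchanges the two sides of the line, and thus the direction in which
circles are read. *)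
Let flip_stack :
  transports jswap (fun u => frev u^-1%g) (deletes predT (line m k n))
    (stack x y) (stack (flip y) (flip x)) /\
  circles (stack (flip y) (flip x)) = map (@frev g) (circles (stack x y)).
Proof.
have H : transports jswap (fun u => frev u^-1%g) predT
    (beside (tangle_of x) (tangle_of y)) (beside (tangle_of (flip y)) (tangle_of (flip x))).
  by move=> [] p _ /=; rewrite mate_flip word_flip.
have LE : map (image_pair jswap true) (line m k n) = line n k m.
  by rewrite /line -map_comp.
have [] := transports_glues true jswap_inj (@frev_invM g)
  (planar_closed (jpt_planar x y)) (line_gluable m k n) H.
rewrite LE -!stackE => H' [z []]; rewrite !cats0 => -> ->; split=> //.
by apply: eq_map => w; rewrite /image_circle invgK.
Qed.

Lemma flip_concat : flip (concat x y) = concat (flip y) (flip x).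
Proof.
have [H _] := flip_stack.
have jo p : jswap (outer k p) = outer k (swap p) by case: p.
apply: diagram_eq => p; rewrite -(swapK p); move: (swap p) => {}p.
have [|Hm Hw] := H (outer k p); first by rewrite deletes_line; case: p.
rewrite jo in Hm Hw; rewrite mate_flip word_flip !word_concat Hw; split=> //.
by apply: (@outer_inj n k m); rewrite mate_concat Hm -jo -mate_concat; case: (mate _ _).
Qed.

(** A closed component is traversed clockwise before and after flipping, hence in
opposite directions, while coils keep their signs. *)
Lemma circle_factor_flip (K : comNzRingType) (c : 'Fr_g -> K) :
  circle_factor c (flip y) (flip x) = circle_factor (fun w => c (frev w)) x y.
Proof. by have [_ e] := flip_stack; rewrite /circle_factor e big_map. Qed.

End FlipConcat.

(** * Composition with full diagrams *)

Section FullDiagrams.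
Variables (g m k : nat).

(** Half-diagrams without the condition on windings; these are the composites of
a half-diagram and coils. *)
Definition is_full (x : diagram g m k) : bool := [forall j : 'I_k, is_inl (mate x (inr j))].

Lemma fullP (x : diagram g m k) :
  reflect (exists s : 'I_k -> 'I_m, forall j, mate x (inr j) = inl (s j)) (is_full x).
Proof.
apply: (iffP forallP) => [H|[s Hs] j]; last by rewrite Hs.
have f j : exists i, mate x (inr j) == inl i by have := H j; case: (mate _ _) => // i; exists i.
by exists (fun j => xchoose (f j)) => j; apply/eqP/(xchooseP (f j)).
Qed.
End FullDiagrams.

Section ConcatFull.
Variables (g m k n : nat) (x : diagram g m k) (s : 'I_k -> 'I_m).
Hypothesis xs : forall j, mate x (inr j) = inl (s j).

Lemma mate_src j : mate x (inl (s j)) = inr j.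
Proof. by rewrite -xs mate_invol. Qed.

Lemma src_inj : injective s.
Proof. by move=> i j E; have := mate_src i; rewrite E mate_src => -[]. Qed.

(** Slides an end of w down along the through strands of x. *)
Definition push (p : pt k n) : pt m n :=
  match p with inl i => inl (s i) | inr j => inr j end.

(** The word picked up on the way, read from the new end to the old one. *)
Definition push_word (p : pt k n) : 'Fr_g :=
  match p with inl i => (word x (inr i))^-1%g | inr _ => 1%g end.

Lemma push_inj : injective push.
Proof. by move=> [i|i] [j|j] //= []; [move/src_inj -> | move->]. Qed.

Variable w : diagram g k n.

(* Where an end of w is found when the points of r remain to be glued. *)
Let at_ (r : seq 'I_k) (p : pt k n) : jpt m k n :=
  match p with
  | inl i => if i \in r then inr (inl i) else inl (inl (s i))
  | inr j => inr (inr j)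
  end.

Let at_word (r : seq 'I_k) (p : pt k n) : 'Fr_g :=
  match p with
  | inl i => if i \in r then 1%g else (word x (inr i))^-1%g
  | inr _ => 1%g
  end.

Let at_inj r : injective (at_ r).
Proof.
by move=> [i|i] [j|j] //=; do ?[case: ifP => _]; move=> // -[] //; [move->|move/src_inj->|move->].
Qed.

Let state (r : seq 'I_k) (t : tangle g (jpt m k n)) : Prop :=
  [/\ forall p, tmate t (at_ r p) = at_ r (mate w p) /\
        tword t (at_ r p) = (at_word r p * word w p * (at_word r (mate w p))^-1)%g,
      forall i i', mate x (inl i) = inl i' ->
        tmate t (inl (inl i)) = inl (inl i') /\ tword t (inl (inl i)) = word x (inl i),
      forall j, j \in r ->
        [/\ tmate t (inl (inr j)) = inl (inl (s j)),
            tword t (inl (inr j)) = word x (inr j),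
            tmate t (inl (inl (s j))) = inl (inr j) &
            tword t (inl (inl (s j))) = (word x (inr j))^-1%g] &
      circles t = [::]].

(* The i-th bottom point of w is moved to s i.  No circle closes: the strand at
the i-th top point of x ends at the bottom of x. *)
Let state_step i r t : i \notin r -> state (i :: r) t ->
  state r (glue (inl (inr i)) (inr (inl i)) t).
Proof.
move=> ir [Hp Hc Hr Ht].
have [fa wa ffa wfa] := Hr i (mem_head _ _).
have [] := Hp (inl i); rewrite /= mem_head => fb wb.
have wfi := mate_neq_self w (inl i).
set q := mate w (inl i) in fb wb wfi.
have wq : mate w q = inl i by rewrite mate_invol.
have fab : tmate t (inl (inr i)) != inr (inl i) by rewrite fa.
have atE p : p != inl i -> at_ r p = at_ (i :: r) p /\ at_word r p = at_word (i :: r) p.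
  by case: p => //= j; rewrite inE; have [->|] := eqVneq j i; rewrite ?eqxx.
have ati : at_ r (inl i) = inl (inl (s i)) by rewrite /= (negPf ir).
have atwi : at_word r (inl i) = (word x (inr i))^-1%g by rewrite /= (negPf ir).
have [q1 q2] := atE q wfi.
have at_fa p : p != inl i -> at_ (i :: r) p != inl (inl (s i)).
  by move=> pi; have [<- _] := atE p pi; rewrite -ati (inj_eq (@at_inj r)).
split.
- move=> p; rewrite glue_mateE // glue_wordE // fa fb wfa wa wb.
  have [->|pi] := eqVneq p (inl i).
    by rewrite ati eqxx -/q q1 q2 atwi mul1g mulgA.
  have [e1 e2] := atE p pi; rewrite e1 e2 (negPf (at_fa p pi)) (inj_eq (@at_inj _)).
  have [->|pq] := eqVneq p q.
    have [_ ->] := Hp q; rewrite wq ati atwi invgK /= mem_head.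
    by rewrite invg1 mulg1.
  have wpi : mate w p != inl i by apply: contraNneq pq => E; rewrite /q -E mate_invol.
  by have [e3 e4] := atE _ wpi; rewrite e3 e4; apply: Hp.
- move=> i1 i2 xi; rewrite glue_mateE // glue_wordE // fa fb.
  have -> : (inl (inl i1) == inl (inl (s i)) :> jpt m k n) = false.
    by apply/eqP => -[E]; move: xi; rewrite E mate_src.
  have -> : (inl (inl i1) == at_ (i :: r) q) = false.
    case: (q) => j //=; case: ifP => // _; apply/eqP => -[E].
    by move: xi; rewrite E mate_src.
  exact: Hc.
- move=> j jr; have ji : j != i by apply: contraNneq ir => <-.
  have [|h1 h2 h3 h4] := Hr j; first by rewrite inE jr orbT.
  rewrite !glue_mateE // !glue_wordE // fa fb.
  have -> : (inl (inr j) == at_ (i :: r) q) = false by case: (q) => //= ?; case: ifP.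
  have -> : (inl (inl (s j)) == inl (inl (s i)) :> jpt m k n) = false.
    by apply/eqP => -[/src_inj E]; rewrite E eqxx in ji.
  have -> // : (inl (inl (s j)) == at_ (i :: r) q) = false.
  case: (q) => //= j'; case: ifP => // j'r; apply/eqP => -[/src_inj E].
  by move: j'r; rewrite -E inE jr orbT.
- by rewrite glue_circlesE (negPf fab).
Qed.

Let stack_state : state [::] (stack x w).
Proof.
rewrite /stack; have := enum_uniq 'I_k.
have : state (enum 'I_k) (juxtapose x w).
  split=> //=.
  - move=> p; have atE q : at_ (enum 'I_k) q = inr q /\ at_word (enum 'I_k) q = 1%g.
      by case: q => //= i; rewrite mem_enum.
    have [-> ->] := atE p; have [-> ->] := atE (mate w p).
    by rewrite invg1 mulg1 mul1g.
  - by move=> i i' /= ->.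
  - by move=> j _; rewrite /= xs mate_src -xs word_mate.
elim: (enum 'I_k) (juxtapose x w) => //= i r IH t st /andP [ir ur].
exact: IH (state_step ir st) ur.
Qed.

(** The source of the unit laws, of the multiplication of coils, of cancellation
and of the factorization: the composite is w with its lower ends slid down along
x, and otherwise the caps of x. *)
Lemma concat_push p :
  mate (concat x w) (push p) = push (mate w p) /\
  word (concat x w) (push p) = (push_word p * word w p * (push_word (mate w p))^-1)%g.
Proof.
have [H _ _ _] := stack_state; have [Hm Hw] := H p.
have aE q : at_ [::] q = outer k (push q) by case: q.
have wE q : at_word [::] q = push_word q by case: q.
rewrite !aE !wE in Hm Hw; rewrite word_concat Hw; split=> //.
by apply: (@outer_inj m k n); rewrite mate_concat.
Qed.

Lemma concat_cap i i' : mate x (inl i) = inl i' ->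
  mate (concat x w) (inl i) = inl i' /\ word (concat x w) (inl i) = word x (inl i).
Proof.
have [_ H _ _] := stack_state => /H [Hm Hw]; rewrite word_concat; split=> //.
by apply: (@outer_inj m k n); rewrite mate_concat.
Qed.

(** A circle would contain a cap of x having both ends on the gluing line. *)
Lemma circles_full : circles (stack x w) = [::].
Proof. by have [] := stack_state. Qed.

End ConcatFull.

(** * Through strands *)

Section Pullback.
Variable g : nat.

Lemma diagram_nc m n (y : diagram g m n) p q :
  ~~ [&& pos p < pos q, pos q < pos (mate y p) & pos (mate y p) < pos (mate y q)]%N.
Proof. by have [_ _ _ _ /(_ q isT) []] := diagram_planar y (isT : predT p). Qed.

Lemma diagram_nested m n (y : diagram g m n) p q :
  (pos q < pos p < pos (mate y q))%N -> word y p = 1%g.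
Proof. by have [_ _ _ _ /(_ q isT) [_]] := diagram_planar y (isT : predT p). Qed.

(** The conditions on diagrams only refer to the order of boundary points, so a
part of a diagram that is closed under taking mates is again a diagram.  The
words may be replaced by simpler ones, which serves to unwind strands. *)
Lemma pullback m n m' n' (y : diagram g m n) (psi : pt m' n' -> pt m n)
    (w : pt m' n' -> 'Fr_g) :
  (forall p q, (pos p < pos q)%N -> (pos (psi p) < pos (psi q))%N) ->
  (forall p, exists q, psi q = mate y (psi p)) ->
  (forall p q, psi q = mate y (psi p) -> w q = (w p)^-1%g) ->
  (forall p, word y (psi p) = 1%g -> w p = 1%g) ->
  exists z : diagram g m' n', forall p, psi (mate z p) = mate y (psi p) /\ word z p = w p.
Proof.
move=> psi_lt im wV w1.
have psi_inj : injective psi.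
  move=> p q E; apply: pos_inj; case: (ltngtP (pos p) (pos q)) => // /psi_lt; rewrite E ltnn //.
have im' p : exists q, psi q == mate y (psi p) by have [q qE] := im p; exists q; apply/eqP.
pose f p := xchoose (im' p).
have fE p : psi (f p) = mate y (psi p) by apply/eqP/(xchooseP (im' p)).
have D : is_diagram [ffun p => (f p, w p)].
  apply/diagramP => p _; rewrite !ffunE /=; split=> //.
  - by apply: contra (mate_neq_self y (psi p)) => /eqP E; rewrite -fE E.
  - by apply: psi_inj; rewrite !fE mate_invol.
  - exact: wV.
  move=> q _; rewrite !ffunE /=; split.
    apply/negP => /and3P [/psi_lt h1 /psi_lt h2 /psi_lt h3].
    by have := diagram_nc y (psi p) (psi q); rewrite -!fE h1 h2 h3.
  move=> /andP [/psi_lt h1 /psi_lt h2]; apply: w1.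
  by apply: (diagram_nested (q := psi q)); rewrite -fE h1.
by exists (Diagram D) => p; rewrite /mate /word /= ffunE; split; first exact: fE.
Qed.

End Pullback.

Definition monotone_src l m (s : 'I_l -> 'I_m) : Prop :=
  forall i j : 'I_l, (i < j)%N -> (s i < s j)%N.

Lemma monotone_src_inj l m (s : 'I_l -> 'I_m) : monotone_src s -> injective s.
Proof.
move=> ms i j E; apply: val_inj; case: (ltngtP i j) => // /ms; rewrite E ltnn //.
Qed.

(** Both functions enumerate the same set increasingly. *)
Lemma monotone_src_eq l m (s s' : 'I_l -> 'I_m) :
  monotone_src s -> monotone_src s' -> codom s =i codom s' -> s =1 s'.
Proof.
move=> ms ms' E.
have srt (r : 'I_l -> 'I_m) : monotone_src r ->
    sorted ltn [seq val (r i) | i <- enum 'I_l].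
  move=> mr; have : sorted ltn [seq val i | i <- enum 'I_l].
    by rewrite val_enum_ord iota_ltn_sorted.
  by rewrite !sorted_map; apply: sub_sorted => i j; apply: mr.
have : [seq val (s i) | i <- enum 'I_l] = [seq val (s' i) | i <- enum 'I_l].
  apply: (irr_sorted_eq ltn_trans ltnn (srt _ ms) (srt _ ms')) => x.
  rewrite (map_comp val s) (map_comp val s'); apply/mapP/mapP => -[i ir ->]; exists i => //.
    by rewrite -[X in _ \in X]/(codom s') -E.
  by rewrite -[X in _ \in X]/(codom s) E.
move=> H i; apply: val_inj.
have /eq_in_map : [seq val (s i) | i <- enum 'I_l] = [seq val (s' i) | i <- enum 'I_l] by [].
by apply; rewrite mem_enum.
Qed.

Lemma enum_monotone m (A : {set 'I_m}) l : #|A| = l ->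
  exists2 s : 'I_l -> 'I_m, monotone_src s & forall i, i \in A <-> exists t, i = s t.
Proof.
move=> <-; exists enum_val.
  move=> i j ij.
  have tr : transitive (relpre (val : 'I_m -> nat) ltn) by move=> a b d /=; apply: ltn_trans.
  have srt : sorted (relpre val ltn) (enum A).
    have : sorted ltn (map val (enum 'I_m)) by rewrite val_enum_ord iota_ltn_sorted.
    rewrite sorted_map => srt; have -> : enum A = filter [in A] (enum 'I_m) by rewrite enumT.
    exact: sorted_filter srt.
  pose x0 := enum_val i; rewrite (enum_val_nth x0 i) (enum_val_nth x0 j).
  by apply: (sorted_ltn_nth tr x0 srt i j); rewrite ?inE -?cardE.
move=> i; split=> [iA|[t ->]]; last exact: enum_valP.
by exists (enum_rank_in iA i); rewrite enum_rankK_in.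
Qed.

Section Through.
Variable g : nat.

Definition through_set m n (x : diagram g m n) : {set 'I_m} :=
  [set i | ~~ is_inl (mate x (inl i))].

Definition through_count m n (x : diagram g m n) : nat := #|through_set x|.

Lemma through_setP m n (x : diagram g m n) i :
  reflect (exists j, mate x (inl i) = inr j) (i \in through_set x).
Proof.
rewrite inE; apply: (iffP idP) => [|[j ->] //].
by case: (mate _ _) => // j; exists j.
Qed.

Lemma through_count_le m n (x : diagram g m n) : (through_count x <= m)%N.
Proof. by rewrite /through_count -[X in (_ <= X)%N]card_ord max_card. Qed.

Lemma through_set_flip m n (x : diagram g m n) j :
  (j \in through_set (flip x)) = is_inl (mate x (inr j)).
Proof. by rewrite inE -[inl j]/(swap (inr j)) mate_flip; case: (mate _ _). Qed.

(** The mate function exchanges lower and upper ends of through strands. *)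
Lemma through_count_flip m n (x : diagram g m n) : through_count (flip x) = through_count x.
Proof.
have inl_inj : injective (inl : 'I_m -> pt m n) by move=> a b [].
have inr_inj : injective (inr : 'I_n -> pt m n) by move=> a b [].
have e1 : inl @: through_set x = [set p | is_inl p && ~~ is_inl (mate x p)].
  apply/setP => p; rewrite !inE; apply/imsetP/andP => [[i + ->]|]; first by rewrite inE.
  by case: p => [] i [] // _ H; exists i; rewrite ?inE.
have e2 : inr @: through_set (flip x) = [set p | ~~ is_inl p && is_inl (mate x p)].
  apply/setP => p; rewrite !inE; apply/imsetP/andP => [[i + ->]|].
    by rewrite through_set_flip.
  by case: p => [] i [] // _ H; exists i; rewrite ?through_set_flip.
rewrite /through_count -(card_imset _ inr_inj) -(card_imset _ inl_inj) e1 e2.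
rewrite -[RHS](card_imset _ (@mate_inj _ _ _ x)); apply: eq_card => p.
rewrite !inE; apply/idP/imsetP => [|[q + ->]].
  by move=> /andP [p1 p2]; exists (mate x p); rewrite ?inE ?mate_invol // p2.
by rewrite inE mate_invol andbC.
Qed.

Lemma through_count_le_top m n (x : diagram g m n) : (through_count x <= n)%N.
Proof. by rewrite -through_count_flip through_count_le. Qed.

(** The other bottom points are paired up by the mate function. *)
Lemma odd_through_count m n (x : diagram g m n) : odd (through_count x) = odd m.
Proof.
pose f (i : 'I_m) : 'I_m := if mate x (inl i) is inl i' then i' else i.
have fE i i' : mate x (inl i) = inl i' -> f i = i' by rewrite /f => ->.
pose A := [set i : 'I_m | (i < f i)%N]; pose B := [set i : 'I_m | (f i < i)%N].
have fK : involutive f.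
  move=> i; rewrite {2}/f; case E: (mate x (inl i)) => [i'|j]; last by rewrite /f E.
  by apply: fE; rewrite -E mate_invol.
have AB : B = f @: A.
  apply/setP => i; rewrite inE; apply/idP/imsetP => [lt|[j + ->]].
    by exists (f i); rewrite ?inE fK.
  by rewrite inE fK.
have ABT : ~: through_set x = A :|: B.
  apply/setP => i; rewrite !inE negbK -neq_ltn; have := mate_neq_self x (inl i).
  rewrite /f; case: (mate x (inl i)) => [i'|j] /=; last by rewrite eqxx.
  by move=> neq; symmetry; apply: contraNneq neq => /val_inj ->.
have := cardsC (through_set x); rewrite ABT cardsU disjoint_setI0 ?cards0.
  rewrite subn0 AB (card_imset _ (inv_inj fK)) addnn card_ord => /(congr1 odd) <-.
  by rewrite oddD odd_double addbF.
by rewrite disjoints_subset; apply/subsetP => i; rewrite !inE -leqNgt => /ltnW.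
Qed.

Lemma full_through_count m k (x : diagram g m k) : is_full x = (through_count x == k).
Proof.
transitivity (through_set (flip x) == setT).
  apply/forallP/eqP => [H|H j]; last by rewrite -through_set_flip H inE.
  by apply/setP => j; rewrite through_set_flip inE H.
by rewrite eqEcard subsetT cardsT card_ord -/(through_count _) through_count_flip eqn_leq through_count_le_top.
Qed.

Section Full.
Variables (m k : nat) (x : diagram g m k) (s : 'I_k -> 'I_m).
Hypothesis xs : forall j, mate x (inr j) = inl (s j).

(** The through strands at two top points would cross otherwise. *)
Lemma src_monotone : monotone_src s.
Proof.
move=> i j ij; rewrite ltnNge; apply/negP; rewrite leq_eqVlt => /predU1P [/val_inj/(src_inj xs) E|lt].
  by rewrite E ltnn in ij.
have := diagram_nc x (inl (s j)) (inl (s i)); rewrite !(mate_src xs) /= lt.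
by have := ltn_ord (s i); have := ltn_ord i; have := ltn_ord j; lia.
Qed.

Lemma concat_full_through n (w : diagram g k n) :
  through_set (concat x w) = s @: through_set w.
Proof.
apply/setP => i; apply/through_setP/imsetP.
  move=> [j E]; have [t it] : exists t, i = s t.
    case M: (mate x (inl i)) => [i'|j']; last first.
      by exists j'; have := xs j'; rewrite -M mate_invol => -[].
    by have [] := concat_cap xs w M; rewrite E.
  have [] := concat_push xs w (inl t); rewrite /= -it E => E' _; exists t => //.
  by apply/through_setP; case: (mate w _) E' => // j' _; exists j'.
move=> [t /through_setP [j E] ->]; exists j.
by have [] := concat_push xs w (inl t); rewrite E.
Qed.

Lemma concat_full_through_count n (w : diagram g k n) : through_count (concat x w) = through_count w.
Proof. by rewrite /through_count concat_full_through card_imset //; apply: src_inj. Qed.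

(** Left cancellation: the strands of w can be recovered from the composite, as
push is injective and push_word does not depend on w. *)
Lemma concat_full_inj n : injective (fun w : diagram g k n => concat x w).
Proof.
move=> w w' E; apply: diagram_eq => p.
have [m1 w1] := concat_push xs w p; have [m2 w2] := concat_push xs w' p.
have E' : mate w p = mate w' p by apply: (push_inj xs); rewrite -m1 -m2 E.
by split=> //; move: w1; rewrite E w2 E' => /mulIg /mulgI.
Qed.

End Full.
End Through.

(** * Factorization into half-diagrams and a coil *)

Section Factorization.
Variable g : nat.

Lemma mate_coil l (b : 'Fr_g) p : mate (coil l b) p = swap p.
Proof. by rewrite /mate /= ffunE. Qed.

Lemma word_coil l (b : 'Fr_g) (i : 'I_l) :
  word (coil l b) (inl i) = if i == 0 :> nat then b else 1%g.
Proof. by rewrite /word /= ffunE. Qed.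

Section LowerHalf.
Variables (m n l : nat) (y : diagram g m n) (s : 'I_l -> 'I_m).
Hypothesis ms : monotone_src s.
Hypothesis sT : forall i, i \in through_set y <-> exists t, i = s t.

(** As through strands do not cross, numbering them at the bottom also numbers
them from left to right at the top. *)
Lemma through_tops : exists s' : 'I_l -> 'I_n,
  [/\ monotone_src s', forall t, mate y (inl (s t)) = inr (s' t) &
      forall j, j \in through_set (flip y) <-> exists t, j = s' t].
Proof.
have ex t : exists j, mate y (inl (s t)) == inr j.
  have /through_setP [j E] : s t \in through_set y by apply/sT; exists t.
  by exists j; apply/eqP.
pose s' t := xchoose (ex t).
have s'E t : mate y (inl (s t)) = inr (s' t) by apply/eqP/(xchooseP (ex t)).
exists s'; split=> //.
  move=> t t' tt'; have lt := ms tt'.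
  have := diagram_nc y (inl (s t)) (inl (s t')); rewrite !s'E /= lt /=.
  have neq : s' t != s' t' :> nat.
    apply/eqP => /val_inj E; have := s'E t'; rewrite -E -s'E => /mate_inj [/eqP].
    by rewrite eq_sym -val_eqE (ltn_eqF lt).
  by have := ltn_ord (s t'); have := ltn_ord (s' t); have := ltn_ord (s' t'); lia.
move=> j; rewrite through_set_flip; split=> [|[t ->]].
  case E: (mate y (inr j)) => [i|//] _.
  have [t it] : exists t, i = s t by apply/sT/through_setP; exists j; rewrite -E mate_invol.
  by exists t; have := s'E t; rewrite -it -E mate_invol => -[].
by rewrite -s'E mate_invol.
Qed.

(** Forget the caps at the top; the l upper ends of through strands become the new
top points, in the same order. *)
Lemma lower_half : exists F : diagram g m l,
  [/\ forall t, mate F (inr t) = inl (s t),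
      forall t, word F (inl (s t)) = word y (inl (s t)) &
      forall i i', mate y (inl i) = inl i' ->
        mate F (inl i) = inl i' /\ word F (inl i) = word y (inl i)].
Proof.
have [s' [ms' s'E _]] := through_tops.
pose psi (p : pt m l) : pt m n := match p with inl i => inl i | inr t => inr (s' t) end.
have psi_inj : injective psi.
  by move=> [i|i] [j|j] //= []; [move-> | move/(monotone_src_inj ms') ->].
have [||||F FE] := @pullback g _ _ _ _ y psi (fun p => word y (psi p)).
- move=> [i|i] [j|j] //=.
  + by have := ltn_ord i; have := ltn_ord (s' j); lia.
  + by have := ltn_ord j; lia.
  + rewrite ltn_add2l => ij; have ji : (j < i)%N by have := ltn_ord i; lia.
    by have := ms' _ _ ji; have := ltn_ord (s' i); lia.
- case=> [i|t] /=; last by exists (inl (s t)); rewrite -s'E mate_invol.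
  case E: (mate y (inl i)) => [i'|j]; first by exists (inl i').
  have [t it] : exists t, i = s t by apply/sT/through_setP; exists j.
  by exists (inr t); rewrite /= -s'E -it.
- by move=> p q ->; rewrite word_mate.
- by [].
exists F; split.
- by move=> t; apply: psi_inj; have [-> _] := FE (inr t); rewrite /= -s'E mate_invol.
- by move=> t; have [_ ->] := FE (inl (s t)).
move=> i i' E; have [Fm Fw] := FE (inl i); split=> //.
by apply: psi_inj; rewrite Fm.
Qed.

End LowerHalf.

Lemma halfP m l (S : half_diagram g m l) :
  { s : 'I_l -> 'I_m | forall j, mate S (inr j) = inl (s j) & 
      forall j, word S (inr j) = 1%g }.
Proof.
have H j : is_inl (mate S (inr j)) && (word S (inr j) == 1%g) by apply: (forallP (valP S)).
have ex j : exists i, mate S (inr j) == inl i.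
  by have /andP [] := H j; case: (mate _ _) => // i; exists i.
exists (fun j => xchoose (ex j)) => j; first by apply/eqP/(xchooseP (ex j)).
by have /andP [_ /eqP] := H j.
Qed.

(** Trivializing the words of the through strands keeps the condition that nested
strands do not wind. *)
Lemma unwind m l (F : diagram g m l) : is_full F -> exists S : half_diagram g m l,
  (forall p, mate S p = mate F p) /\
  (forall i i', mate F (inl i) = inl i' -> word S (inl i) = word F (inl i)).
Proof.
move=> /fullP [s Fs].
pose w (p : pt m l) := if is_inl p && is_inl (mate F p) then word F p else 1%g.
have [||||S SE] := @pullback g _ _ _ _ F id w => //.
- by move=> p; exists (mate F p).
- move=> p q ->; rewrite /w mate_invol andbC word_mate; case: ifP => // _; by rewrite invg1.
- by move=> p p1; rewrite /w p1; case: ifP.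
have Sh : is_half S.
  apply/forallP => j; have [-> ->] := SE (inr j); rewrite Fs /w /=.
  by rewrite eqxx.
exists (HalfDiagram Sh); split=> [p|i i' E] /=; first by have [] := SE p.
by have [_ ->] := SE (inl i); rewrite /w E.
Qed.

(** Through strands other than the leftmost one are nested under it and have
trivial words, so the word b of the leftmost one contains all that unwinding
has lost. *)
Lemma full_half_coil m l (F : diagram g m l) : is_full F ->
  exists (S : half_diagram g m l) (b : coil_group g l), F = concat S (coil l b).
Proof.
move=> Ff; have [S [Sm Sw]] := unwind Ff; have /fullP [s Fs] := Ff.
have Ss j : mate S (inr j) = inl (s j) by rewrite Sm.
have S1 j : word S (inr j) = 1%g by have := valP S => /forallP /(_ j) /andP [_ /eqP].
have [b bE] : exists b : coil_group g l,
    forall t : 'I_l, (t == 0 :> nat)%N -> word F (inl (s t)) = b.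
  case: (posnP l) => [l0|l_gt0].
    by exists (coil_one g l) => t; have := ltn_ord t; lia.
  have bP : (l == 0%N) ==> (word F (inl (s (Ordinal l_gt0))) == 1%g).
    by rewrite eqn0Ngt l_gt0.
  by exists (CoilGroup bP) => t /eqP t0 /=; congr (word F (inl (s _))); apply: val_inj.
have bE' t : word F (inl (s t)) = if t == 0 :> nat then val b else 1%g.
  case: eqP => [/eqP /bE //|t0].
  have l0 : (0 < l)%N by have := ltn_ord t; lia.
  have lt : (Ordinal l0 < t)%N by rewrite /=; lia.
  apply: (diagram_nested (q := inl (s (Ordinal l0)))); rewrite (mate_src Fs) /=.
  by rewrite (src_monotone Fs lt) /=; have := ltn_ord (s t); lia.
exists S, b; apply/esym/diagram_eq => p.
have push_t t : mate (concat S (coil l b)) (inl (s t)) = mate F (inl (s t)) /\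
    word (concat S (coil l b)) (inl (s t)) = word F (inl (s t)).
  have [] := concat_push Ss (coil l b) (inl t); rewrite mate_coil /= => -> ->.
  by rewrite (mate_src Fs) word_coil S1 !invg1 mulg1 mul1g bE'.
case: p => [i|t].
  case E: (mate F (inl i)) => [i'|t].
    have Si : mate S (inl i) = inl i' by rewrite Sm.
    by have [-> ->] := concat_cap Ss (coil l b) Si; rewrite (Sw _ _ E).
  have -> : i = s t by have := Fs t; rewrite -E mate_invol => -[].
  by have [-> ->] := push_t t; rewrite (mate_src Fs).
have [m1 w1] := push_t t; rewrite (mate_src Fs) in m1.
by rewrite -m1 mate_invol word_mate w1 -word_mate m1 Fs (mate_src Fs).
Qed.

End Factorization.

Section Cells.
Variable g : nat.

Definition cell_diagram m n l (S : half_diagram g m l) (b : coil_group g l)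
    (U : half_diagram g n l) : diagram g m n :=
  concat (concat S (coil l b)) (flip U).

Lemma coil_src l (b : 'Fr_g) (j : 'I_l) : mate (coil l b) (inr j) = inl j.
Proof. by rewrite mate_coil. Qed.

Lemma mate_concat_coil l n (b : 'Fr_g) (w : diagram g l n) p :
  mate (concat (coil l b) w) p = mate w p.
Proof.
have [] := concat_push (@coil_src l b) w p.
have pE (q : pt l n) : push id q = q by case: q.
by rewrite !pE.
Qed.

Lemma concat_coil1l l n (w : diagram g l n) : concat (coil l 1%g) w = w.
Proof.
apply: diagram_eq => p; rewrite mate_concat_coil; split=> //.
have [_] := concat_push (@coil_src l 1%g) w p.
have pE (q : pt l n) : push id q = q by case: q.
have wE (q : pt l n) : push_word (coil l (1%g : 'Fr_g)) q = 1%g.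
  by case: q => i //=; rewrite /word /= ffunE; case: eqP; rewrite !invg1.
by rewrite pE !wE invg1 mulg1 mul1g.
Qed.

Lemma concat_coil1r m l (w : diagram g m l) : concat w (coil l 1%g) = w.
Proof.
apply: (can_inj (@flipK _ _ _)).
by rewrite flip_concat flip_coil frev1 concat_coil1l.
Qed.

(** It suffices to compare words at bottom points; at the other end of each strand
they are inverted. *)
Lemma coilM l (a b : 'Fr_g) : concat (coil l a) (coil l b) = coil l (a * b)%g.
Proof.
suff bot (i : 'I_l) : word (concat (coil l a) (coil l b)) (inl i) =
    word (coil l (a * b)%g) (inl i).
  apply: diagram_eq => p; rewrite mate_concat_coil !mate_coil; split=> //.
  case: p => // i.
  have e1 : inr i = mate (concat (coil l a) (coil l b)) (inl i).
    by rewrite mate_concat_coil mate_coil.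
  have e2 : inr i = mate (coil l (a * b)%g) (inl i) by rewrite mate_coil.
  by rewrite [in LHS]e1 [in RHS]e2 !word_mate bot.
have [_] := concat_push (@coil_src l a) (coil l b) (inl i).
rewrite mate_coil /= => ->; rewrite !word_coil invg1 mulg1 /word /= ffunE.
by case: eqP => _; rewrite ?invgK ?invg1 ?mulg1.
Qed.

Lemma half_full m l (S : half_diagram g m l) : is_full S.
Proof. by apply/forallP => j; have /andP [] := forallP (valP S) j. Qed.

Lemma coil_full l (b : 'Fr_g) : is_full (coil l b).
Proof. by apply/forallP => j; rewrite coil_src. Qed.

Lemma concat_through_count m k n (x : diagram g m k) (w : diagram g k n) :
  is_full x -> through_count (concat x w) = through_count w.
Proof. by case/fullP => s xs; apply: concat_full_through_count. Qed.

Lemma full_through_countE m k (x : diagram g m k) : is_full x -> through_count x = k.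
Proof. by rewrite full_through_count => /eqP. Qed.

Lemma through_count_cell m n l S b U : through_count (@cell_diagram m n l S b U) = l.
Proof.
rewrite /cell_diagram concat_through_count; last first.
  by rewrite full_through_count concat_through_count ?half_full // -full_through_count coil_full.
by rewrite through_count_flip full_through_countE // half_full.
Qed.

(** The upper half is the lower half of the flipped diagram; all winding of the
through strands is put into the lower part before the coil is split off. *)
Lemma factorization m n l (y : diagram g m n) : through_count y = l ->
  exists (S : half_diagram g m l) b U, y = cell_diagram S b U.
Proof.
move=> /enum_monotone [s ms sT].
have [s' [ms' s'E s'T]] := through_tops ms sT.
have [F [Fs Fw Fc]] := lower_half ms sT.
have [F' [F's F'w F'c]] := lower_half ms' s'T.
have Ff : is_full F by apply/fullP; exists s.
have F'f : is_full F' by apply/fullP; exists s'.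
have [U [Um Uw]] := unwind F'f.
have U1 t : word U (inr t) = 1%g by have /andP [_ /eqP] := forallP (valP U) t.
have [S [b Fe]] := full_half_coil Ff.
exists S, b, U; rewrite /cell_diagram -Fe; apply/esym/diagram_eq.
have flip_in t : mate (flip U) (inl t) = inr (s' t).
  by rewrite -[inl t]/(swap (inr t)) mate_flip Um F's.
have w_in t : word (flip U) (inl t) = 1%g.
  by rewrite -[inl t]/(swap (inr t)) word_flip U1 invg1 frev1.
have up t : mate (concat F (flip U)) (inl (s t)) = mate y (inl (s t)) /\
    word (concat F (flip U)) (inl (s t)) = word y (inl (s t)).
  have [] := concat_push Fs (flip U) (inl t); rewrite /= flip_in /= => -> ->.
  by rewrite w_in invg1 !mulg1 -word_mate Fs Fw s'E.
case=> [i|j].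
  case E: (mate y (inl i)) => [i'|j].
    have [Fi <-] := Fc _ _ E.
    by have [-> ->] := concat_cap Fs (flip U) Fi.
  have [t it] : exists t, i = s t by apply/sT/through_setP; exists j.
  by rewrite -E it; apply: up.
case E: (mate y (inr j)) => [i|j'].
  have Ei : mate y (inl i) = inr j by rewrite -E mate_invol.
  have [t it] : exists t, i = s t by apply/sT/through_setP; exists j.
  have [um uw] := up t; rewrite -it Ei in um uw.
  by rewrite -{1 2}um mate_invol word_mate uw -word_mate Ei.
have Ef : mate (flip y) (inl j) = inl j'.
  by rewrite -[inl j]/(swap (inr j)) mate_flip E.
have [F'j F'wj] := F'c _ _ Ef.
have Uj : mate (flip U) (inr j) = inr j'.
  by rewrite -[inr j]/(swap (inl j)) mate_flip Um F'j.
have [] := concat_push Fs (flip U) (inr j); rewrite /= Uj /= => -> ->; split=> //.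
rewrite invg1 mulg1 mul1g -[inr j]/(swap (inl j)) word_flip (Uw _ _ F'j) F'wj.
by rewrite -[inl j]/(swap (inr j)) word_flip frevV frevK invgK.
Qed.

Lemma through_count_full_set l n (w : diagram g l n) : through_count w = l -> through_set w = setT.
Proof. by move=> e; apply/eqP; rewrite eqEcard subsetT cardsT card_ord -/(through_count w) e leqnn. Qed.

(** As w has no caps at the bottom, the through strands of the composite start at
the points where those of S do.  This determines the positions of the through
strands of S, whose words are trivial; its caps are visible in the composite. *)
Lemma half_concat_inj m n l (S S' : half_diagram g m l) (w w' : diagram g l n) :
  through_count w = l -> through_count w' = l -> concat S w = concat S' w' -> S = S' /\ w = w'.
Proof.
move=> tw tw' E.
have [s Ss S1] := halfP S; have [s' S's S'1] := halfP S'.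
have ss : s =1 s'.
  apply: (monotone_src_eq (src_monotone Ss) (src_monotone S's)) => i.
  have := concat_full_through Ss w; rewrite E (concat_full_through S's) !through_count_full_set // => st.
  apply/codomP/codomP => -[t ->].
    have : s t \in s' @: setT by rewrite st imset_f ?inE.
    by case/imsetP => t' _ ->; exists t'.
  have : s' t \in s @: setT by rewrite -st imset_f ?inE.
  by case/imsetP => t' _ ->; exists t'.
have SS : S = S'; last by split=> //; apply: (concat_full_inj Ss); rewrite E SS.
apply/val_inj/diagram_eq => -[i|t] /=; last by rewrite Ss S's ss S1 S'1.
have through t : i = s t -> mate S (inl i) = mate S' (inl i) /\ word S (inl i) = word S' (inl i).
  move=> it; have e : inl i = mate S (inr t) by rewrite Ss it.
  have e' : inl i = mate S' (inr t) by rewrite S's it ss.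
  by rewrite {1 3}e e' !mate_invol !word_mate S1 S'1.
case M: (mate S (inl i)) => [i'|t]; last first.
  by rewrite -M; apply: (through t); have := Ss t; rewrite -M mate_invol => -[].
case M': (mate S' (inl i)) => [i''|t].
  have [m1 w1] := concat_cap Ss w M; have [m2 w2] := concat_cap S's w' M'.
  by rewrite -w1 -w2 E; move: m1; rewrite E m2 => -[->].
rewrite -M -M'; apply: (through t).
by have := S's t; rewrite -M' mate_invol ss => -[].
Qed.

Lemma cell_diagram_inj m n l (S S' : half_diagram g m l) b b' (U U' : half_diagram g n l) :
  cell_diagram S b U = cell_diagram S' b' U' -> [/\ S = S', b = b' & U = U'].
Proof.
rewrite /cell_diagram !concatA.
have tw (a : coil_group g l) (V : half_diagram g n l) : through_count (concat (coil l a) (flip V)) = l.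
  by rewrite concat_through_count ?coil_full // through_count_flip full_through_countE // half_full.
move=> /(half_concat_inj (tw b U) (tw b' U')) [SS E].
have bb : b = b'.
  have [l0|l_gt0] : l = 0%N \/ (0 < l)%N by lia.
    apply: val_inj.
    have a1 (a : coil_group g l) : val a = 1%g.
      by case: a => u /= /implyP au; apply/eqP/au/eqP.
    by rewrite !a1.
  have in0 (a : coil_group g l) (V : half_diagram g n l) :
      word (concat (coil l a) (flip V)) (inl (Ordinal l_gt0)) = val a.
    have [u Vu V1] := halfP V; set o := Ordinal l_gt0.
    have mV : mate (flip V) (inl o) = inr (u o).
      by rewrite -[inl o]/(swap (inr o)) mate_flip Vu.
    have wV : word (flip V) (inl o) = 1%g.
      by rewrite -[inl o]/(swap (inr o)) word_flip V1 invg1 frev1.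
    have [_] := concat_push (@coil_src l a) (flip V) (inl o).
    rewrite mV wV /= => ->.
    by rewrite /word /= ffunE /= invgK invg1 !mulg1.
  by apply: val_inj; rewrite -(in0 b U) E in0.
split=> //; apply/val_inj/(can_inj (@flipK _ _ _)).
by apply: (concat_full_inj (@coil_src l b)); rewrite E bb.
Qed.

Lemma coil1_half l : is_half (coil l (1%g : 'Fr_g)).
Proof.
apply/forallP => j; rewrite coil_src /word /= ffunE /=.
by case: ifP; rewrite ?invg1 eqxx.
Qed.

(** S and the identity both factor S composed with the identity, and such a
factorization is unique. *)
Lemma half_square l (S : half_diagram g l l) : val S = coil l 1%g.
Proof.
pose C := HalfDiagram (coil1_half l).
have tS : through_count S = l by rewrite full_through_countE ?half_full.
have tc' : through_count (coil l (1%g : 'Fr_g)) = l by rewrite full_through_countE ?coil_full.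
by have [|-> _] := @half_concat_inj _ _ _ S C (coil l 1%g) S tc' tS; rewrite ?concat_coil1r ?concat_coil1l.
Qed.

Lemma circle_factor_full (K : comNzRingType) (c : 'Fr_g -> K) m k n
    (x : diagram g m k) (w : diagram g k n) : is_full x -> circle_factor c x w = 1.
Proof.
by case/fullP => s xs; rewrite /circle_factor (circles_full xs) big_nil.
Qed.

Lemma circle_factor_flip_full (K : comNzRingType) (c : 'Fr_g -> K) m k n
    (x : diagram g m k) (w : diagram g n k) : is_full w -> circle_factor c x (flip w) = 1.
Proof.
move=> wf; rewrite -[x](flipK) circle_factor_flip.
exact: circle_factor_full.
Qed.

(** Splitting off the lower half of x from the composite preserves the number of
through strands, and the remaining diagram starts from that many points only. *)
Lemma through_count_concat_l m k n (x : diagram g m k) (y : diagram g k n) :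
  (through_count (concat x y) <= through_count x)%N.
Proof.
have [S [b [U e]]] := factorization (erefl (through_count x)).
rewrite {1}e /cell_diagram !concatA.
by rewrite concat_through_count ?half_full // through_count_le.
Qed.

Lemma through_count_concat_r m k n (x : diagram g m k) (y : diagram g k n) :
  (through_count (concat x y) <= through_count y)%N.
Proof. by rewrite -through_count_flip flip_concat -(through_count_flip y) through_count_concat_l. Qed.

Lemma flip_cell m n l (S : half_diagram g m l) b (U : half_diagram g n l) :
  flip (cell_diagram S b U) = cell_diagram U (coil_rev b) S.
Proof.
rewrite /cell_diagram !flip_concat flip_coil flipK.
by rewrite concatA.
Qed.

End Cells.

(** * Linear extension and bases *)

Section LinearExtensions.
Variable K : comNzRingType.

Section Linear.
Variables (U V : lmodType K) (f : U -> V).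
Hypothesis fL : linear f.

Lemma lin0 : f 0 = 0.
Proof.
have := fL 1 0 0; rewrite !scale1r addr0 => /eqP.
by rewrite -subr_eq subrr eq_sym => /eqP.
Qed.
Lemma linZ k u : f (k *: u) = k *: f u.
Proof. by rewrite -[k *: u]addr0 fL lin0 addr0. Qed.
Lemma linD u v : f (u + v) = f u + f v.
Proof. by rewrite -[u in LHS]scale1r fL scale1r. Qed.
Lemma linB u v : f (u - v) = f u - f v.
Proof. by rewrite addrC -scaleN1r fL scaleN1r addrC. Qed.
Lemma lin_sum (I : Type) (r : seq I) (F : I -> U) :
  f (\sum_(i <- r) F i) = \sum_(i <- r) f (F i).
Proof. by elim: r => [|i r IH]; rewrite ?big_nil ?lin0 // !big_cons linD IH. Qed.
End Linear.

Lemma lin_comp (U V W : lmodType K) (f : U -> V) (h : V -> W) :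
  linear f -> linear h -> linear (h \o f).
Proof. by move=> fL hL k u v /=; rewrite fL hL. Qed.

Lemma malgU_scale (I : choiceType) (k : K) (i : I) : << k *g i >> = k *: << i >>.
Proof. by apply/malgP => j; rewrite mcoeffZ !mcoeffU mulrnAr mulr1. Qed.

Section Lext.
Variable I : choiceType.
Implicit Types (u v : {malg K[I]}).

Lemma malg_basisE v : v = \sum_(i <- msupp v) v@_i *: << i >>.
Proof. by rewrite {1}[v]monalgE; apply: eq_bigr => i _; rewrite malgU_scale. Qed.

Lemma lin_lext (V : lmodType K) (f : {malg K[I]} -> V) :
  linear f -> f =1 lext (fun i => f << i >>).
Proof.
move=> fL v; rewrite {1}[v]malg_basisE (lin_sum fL); apply: eq_bigr => i _.
by rewrite (linZ fL).
Qed.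

Lemma linear_ext (V : lmodType K) (f h : {malg K[I]} -> V) :
  linear f -> linear h -> (forall i, f << i >> = h << i >>) -> f =1 h.
Proof.
move=> fL hL e v; rewrite (lin_lext fL) (lin_lext hL).
by apply: eq_bigr => i _; rewrite e.
Qed.

Variables (V : lmodType K) (f : I -> V).

Lemma lextEw (d : {fset I}) v : (msupp v `<=` d)%fset ->
  lext f v = \sum_(i <- d) v@_i *: f i.
Proof.
move=> sd; apply: big_fset_incl => // i _ /mcoeff_outdom ->.
by rewrite scale0r.
Qed.

Lemma lext_linear : linear (lext f).
Proof.
move=> k u v; pose d := (msupp u `|` msupp v)%fset.
have sd : (msupp (k *: u + v) `<=` d)%fset.
  by apply: fsubset_trans (msuppD_le _ _) _; apply: fsetSU; apply: msuppZ_le.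
rewrite !(@lextEw d) ?fsubsetUl ?fsubsetUr // scaler_sumr -big_split /=.
by apply: eq_bigr => i _; rewrite mcoeffD mcoeffZ scalerDl scalerA.
Qed.

Lemma lextU i : lext f << i >> = f i.
Proof.
rewrite (@lextEw [fset i]%fset) ?msuppU_le // big_seq_fset1.
by rewrite mcoeffUU scale1r.
Qed.

End Lext.

Lemma lextE (I : choiceType) (V : lmodType K) (f : I -> V) v :
  lext f v = \sum_(i <- msupp v) v@_i *: f i.
Proof. by []. Qed.

Lemma lext_eq (I : choiceType) (V : lmodType K) (f h : I -> V) :
  f =1 h -> lext f =1 lext h.
Proof. by move=> e v; apply: eq_bigr => i _; rewrite e. Qed.

Lemma bilinear_ext (I J : choiceType) (V : lmodType K)
    (f h : {malg K[I]} -> {malg K[J]} -> V) :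
  is_bilinear f -> is_bilinear h ->
  (forall i j, f << i >> << j >> = h << i >> << j >>) -> forall u v, f u v = h u v.
Proof.
move=> [fl fr] [hl hr] e u v; apply: (linear_ext (fl v) (hl v)) => i.
exact: (linear_ext (fr _) (hr _)).
Qed.

Lemma bilinear_comp (U U' V V' W : lmodType K) (f : U -> V -> W) (a : U' -> U) (b : V' -> V) :
  is_bilinear f -> linear a -> linear b -> is_bilinear (fun u v => f (a u) (b v)).
Proof.
move=> [fl fr] aL bL; split=> [v|u] k p q; first by rewrite aL fl.
by rewrite bL fr.
Qed.

Lemma comp_bilinear (U V W W' : lmodType K) (f : U -> V -> W) (h : W -> W') :
  is_bilinear f -> linear h -> is_bilinear (fun u v => h (f u v)).
Proof.
move=> [fl fr] hL; split=> [v|u] k p q; first by rewrite fl hL.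
by rewrite fr hL.
Qed.

Lemma bilinear_swap (U V W : lmodType K) (f : U -> V -> W) :
  is_bilinear f -> is_bilinear (fun v u => f u v).
Proof. by case. Qed.

Lemma lext2_bilinear (I J : choiceType) (V : lmodType K) (f : I -> J -> V) :
  is_bilinear (lext2 f).
Proof.
split=> [v|u]; first exact: lext_linear.
move=> k v v'; rewrite /lext2 (_ : lext _ u = lext (fun i => k *: lext (f i) v + lext (f i) v') u).
  rewrite /lext scaler_sumr -big_split /=; apply: eq_bigr => i _.
  by rewrite scalerDr !scalerA mulrC.
by apply: lext_eq => i; apply: lext_linear.
Qed.

Lemma lext2U (I J : choiceType) (V : lmodType K) (f : I -> J -> V) i j :
  lext2 f << i >> << j >> = f i j.
Proof. by rewrite /lext2 lextU lextU. Qed.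

Section Supported.
Variables (I : choiceType) (P : pred I).

Definition supported (v : {malg K[I]}) : Prop := forall i, i \in msupp v -> P i.

Lemma supported0 : supported 0.
Proof. by move=> i; rewrite msupp0. Qed.

Lemma supported_lin k u v : supported u -> supported v -> supported (k *: u + v).
Proof.
move=> su sv i /(fsubsetP (msuppD_le _ _)); rewrite inE => /orP [|/sv //].
by move=> /(fsubsetP (msuppZ_le _ _)) /su.
Qed.

Lemma supportedU i : P i -> supported << i >>.
Proof. by move=> Pi j /(fsubsetP msuppU_le); rewrite inE => /eqP ->. Qed.

Lemma supportedZ k u : supported u -> supported (k *: u).
Proof. by move=> su; rewrite -[k *: u]addr0; apply: supported_lin (supported0). Qed.

Lemma supported_ind (Q : {malg K[I]} -> Prop) :
  Q 0 -> (forall k u v, Q u -> Q v -> Q (k *: u + v)) -> (forall i, P i -> Q << i >>) ->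
  forall v, supported v -> Q v.
Proof.
move=> Q0 QL QU v sv; rewrite [v]malg_basisE big_seq_cond.
by apply: (big_rec Q) => // i u /andP [/sv Pi _] Qu; apply: QL => //; apply: QU.
Qed.

End Supported.

Lemma supportedT (I : choiceType) (P : pred I) (v : {malg K[I]}) :
  (forall i, P i) -> supported P v.
Proof. by move=> PT i _. Qed.

Lemma supported_lext (I J : choiceType) (P : pred I) (Q : pred J)
    (f : I -> {malg K[J]}) v :
  (forall i, P i -> supported Q (f i)) -> supported P v -> supported Q (lext f v).
Proof.
move=> fPQ; move: v; apply: (supported_ind (Q := fun v => supported Q (lext f v)))
  => [|k u w su sw|i Pi].
- by rewrite (lin0 (lext_linear f)); apply: supported0.
- by rewrite lext_linear; apply: supported_lin.
by rewrite lextU; apply: fPQ.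
Qed.

End LinearExtensions.

Lemma bijective_choice (A : choiceType) (B : eqType) (f : A -> B) :
  injective f -> (forall b, exists a, f a = b) -> bijective f.
Proof.
move=> f_inj f_surj.
have ex b : exists a, f a == b by have [a fa] := f_surj b; exists a; apply/eqP.
have gK : cancel (fun b => xchoose (ex b)) f by move=> b; apply/eqP/(xchooseP (ex b)).
by exists (fun b => xchoose (ex b)) => // a; apply: f_inj; rewrite gK.
Qed.

Section Bases.
Variable K : comNzRingType.

Lemma lext_bijective (I J : choiceType) (f : I -> J) : bijective f ->
  bijective (lext (K := K) (fun i => << f i >>)).
Proof.
case=> h fK hK; exists (lext (fun j => << h j >>)) => v.
  apply: (@linear_ext K I _ (lext (fun j => << h j >>) \o lext (fun i => << f i >>)) id).
  - exact: lin_comp (lext_linear _) (lext_linear _).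
  - by [].
  - by move=> i; rewrite /= !lextU fK.
apply: (@linear_ext K J _ (lext (fun i => << f i >>) \o lext (fun j => << h j >>)) id).
- exact: lin_comp (lext_linear _) (lext_linear _).
- by [].
- by move=> i; rewrite /= !lextU hK.
Qed.

(** With the basis Y of the module identified with I x B, the coefficient of
sum_i e_i x_i at (i, b) is the coefficient of x_i at b. *)
Lemma free_bijective (I B Y : choiceType) (beta : I * B -> Y)
    (act : I -> {malg K[B]} -> {malg K[Y]}) :
  bijective beta -> (forall i, linear (act i)) ->
  (forall i b, act i << b >> = << beta (i, b) >>) ->
  bijective (fun x : {malg {malg K[B]}[I]} => \sum_(i <- msupp x) act i x@_i).
Proof.
case=> gam betaK gamK actL actU; set F := fun x => _.
have actC i j b (s : {malg K[B]}) : (act i s)@_(beta (j, b)) = s@_b *+ (i == j).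
  apply: (@linear_ext K B K^o (fun s => (act i s)@_(beta (j, b))) (fun s => s@_b *+ (i == j))).
  - by move=> k u v; rewrite actL mcoeffD mcoeffZ.
  - move=> k u v /=; rewrite mcoeffD mcoeffZ.
    by case: (i == j); rewrite ?mulr1n // !mulr0n scaler0 addr0.
  move=> b'; rewrite actU !mcoeffU (can_eq betaK) xpair_eqE andbC.
  by case: (i == j); rewrite ?andbT ?andbF ?mulr1n ?mulr0n.
have FC x i b : (F x)@_(beta (i, b)) = x@_i@_b.
  rewrite /F raddf_sum /=.
  have [ix|ix] := boolP (i \in msupp x).
    rewrite (big_fsetD1 i) //= actC eqxx big_seq big1 ?addr0 // => j.
    by rewrite in_fsetD1 => /andP [/negPf ji _]; rewrite actC ji.
  rewrite (mcoeff_outdom ix) mcoeff0 big_seq big1 // => j jx.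
  by rewrite actC; case: eqP => // ji; rewrite ji (negPf ix) in jx.
pose G (v : {malg K[Y]}) : {malg {malg K[B]}[I]} :=
  \sum_(y <- msupp v) << v@_y *: << (gam y).2 >> *g (gam y).1 >>.
have FG : cancel G F.
  move=> v; apply/malgP => y; rewrite -[y]gamK; case: (gam y) => i b.
  rewrite FC /G !raddf_sum /=.
  have GC y' : << v@_y' *: << (gam y').2 >> *g (gam y').1 >>@_i@_b =
      v@_y' *+ (y' == beta (i, b)).
    have -> : (y' == beta (i, b)) = (gam y' == (i, b)).
      by apply/eqP/eqP => [->|<-]; rewrite ?betaK ?gamK.
    rewrite mcoeffU; case: (gam y') => i' b' /=.
    rewrite xpair_eqE; case: (i' == i); rewrite ?mulr0n ?mulr1n ?mcoeff0 //=.
    by rewrite mcoeffZ mcoeffU mulrnAr mulr1.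
  rewrite (eq_bigr _ (fun y' _ => GC y')).
  have [ix|ix] := boolP (beta (i, b) \in msupp v).
    rewrite (big_fsetD1 (beta (i, b))) //= eqxx big_seq big1 ?addr0 // => j.
    by rewrite in_fsetD1 => /andP [/negPf -> _].
  rewrite (mcoeff_outdom ix) big_seq big1 // => j jx.
  by case: eqP => // ji; rewrite ji (negPf ix) in jx.
exists G => // x; apply/malgP => i; apply/malgP => b.
by rewrite -FC FG FC.
Qed.

End Bases.

(** * The filtration of the algebra by through strands *)

Section TLAlgebra.
Variables (K : comNzRingType) (g : nat) (c : 'Fr_g -> K).
Hypothesis c_conj : forall u w : 'Fr_g, c (w ^ u)%g = c w.

Local Notation TL m n := {malg K[diagram g m n]}.
Local Notation "u \o_ v" := (TL_comp c u v) (at level 40, left associativity).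

Lemma TL_comp_bilinear m k n : is_bilinear (@TL_comp K g c m k n).
Proof. exact: lext2_bilinear. Qed.

Lemma TL_comp_linl m k n (v : TL k n) : linear (fun u : TL m k => u \o_ v).
Proof. by case: (TL_comp_bilinear m k n) => + _; apply. Qed.

Lemma TL_comp_linr m k n (u : TL m k) : linear (fun v : TL k n => u \o_ v).
Proof. by case: (TL_comp_bilinear m k n) => _; apply. Qed.

Lemma TL_compU m k n (x : diagram g m k) (y : diagram g k n) :
  << x >> \o_ << y >> = circle_factor c x y *: << concat x y >>.
Proof. by rewrite /TL_comp lext2U malgU_scale. Qed.

Lemma TL_compA m k l n (u : TL m k) (v : TL k l) (w : TL l n) :
  u \o_ v \o_ w = u \o_ (v \o_ w).
Proof.
have H := (TL_comp_linl, TL_comp_linr).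
apply: (linear_ext (f := fun u => u \o_ v \o_ w) (h := fun u => u \o_ (v \o_ w))) => [||x].
- by move=> a p q; rewrite !TL_comp_linl.
- exact: TL_comp_linl.
apply: (linear_ext (f := fun v => << x >> \o_ v \o_ w) (h := fun v => << x >> \o_ (v \o_ w))) => [||y].
- by move=> a p q; rewrite TL_comp_linr TL_comp_linl.
- by move=> a p q; rewrite TL_comp_linl TL_comp_linr.
apply: (linear_ext (f := fun w => << x >> \o_ << y >> \o_ w)
  (h := fun w => << x >> \o_ (<< y >> \o_ w))) => [||z].
- exact: TL_comp_linr.
- by move=> a p q; rewrite !TL_comp_linr.
rewrite !TL_compU (linZ (TL_comp_linl _)) (linZ (TL_comp_linr _)) !TL_compU !scalerA.
by rewrite mulrC (circle_factorA _ _ _ c_conj) concatA mulrC.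
Qed.

Lemma TL_comp_full_l m k n (x : diagram g m k) (y : diagram g k n) : is_full x ->
  << x >> \o_ << y >> = << concat x y >>.
Proof. by move=> xf; rewrite TL_compU circle_factor_full // scale1r. Qed.

Lemma TL_comp_full_r m k n (x : diagram g m k) (y : diagram g n k) : is_full y ->
  << x >> \o_ << flip y >> = << concat x (flip y) >>.
Proof. by move=> yf; rewrite TL_compU circle_factor_flip_full // scale1r. Qed.

Lemma TL_comp1l m n (u : TL m n) : << coil m 1%g >> \o_ u = u.
Proof.
apply: (linear_ext (f := fun u => << coil m 1%g >> \o_ u) (h := id)) => [||x] //.
  exact: TL_comp_linr.
by rewrite TL_comp_full_l ?coil_full // concat_coil1l.
Qed.

Lemma TL_comp1r m n (u : TL m n) : u \o_ << coil n 1%g >> = u.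
Proof.
apply: (linear_ext (f := fun u => u \o_ << coil n 1%g >>) (h := id)) => [||x] //.
  exact: TL_comp_linl.
by rewrite -[coil n 1%g](flipK) TL_comp_full_r ?flipK ?concat_coil1r // flip_coil coil_full.
Qed.

Lemma TL_is_algebra n : is_algebra (@TL_mul K g c n) (TL_one K g n).
Proof.
split; [exact: TL_comp_bilinear | | exact: TL_comp1l | exact: TL_comp1r].
by move=> u v w; rewrite /TL_mul TL_compA.
Qed.

Definition at_most m n l (v : TL m n) : Prop := supported (fun x => (through_count x <= l)%N) v.
Definition below m n l (v : TL m n) : Prop := supported (fun x => (through_count x < l)%N) v.

Lemma TL_comp_supported m k n (P : pred (diagram g m k)) (Q : pred (diagram g k n))
    (R : pred (diagram g m n)) u v :
  (forall x y, P x -> Q y -> R (concat x y)) -> supported P u -> supported Q v ->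
  supported R (u \o_ v).
Proof.
move=> PQR su sv; rewrite /TL_comp /lext2; apply: (supported_lext _ su) => x Px.
apply: (supported_lext _ sv) => y Qy; rewrite malgU_scale.
by apply/supportedZ/supportedU/PQR.
Qed.

Lemma at_most_compl m k n l (u : TL m k) (v : TL k n) : at_most l v -> at_most l (u \o_ v).
Proof.
move=> sv; apply: (TL_comp_supported (P := xpredT) _ _ sv); last exact: supportedT.
by move=> x y _; apply: leq_trans (through_count_concat_r x y).
Qed.

Lemma at_most_compr m k n l (u : TL m k) (v : TL k n) : at_most l u -> at_most l (u \o_ v).
Proof.
move=> su; apply: (TL_comp_supported (Q := xpredT) _ su); last exact: supportedT.
by move=> x y + _; apply: leq_trans (through_count_concat_l x y).
Qed.

Lemma below_compl m k n l (u : TL m k) (v : TL k n) : below l v -> below l (u \o_ v).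
Proof.
move=> sv; apply: (TL_comp_supported (P := xpredT) _ _ sv); last exact: supportedT.
by move=> x y _; apply: leq_ltn_trans (through_count_concat_r x y).
Qed.

Lemma below_compr m k n l (u : TL m k) (v : TL k n) : below l u -> below l (u \o_ v).
Proof.
move=> su; apply: (TL_comp_supported (Q := xpredT) _ su); last exact: supportedT.
by move=> x y + _; apply: leq_ltn_trans (through_count_concat_l x y).
Qed.

Definition layer (m n l : nat) : choiceType := {x : diagram g m n | through_count x == l}.

(** Together with proj, this presents the module on a layer as the quotient of the
span of the diagrams with at most l through strands by the span of those with
fewer: incl is a section of proj, whose kernel there is the latter span. *)
Definition incl m n l : {malg K[layer m n l]} -> TL m n := lext (fun x => << val x >>).

Definition proj m n l : TL m n -> {malg K[layer m n l]} :=
  lext (fun x => if insub x is Some y then << y >> else 0).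

Arguments proj {m n} l v.

Lemma incl_linear m n l : linear (@incl m n l). Proof. exact: lext_linear. Qed.
Lemma proj_linear m n l : linear (@proj m n l). Proof. exact: lext_linear. Qed.

Lemma inclU m n l (x : layer m n l) : incl << x >> = << val x >>.
Proof. exact: lextU. Qed.

Lemma projU m n l (x : layer m n l) : proj l << val x >> = << x >>.
Proof. by rewrite /proj lextU valK. Qed.

Lemma inclK m n l : cancel (@incl m n l) (@proj m n l).
Proof.
apply: (linear_ext (f := @proj m n l \o @incl m n l) (h := id)) => [||x] //.
  exact: lin_comp (@incl_linear m n l) (@proj_linear m n l).
by rewrite /= inclU projU.
Qed.

Lemma incl_at_most m n l (a : {malg K[layer m n l]}) : at_most l (incl a).
Proof.
apply: (supported_lext (P := xpredT)) => [x _|]; last exact: supportedT.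
by apply: supportedU; rewrite (eqP (valP x)).
Qed.

Lemma proj_below m n l (v : TL m n) : below l v -> proj l v = 0.
Proof.
move: v; apply: (supported_ind (Q := fun v => proj l v = 0)) => [|k u v pu pv|x lt].
- exact: lin0 (@proj_linear _ _ _).
- by rewrite proj_linear pu pv scaler0 addr0.
by rewrite /proj lextU insubN // neq_ltn lt.
Qed.

Lemma proj_incl_below m n l (v : TL m n) : at_most l v -> below l (v - incl (proj l v)).
Proof.
move: v; apply: (supported_ind (Q := fun v => below l (v - incl (proj l v))))
  => [|k u v pu pv|x le].
- by rewrite (lin0 (@proj_linear _ _ _)) (lin0 (@incl_linear _ _ _)) subr0; apply: supported0.
- rewrite proj_linear incl_linear (_ : _ - _ = k *: (u - incl (proj l u)) + (v - incl (proj l v))).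
    exact: supported_lin pu pv.
  by rewrite scalerBr opprD addrACA.
have [e|ne] := eqVneq (through_count x) l.
  have -> : x = val (Sub x (introT eqP e) : layer m n l) by [].
  by rewrite projU inclU subrr; apply: supported0.
rewrite /proj lextU insubN // (lin0 (@incl_linear _ _ _)) subr0.
by apply: supportedU; rewrite ltn_neqAle ne.
Qed.

(** The error committed by replacing v by the representative incl (proj v) has
fewer than l through strands, and keeps this property after composition. *)
Lemma proj_compl m k n l (v : TL m k) (w : TL k n) : at_most l v ->
  proj l (incl (proj l v) \o_ w) = proj l (v \o_ w).
Proof.
move=> sv; apply/eqP; rewrite eq_sym -subr_eq0 -(linB (@proj_linear _ _ _)).
rewrite -(linB (TL_comp_linl _)) proj_below //.
exact: below_compr (proj_incl_below sv).
Qed.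

Lemma proj_compr m k n l (v : TL m k) (w : TL k n) : at_most l w ->
  proj l (v \o_ incl (proj l w)) = proj l (v \o_ w).
Proof.
move=> sw; apply/eqP; rewrite eq_sym -subr_eq0 -(linB (@proj_linear _ _ _)).
rewrite -(linB (TL_comp_linr _)) proj_below //.
exact: below_compl (proj_incl_below sw).
Qed.

Lemma proj_eq0 m n l (v : TL m n) : at_most l v -> (proj l v = 0 <-> below l v).
Proof.
move=> sv; split=> [e|]; last exact: proj_below.
by have := proj_incl_below sv; rewrite e (lin0 (@incl_linear _ _ _)) subr0.
Qed.

End TLAlgebra.

Arguments incl_at_most {K g m n l} a i _.

(** * Layers as modules over the algebra and over the coils *)

Section GroupAlgebra.
Variables (K : comNzRingType) (G : groupType).

Lemma group_mul_bilinear : is_bilinear (@group_mul K G).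
Proof. exact: lext2_bilinear. Qed.

Lemma group_mulU (a b : G) : @group_mul K G << a >> << b >> = << (a * b)%g >>.
Proof. exact: lext2U. Qed.

Lemma group_algebra : is_algebra (@group_mul K G) (group_one K G).
Proof.
have [ml mr] := group_mul_bilinear.
split; first exact: group_mul_bilinear.
- move=> u v w; rewrite -[LHS]/((fun u => group_mul u (group_mul v w)) u).
  apply: (linear_ext (h := fun u => group_mul (group_mul u v) w)) => [||a].
  + exact: ml.
  + by move=> k p q; rewrite !ml.
  apply: (bilinear_ext (f := fun v w => group_mul << a >> (group_mul v w))
    (h := fun v w => group_mul (group_mul << a >> v) w)).
  + exact: comp_bilinear group_mul_bilinear (mr _).
  + exact: bilinear_comp group_mul_bilinear (mr _) (fun _ _ _ => erefl).
  by move=> b d; rewrite !group_mulU mulgA.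
- apply: (linear_ext (f := group_mul (group_one K G)) (h := id)) => [||a] //.
  by rewrite group_mulU mul1g.
- apply: (linear_ext (f := fun u => group_mul u (group_one K G)) (h := id)) => [||a] //.
  by rewrite group_mulU mulg1.
Qed.

Lemma group_star (star : G -> G) : involutive star ->
  {morph star : a b / (a * b)%g >-> (b * a)%g} ->
  is_antiinvolution (@group_mul K G) (lext (fun b => << star b >>)).
Proof.
move=> starK starM; have [ml mr] := group_mul_bilinear.
split; first exact: lext_linear.
- apply: (linear_ext (f := lext _ \o lext _) (h := id)) => [||a] //.
    exact: lin_comp (lext_linear _) (lext_linear _).
  by rewrite /= !lextU starK.
apply: (bilinear_ext (f := fun x y => lext _ (group_mul x y))
   (h := fun x y => group_mul (lext _ y) (lext _ x))).
- exact: comp_bilinear group_mul_bilinear (lext_linear _).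
- exact: bilinear_comp (bilinear_swap group_mul_bilinear) (lext_linear _) (lext_linear _).
by move=> a b; rewrite group_mulU !lextU group_mulU starM.
Qed.

End GroupAlgebra.


Section Layers.
Variables (K : comNzRingType) (g : nat) (c : 'Fr_g -> K).
Hypothesis c_conj : forall u w : 'Fr_g, c (w ^ u)%g = c w.

Local Notation TL m n := {malg K[diagram g m n]}.
Local Notation X m n l := {malg K[layer g m n l]}.
Local Notation "u \o_ v" := (TL_comp c u v) (at level 40, left associativity).

(** Left and right multiplication modulo diagrams with fewer than l through
strands.  All module structures below are instances of these two. *)
Definition lact m k n l (a : TL m k) (p : X k n l) : X m n l := proj l (a \o_ incl p).
Definition ract m k n l (p : X m k l) (a : TL k n) : X m n l := proj l (incl p \o_ a).

Lemma lact_bilinear m k n l : is_bilinear (@lact m k n l).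
Proof.
apply: comp_bilinear (@proj_linear K g m n l).
exact: (bilinear_comp (TL_comp_bilinear c m k n) (fun _ _ _ => erefl) (@incl_linear K g k n l)).
Qed.

Lemma ract_bilinear m k n l : is_bilinear (@ract m k n l).
Proof.
apply: comp_bilinear (@proj_linear K g m n l).
exact: (bilinear_comp (TL_comp_bilinear c m k n) (@incl_linear K g m k l) (fun _ _ _ => erefl)).
Qed.

Lemma lact_comp m k k' n l (a : TL m k) (b : TL k k') (p : X k' n l) :
  lact (a \o_ b) p = lact a (lact b p).
Proof.
rewrite /lact (TL_compA c_conj) [RHS]proj_compr //.
exact: at_most_compl (incl_at_most _).
Qed.

Lemma ract_comp m k k' n l (p : X m k l) (a : TL k k') (b : TL k' n) :
  ract p (a \o_ b) = ract (ract p a) b.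
Proof.
rewrite /ract -(TL_compA c_conj) [RHS]proj_compl //.
exact: at_most_compr (incl_at_most _).
Qed.

Lemma lract m k k' n l (a : TL m k) (p : X k k' l) (b : TL k' n) :
  ract (lact a p) b = lact a (ract p b).
Proof.
rewrite /lact /ract [LHS]proj_compl; last exact: at_most_compl (incl_at_most _).
rewrite [RHS]proj_compr; last exact: at_most_compr (incl_at_most _).
by rewrite (TL_compA c_conj).
Qed.

Lemma lact1 m n l (p : X m n l) : lact (TL_one K g m) p = p.
Proof. by rewrite /lact TL_comp1l inclK. Qed.

Lemma ract1 m n l (p : X m n l) : ract p (TL_one K g n) = p.
Proof. by rewrite /ract TL_comp1r inclK. Qed.

Definition in_layer m n l (x : diagram g m n) (xl : through_count x == l) : layer g m n l :=
  exist _ x xl.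

Lemma projU_eq m n l (x : diagram g m n) (xl : through_count x == l) :
  proj l << x >> = << in_layer xl >> :> X m n l.
Proof. exact: (projU K (in_layer xl)). Qed.

Section Coils.
Variable l : nat.
Local Notation S := {malg K[coil_group g l]}.

Definition coils : S -> TL l l := lext (fun b => << coil l (coil_word b) >>).

Lemma coils_linear : linear coils. Proof. exact: lext_linear. Qed.

Lemma coilsU b : coils << b >> = << coil l (coil_word b) >>.
Proof. exact: lextU. Qed.

Lemma coils_mul (s s' : S) : coils (group_mul s s') = coils s \o_ coils s'.
Proof.
apply: (bilinear_ext (f := fun s s' => coils (group_mul s s'))
  (h := fun s s' => coils s \o_ coils s')).
- exact: comp_bilinear (group_mul_bilinear _ _) coils_linear.
- exact: bilinear_comp (TL_comp_bilinear _ _ _ _) coils_linear coils_linear.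
move=> a b; rewrite group_mulU [LHS]coilsU [Z in Z \o_ _]coilsU [Z in _ \o_ Z]coilsU.
by rewrite TL_comp_full_l ?coil_full // coilM.
Qed.

Lemma coils_one : coils (group_one K (coil_group g l)) = TL_one K g l.
Proof. exact: coilsU. Qed.

End Coils.

Variables n l : nat.
Local Notation M := (half_diagram g n l).
Local Notation B := (coil_group g l).
Local Notation S := {malg K[B]}.
Local Notation PX := (X n l l).
Local Notation QX := (X l n l).
Local Notation TX := (X n n l).

Lemma lower_through_count (S : M) (b : B) : through_count (concat S (coil l b)) == l.
Proof. by rewrite concat_through_count ?half_full // full_through_countE ?coil_full. Qed.

Lemma upper_through_count (U : M) (b : B) : through_count (concat (coil l b) (flip U)) == l.
Proof. by rewrite concat_through_count ?coil_full // through_count_flip full_through_countE ?half_full. Qed.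

Definition lower_cell (Sb : M * B) : layer g n l l := in_layer (lower_through_count Sb.1 Sb.2).
Definition upper_cell (Ub : M * B) : layer g l n l := in_layer (upper_through_count Ub.1 Ub.2).

Lemma coil_inj (b b' : B) : coil l b = coil l b' -> b = b'.
Proof.
move=> E; have [l0|l_gt0] : l = 0%N \/ (0 < l)%N by lia.
  have a1 (a : B) : val a = 1%g by case: a => u /= /implyP au; apply/eqP/au/eqP.
  by apply: val_inj; rewrite !a1.
by apply: val_inj; have := congr1 (fun x => word x (inl (Ordinal l_gt0))) E; rewrite !word_coil.
Qed.

(** Diagrams from n to l with l through strands are full. *)
Lemma lower_cell_bij : bijective lower_cell.
Proof.
apply: bijective_choice => [[S b] [S' b'] /(congr1 val) /= E|y].
  have [] := half_concat_inj _ _ E; rewrite ?full_through_countE ?coil_full //.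
  by move=> -> /coil_inj ->.
have yf : is_full (val y) by rewrite full_through_count (valP y).
by have [S [b e]] := full_half_coil yf; exists (S, b); apply: val_inj.
Qed.

Lemma upper_cell_bij : bijective upper_cell.
Proof.
have E (U : M) (b : B) : flip (val (upper_cell (U, b))) = val (lower_cell (U, coil_rev b)).
  by rewrite /= flip_concat flipK flip_coil.
apply: bijective_choice => [[U b] [U' b'] /(congr1 (fun x => flip (val x)))|y].
  rewrite !E => /val_inj /(bij_inj lower_cell_bij) [-> rb].
  by congr pair; do 2!apply: val_inj; apply: (can_inj revK).
have yf : through_count (flip (val y)) == l by rewrite through_count_flip (valP y).
have [h _ hK] := lower_cell_bij; have := hK (in_layer yf).
case: (h _) => U b /(congr1 val) /= e; exists (U, coil_rev b).
by apply/val_inj/(can_inj (@flipK g l n)); rewrite E /= frevK -e.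
Qed.

Definition half_layer (S : M) : layer g n l l :=
  in_layer (introT eqP (full_through_countE (half_full S))).

Lemma lower_free : is_free_right (fun (p : PX) (s : S) => ract p (coils s)).
Proof.
exists M, (fun D => << half_layer D >>).
apply: (free_bijective (act := fun D s => ract << half_layer D >> (coils s)) lower_cell_bij).
  by move=> D k s s'; rewrite coils_linear; case: (ract_bilinear n l l l) => _ ->.
move=> D b; rewrite /ract inclU coilsU TL_comp_full_l ?half_full //.
exact: projU_eq (lower_through_count D b).
Qed.

Lemma flip_half_through_count (U : M) : through_count (flip U) == l.
Proof. by rewrite through_count_flip full_through_countE ?half_full. Qed.

Definition flip_half_layer (U : M) : layer g l n l := in_layer (flip_half_through_count U).

Lemma upper_free : is_free_left (fun (s : S) (q : QX) => lact (coils s) q).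
Proof.
exists M, (fun U => << flip_half_layer U >>).
apply: (free_bijective (act := fun U s => lact (coils s) << flip_half_layer U >>) upper_cell_bij).
  by move=> U k s s'; rewrite coils_linear; case: (lact_bilinear l l n l) => ->.
move=> U b; rewrite /lact inclU coilsU TL_comp_full_l ?coil_full //.
exact: projU_eq (upper_through_count U b).
Qed.

Definition layer_tensor (p : PX) (q : QX) : TX := lact (incl p) q.

Lemma concat_layer_through_count (x : layer g n l l) (w : layer g l n l) :
  through_count (concat (val x) (val w)) == l.
Proof. by rewrite concat_through_count ?(eqP (valP w)) // full_through_count (valP x). Qed.

Definition layer_concat (x : layer g n l l) (w : layer g l n l) : layer g n n l :=
  in_layer (concat_layer_through_count x w).

Lemma layer_tensorU x w : layer_tensor << x >> << w >> = << layer_concat x w >>.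
Proof.
rewrite /layer_tensor /lact !inclU TL_comp_full_l; last by rewrite full_through_count (valP x).
exact: projU_eq (concat_layer_through_count x w).
Qed.

(** The basis of the tensor product: all coils are moved to the right factor. *)
Lemma layer_concat_bij :
  bijective (fun Dw : M * layer g l n l => layer_concat (half_layer Dw.1) Dw.2).
Proof.
apply: bijective_choice => [[D w] [D' w'] /(congr1 val) /= E|y].
  have [] := half_concat_inj (eqP (valP w)) (eqP (valP w')) E.
  by move=> -> /val_inj ->.
have [S [b [U e]]] := factorization (eqP (valP y)).
by exists (S, upper_cell (U, b)); apply: val_inj; rewrite /= -concatA.
Qed.

(** A balanced map f is determined by its values on a half-diagram D and a basis
element w of the right factor, since a coil behind D can be moved over to w; and
by the previous bijection these values can be prescribed freely. *)
Lemma layer_tensor_product :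
  is_tensor_product (fun (p : PX) (s : S) => ract p (coils s))
    (fun (s : S) (q : QX) => lact (coils s) q) layer_tensor.
Proof.
have tB : is_bilinear layer_tensor.
  exact: (bilinear_comp (lact_bilinear n l n l) (@incl_linear K g n l l) (fun _ _ _ => erefl)).
split.
  split; first exact: tB.
  move=> p s q; rewrite /layer_tensor /lact /ract.
  rewrite [LHS]proj_compl; last exact: at_most_compr (incl_at_most _).
  rewrite [RHS]proj_compr; last exact: at_most_compl (incl_at_most _).
  by rewrite (TL_compA c_conj).
move=> W f [fB fbal]; have [h hK Kh] := layer_concat_bij.
have [fl fr] := fB; have [tl tr] := tB.
pose F := lext (fun y => f << half_layer (h y).1 >> << (h y).2 >>).
have FU D w : F << layer_concat (half_layer D) w >> = f << half_layer D >> << w >>.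
  by rewrite /F lextU (hK (D, w)).
exists F; split; first exact: lext_linear.
- apply: (bilinear_ext (f := fun p q => F (layer_tensor p q))) => // [|x w].
    exact: comp_bilinear tB (lext_linear _).
  have [hx hxK hxK'] := lower_cell_bij; rewrite -(hxK' x); case: (hx x) => D b.
  have xE : << lower_cell (D, b) >> = ract << half_layer D >> (coils << b >>) :> PX.
    rewrite /ract inclU coilsU TL_comp_full_l ?half_full //.
    by rewrite (projU_eq (lower_through_count D b)).
  have bw : through_count (concat (coil l b) (val w)) == l.
    by rewrite concat_through_count ?coil_full // (eqP (valP w)).
  have wE : lact (coils << b >>) << w >> = << in_layer bw >> :> QX.
    by rewrite /lact inclU coilsU TL_comp_full_l ?coil_full // projU_eq.
  rewrite [in RHS]xE fbal wE -FU layer_tensorU; congr (F << _ >>).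
  by apply: val_inj; rewrite /= concatA.
move=> h' h'L h't; apply: linear_ext => // [|y]; first exact: lext_linear.
rewrite -[y]Kh; case: (h y) => D w /=.
by rewrite FU -h't layer_tensorU.
Qed.

End Layers.

(** * The cell datum *)

Section Datum.
Variables (K : comNzRingType) (g : nat) (c : 'Fr_g -> K) (n : nat).
Hypothesis c_conj : forall u w : 'Fr_g, c (w ^ u)%g = c w.

Local Notation TLn := {malg K[diagram g n n]}.
Local Notation index := (cell_index (@TL_M g n) (@TL_M g n) (@TL_B g n)).
Local Notation span := (in_cell_span (@TL_cell g K c n)).

(** No circle arises, because half-diagrams and coils are full. *)
Lemma TL_cellE (l : through n) (D U : TL_M g l) (b : TL_B g l) :
  TL_cell c D b U = << cell_diagram D b U >>.
Proof. by rewrite /TL_cell TL_comp_full_l ?half_full // TL_comp_full_r ?half_full. Qed.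

Definition index_diagram (i : index) : diagram g n n :=
  cell_diagram (tagged i).1.1 (tagged i).1.2 (tagged i).2.

Lemma cellE (i : index) : cell (@TL_cell g K c n) i = << index_diagram i >>.
Proof. exact: TL_cellE. Qed.

Lemma level_proof (x : diagram g n n) : (through_count x <= n)%N && (odd (through_count x) == odd n).
Proof. by rewrite through_count_le odd_through_count eqxx. Qed.

Definition level (x : diagram g n n) : through n := Through (level_proof x).

Lemma level_index (i : index) : level (index_diagram i) = tag i.
Proof. by apply: val_inj; apply: through_count_cell. Qed.

Lemma index_diagram_bij : bijective index_diagram.
Proof.
apply: bijective_choice => [i i' E|x].
  have ll : tag i = tag i' by rewrite -!level_index E.
  case: i i' ll E => l [[D b] U] [l' [[D' b'] U']] /= ll; subst l'.
  by rewrite /index_diagram /= => /cell_diagram_inj [-> -> ->].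
have [D [b [U e]]] := factorization (erefl (through_count x)).
by exists (existT _ (level x) (D, b, U)).
Qed.

Lemma cell_basis : bijective (lext (cell (@TL_cell g K c n))).
Proof.
apply: (eq_bij (lext_bijective K index_diagram_bij)) => v.
by apply: lext_eq => i; rewrite cellE.
Qed.

Lemma in_cell_spanP (P : pred (through n)) (a : TLn) :
  span P a <-> supported (fun x => P (level x)) a.
Proof.
split=> [[v Pv ->]|sa].
  apply: (supported_lext (P := fun i : index => P (tag i))) => // i Pi.
  by rewrite cellE; apply: supportedU; rewrite level_index.
have [h hK Kh] := index_diagram_bij.
exists (lext (fun x => << h x >>) a).
  apply: (supported_lext (P := fun x => P (level x)) (Q := fun i : index => P (tag i)) _ sa).
  by move=> x Px; apply: supportedU; rewrite -level_index Kh.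
apply/esym.
apply: (linear_ext (f := lext (cell (@TL_cell g K c n)) \o lext (fun x => << h x >>)) (h := id)) => [||x] //.
  exact: lin_comp (lext_linear _) (lext_linear _).
by rewrite /= [Z in lext _ Z]lextU lextU cellE Kh.
Qed.

Lemma lowerP (l : through n) (a : TLn) : lower (@TL_cell g K c n) l a <-> below l a.
Proof. exact: in_cell_spanP. Qed.

Lemma lower_eqP (l : through n) (a : TLn) : lower_eq (@TL_cell g K c n) l a <-> at_most l a.
Proof. exact: in_cell_spanP. Qed.

Lemma cell_quotient (l : through n) :
  cell_quotient_tensor (@TL_mul K g c n) (TL_one K g n)
    (@TL_smul g K n) (@TL_sone g K n) (@TL_cell g K c n) l.
Proof.
exists {malg K[layer g n l l]}, {malg K[layer g l n l]}, {malg K[layer g n n l]}.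
exists (lact c (m := n) (k := n) (n := l) (l := l)), (fun p s => ract c p (coils s)).
exists (fun s q => lact c (coils s) q), (ract c (m := l) (k := n) (n := n) (l := l)).
exists (lact c (m := n) (k := n) (n := n) (l := l)), (ract c (m := n) (k := n) (n := n) (l := l)).
exists (layer_tensor c (n := n) (l := l)), (proj l).
split.
- split; last exact: lower_free.
  + split; [exact: lact_bilinear | exact: lact1 | exact: lact_comp].
  + split; first exact: bilinear_comp (ract_bilinear _ _ _ _ _) (fun _ _ _ => erefl) (@coils_linear _ _ _).
      by move=> v; rewrite coils_one ract1.
    by move=> a b v; rewrite (coils_mul c) (ract_comp c_conj).
  + by move=> a p s; rewrite lract.
- split; last exact: upper_free.
  + split; first exact: bilinear_comp (lact_bilinear _ _ _ _ _) (@coils_linear _ _ _) (fun _ _ _ => erefl).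
      by move=> v; rewrite coils_one lact1.
    by move=> a b v; rewrite (coils_mul c) (lact_comp c_conj).
  + split; [exact: ract_bilinear | exact: ract1 |].
    by move=> a b v; apply: ract_comp.
  + by move=> s q a; rewrite lract.
- split; first exact: layer_tensor_product.
  + split; [exact: lact_bilinear | exact: lact1 | exact: lact_comp].
  + split; [exact: ract_bilinear | exact: ract1 |].
    by move=> a b v; apply: ract_comp.
  + move=> a p q; rewrite /layer_tensor -[LHS](lact_comp c_conj) /lact.
    by rewrite [RHS]proj_compl //; apply: at_most_compl (incl_at_most _).
  + by move=> p q a; rewrite /layer_tensor lract.
- split.
  + by move=> k a b _ _; rewrite proj_linear.
  + move=> x a /lower_eqP la; split.
    * by apply/lower_eqP; apply: at_most_compl.
    * by apply/lower_eqP; apply: at_most_compr.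
    * by rewrite /lact [RHS]proj_compr.
    * by rewrite /ract [RHS]proj_compl.
  + by move=> y; exists (incl y); [apply/lower_eqP; apply: incl_at_most | rewrite inclK].
  + move=> a /lower_eqP la; split=> [e|/lowerP]; last exact: proj_below.
    by apply/lowerP/proj_eq0.
Qed.

Lemma cextU (l : through n) (D U : TL_M g l) (b : TL_B g l) :
  cext (@TL_cell g K c n) D << b >> U = << cell_diagram D b U >>.
Proof. by rewrite /cext lextU TL_cellE. Qed.

(** The scalars are found in x composed with D: its diagrams with l through strands
are of the form S followed by a coil a, and a is then multiplied with b. *)
Lemma cell_left (x : TLn) (l : through n) :
  exists r : TL_M g l -> {malg K[(TL_M g l * TL_B g l)%type]}, forall D b U,
    lower (@TL_cell g K c n) l (TL_mul c x (TL_cell c D b U) -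
      \sum_(i <- msupp (r D)) (r D)@_i *:
        cext (@TL_cell g K c n) i.1 (TL_smul << i.2 >> << b >>) U).
Proof.
have [h _ Kh] := @lower_cell_bij g n l.
pose rho : {malg K[diagram g n l]} -> {malg K[(TL_M g l * TL_B g l)%type]} :=
  lext (fun z => if insub z is Some y then << h y >> else 0).
exists (fun D => rho (TL_comp c x << half_dgm D >>)) => D b U; rewrite -lextE.
pose M i := cext (@TL_cell g K c n) i.1 (TL_smul << i.2 >> << b >>) U.
rewrite -[lext _ _]/(lext M _) /TL_mul /TL_cell -!(TL_compA c_conj).
move: (TL_comp c x _) => v; apply/lowerP.
have sv : supported (fun z => (through_count z <= l)%N) v by apply: supportedT => z; apply: through_count_le_top.
have L1 := TL_comp_linl c (<< coil l (coil_word b) >> : {malg K[diagram g l l]}) (m := n).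
have L2 := TL_comp_linl c (<< flip (half_dgm U) >> : {malg K[diagram g l n]}) (m := n).
pose F := fun v : {malg K[diagram g n l]} => TL_comp c (TL_comp c v << coil l (coil_word b) >>) << flip (half_dgm U) >>.
pose G := fun v => lext M (rho v).
have FL : linear F by exact: lin_comp L1 L2.
have GL : linear G by exact: lin_comp (lext_linear _) (lext_linear _).
rewrite -/(F v) -/(G v).
move: v sv; apply: (supported_ind (Q := fun v => below l (F v - G v))) => [|k u v bu bv|z zl].
- by rewrite (lin0 FL) (lin0 GL) subr0; apply: supported0.
- rewrite FL GL opprD addrACA -scalerBr; exact: supported_lin bu bv.
have [e|ne] := eqVneq (through_count z) l; last first.
  have -> : G << z >> = 0 by rewrite /G /rho [Z in lext M Z]lextU insubN // (lin0 (lext_linear _)).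
  rewrite subr0; do 2!apply: below_compr; apply: supportedU.
  by rewrite ltn_neqAle ne.
pose y : layer g n l l := in_layer (introT eqP e).
have -> : z = val y by [].
rewrite /G /rho [Z in lext M Z]lextU valK lextU /M.
rewrite -{1}[y]Kh; case: (h y) => S a /=.
rewrite [TL_smul _ _]group_mulU cextU /F.
rewrite TL_comp_full_l; last by rewrite full_through_count lower_through_count.
rewrite TL_comp_full_r ?half_full //= [concat (concat _ _) (coil _ _)]concatA coilM subrr.
exact: supported0.
Qed.

(** As on the left, with the flipped half-diagram U composed with x. *)
Lemma cell_right (x : TLn) (l : through n) :
  exists r : TL_M g l -> {malg K[(TL_M g l * TL_B g l)%type]}, forall D b U,
    lower (@TL_cell g K c n) l (TL_mul c (TL_cell c D b U) x -
      \sum_(i <- msupp (r U)) (r U)@_i *: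
        cext (@TL_cell g K c n) D (TL_smul << b >> << i.2 >>) i.1).
Proof.
have [h _ Kh] := @upper_cell_bij g n l.
pose rho : {malg K[diagram g l n]} -> {malg K[(TL_M g l * TL_B g l)%type]} :=
  lext (fun z => if insub z is Some y then << h y >> else 0).
exists (fun U => rho (TL_comp c << flip (half_dgm U) >> x)) => D b U; rewrite -lextE.
pose M i := cext (@TL_cell g K c n) D (TL_smul << b >> << i.2 >>) i.1.
rewrite -[lext _ _]/(lext M _) /TL_mul /TL_cell [TL_comp c (TL_comp c _ _) x]TL_compA //.
rewrite [Z in TL_comp c Z _]TL_comp_full_l ?half_full //.
move: (TL_comp c _ x) => v; apply/lowerP.
have sv : supported (fun z => (through_count z <= l)%N) v by apply: supportedT => z; apply: through_count_le.
pose F := fun v : {malg K[diagram g l n]} => TL_comp c << concat (half_dgm D) (coil l (coil_word b)) >> v.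
pose G := fun v => lext M (rho v).
have FL : linear F by exact: TL_comp_linr.
have GL : linear G by exact: lin_comp (lext_linear _) (lext_linear _).
rewrite -/(F v) -/(G v).
move: v sv; apply: (supported_ind (Q := fun v => below l (F v - G v))) => [|k u v bu bv|z zl].
- by rewrite (lin0 FL) (lin0 GL) subr0; apply: supported0.
- rewrite FL GL opprD addrACA -scalerBr; exact: supported_lin bu bv.
have [e|ne] := eqVneq (through_count z) l; last first.
  have -> : G << z >> = 0 by rewrite /G /rho [Z in lext M Z]lextU insubN // (lin0 (lext_linear _)).
  rewrite subr0; apply: below_compl; apply: supportedU.
  by rewrite ltn_neqAle ne.
pose y : layer g l n l := in_layer (introT eqP e).
have -> : z = val y by [].
rewrite /G /rho [Z in lext M Z]lextU valK lextU /M.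
rewrite -{1}[y]Kh; case: (h y) => U' a /=.
rewrite [TL_smul _ _]group_mulU cextU /F.
rewrite TL_comp_full_l; last by rewrite full_through_count lower_through_count.
rewrite /cell_diagram /= -concatA [concat (concat _ _) (coil _ _)]concatA coilM subrr.
exact: supported0.
Qed.

Lemma TL_star_linear : linear (@TL_star K g n). Proof. exact: lext_linear. Qed.

Lemma TL_starU (x : diagram g n n) : @TL_star K g n << x >> = << flip x >>. Proof. exact: lextU. Qed.

(** For n = 1 a diagram consists of a single through strand and no circle can
arise; otherwise circles are read backwards after flipping. *)
Lemma TL_star_antiinvolution : (0 < n)%N ->
  ((1 < n)%N -> forall w : 'Fr_g, c (frev w) = c w) ->
  is_antiinvolution (@TL_mul K g c n) (@TL_star K g n).
Proof.
move=> n_gt0 c_rev; split; first exact: TL_star_linear.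
- apply: (linear_ext (f := @TL_star K g n \o @TL_star K g n) (h := id)) => [||x] //.
    exact: lin_comp TL_star_linear TL_star_linear.
  by rewrite /= TL_starU TL_starU flipK.
apply: (bilinear_ext (f := fun x y => TL_star (TL_mul c x y))
   (h := fun x y => TL_mul c (TL_star y) (TL_star x))) => [||x y].
- exact: comp_bilinear (TL_comp_bilinear c n n n) TL_star_linear.
- exact: (bilinear_comp (bilinear_swap (TL_comp_bilinear c n n n)) TL_star_linear TL_star_linear).
rewrite /TL_mul TL_compU (linZ TL_star_linear) TL_starU flip_concat.
rewrite [TL_star << x >>]TL_starU [TL_star << y >>]TL_starU TL_compU circle_factor_flip.
congr (_ *: _); have [n1|n_le1] := ltnP 1 n.
  by apply: eq_bigr => w _; rewrite c_rev.
have xf : is_full x.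
  rewrite full_through_count eqn_leq through_count_le /=; apply: (leq_trans n_le1); apply: odd_gt0.
  by rewrite odd_through_count; have -> : n = 1%N by lia.
by rewrite !circle_factor_full.
Qed.

Lemma cell_star (l : through n) (D U : TL_M g l) (b : TL_B g l) :
  TL_star (TL_cell c D b U) = TL_cell c U (TL_bstar b) D.
Proof. by rewrite !TL_cellE TL_starU flip_cell. Qed.

End Datum.

(** Such a half-diagram is determined by its mate function. *)
Lemma half_diagram_finite g n l : (forall u v : 'Fr_g, u = v) ->
  exists s : seq (half_diagram g n l), forall D : half_diagram g n l, D \in s.
Proof.
move=> triv.
pose half (f : {ffun pt n l -> pt n l}) : option (half_diagram g n l) :=
  obind insub (insub [ffun p => (f p, 1%g : 'Fr_g)] : option (diagram g n l)).
exists (pmap half (enum {: {ffun pt n l -> pt n l}})) => D.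
rewrite mem_pmap; apply/mapP; exists [ffun p => mate D p]; first by rewrite mem_enum.
have dE : [ffun p => ([ffun p => mate D p] p, 1%g : 'Fr_g)] = dgm D.
  apply/ffunP => p; rewrite !ffunE /mate (triv 1%g (D p).2).
  by case: (dgm D p).
by rewrite /half dE valK /= valK.
Qed.

Lemma free_group0 (u v : 'Fr_0) : u = v.
Proof.
have nil0 (w : 'Fr_0) : val w = [::] by case: w => -[|[[i ?] ?] w] //=; case: i.
by apply: val_inj; rewrite !nil0.
Qed.

Lemma half_square_finite g n l : l = n ->
  exists s : seq (half_diagram g n l), forall D : half_diagram g n l, D \in s.
Proof.
move=> ->; exists [:: HalfDiagram (coil1_half g n)] => D.
by rewrite inE; apply/eqP/val_inj; rewrite half_square.
Qed.

Theorem proposition4p9 (K : idomainType) (hK : noetherian K) (g n : nat) (hn : (0 < n)%N)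
  (c : 'Fr_g -> K) (hc : forall u w : 'Fr_g, c (w ^ u)%g = c w) :
  sandwich_cell_datum (@TL_mul K g c n) (TL_one K g n)
    (@TL_smul g K n) (@TL_sone g K n) (@TL_cell g K c n) /\
  (((1 < n)%N -> forall w : 'Fr_g, c (frev w) = c w) ->
   sandwich_involution (@TL_mul K g c n) (@TL_smul g K n) (@TL_cell g K c n)
     (@TL_star K g n) (@TL_bstar g n)) /\
  (forall l : through n, (g == 0%N) || (l == n :> nat) ->
     exists s : seq (half_diagram g n l), forall D : half_diagram g n l, D \in s).
Proof.
have revK l : involutive (@coil_rev g l).
  by move=> b; apply: val_inj; apply: frevK.
split; [|split].
- split.
  + exact: TL_is_algebra.
  + by move=> l; apply: group_algebra.
  + exact: cell_basis.
  + exact: cell_left.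
  + exact: cell_right.
  + exact: cell_quotient.
- move=> c_rev; split.
  + exact: TL_star_antiinvolution.
  + by move=> l; apply: inv_bij (revK l).
  + move=> l; apply: group_star (revK l) _ => a b.
    by apply: val_inj; apply: frevM.
  + exact: cell_star.
move=> l /orP [/eqP g0|/eqP ln]; last exact: half_square_finite.
by apply: half_diagram_finite; move: g0 {c hc} => ->; apply: free_group0.
Qed.
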